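(* There exists a universal constant $C>0$ such that the following holds for all integers $d\ge 2$, $1\le r\le d$, $n\ge 1$, all $\alpha\in(0,1)$ and $\epsilon\in(0,1]$, where it is assumed that $\mathbb C^d$ admits a complete set of $d+1$ mutually unbiased bases, one of which is fixed. Put $\delta=4\,\mathrm{arctanh}(\alpha)$ and let $t(\epsilon)>0$ be defined by $$t^2(\epsilon)=92\,\log(d/\epsilon)\,\frac{d^2}{n\alpha^2}.$$ Let $\hat\rho_n=\mathcal A(\check\rho_n)$ be the estimator defined in the context, where $\mathcal A$ is the spectral thresholding algorithm with threshold $2t(\epsilon)$. Then $\hat\rho_n$ is a locally-$\alpha$-gentle estimator (i.e. it is a function of the outcomes of a locally-$\alpha$-gentle measurement of $\rho^{\otimes n}$) and $$\sup_{\rho\in\mathcal S_r(\mathbb C^d)}\mathbb E_\rho\big[\|\hat\rho_n-\rho\|_F^2\big]\le C\,\frac{rd^2}{n\alpha^2}\log\Big(\frac d\epsilon\Big).$$ If, in addition, $\rho\in\mathcal S_r(\mathbb C^d)$ satisfies $\lambda_{\min}(\rho)\ge 6t(\epsilon)$, where $\lambda_{\min}(\rho)$ denotes the smallest nonzero eigenvalue of $\rho$, then $$\mathbb P_\rho\big(\operatorname{rank}(\hat\rho_n)=r\big)\ge 1-\epsilon.$$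
   Context: **States and measurements.** $\mathcal S(\mathbb C^d)$ is the set of density matrices (positive semidefinite $d\times d$ complex matrices of trace 1); $\mathcal S_r(\mathbb C^d)$ is the subset of states of rank $r$. A measurement on $\mathbb C^d$ is a countable family $M=(M_\omega)_{\omega\in\Omega}$ of matrices in $\mathbb C^{d\times d}$ with $\sum_\omega M_\omega^*M_\omega=\mathbb 1$; put $E_\omega=M_\omega^*M_\omega$. Measuring $\rho$ yields a random outcome $R^M$ with $\mathbb P_\rho(R^M=\omega)=\operatorname{Tr}[\rho E_\omega]$ and, if this is positive, the post-measurement state $\rho_{M\to\omega}=M_\omega\rho M_\omega^*/\operatorname{Tr}[\rho E_\omega]$. With $\|A\|_{Tr}=\frac12\operatorname{Tr}|A|$, $M$ is $\alpha$-gentle on $\mathcal S\subseteq\mathcal S(\mathbb C^d)$ if $\|\rho-\rho_{M\to\omega}\|_{Tr}\le\alpha$ for all $\rho\in\mathcal S$ and all outcomes $\omega$ (of positive probability). A measurement of $n$ systems is locally-$\alpha$-gentle if it is a product measurement $M_1\otimes\dots\otimes M_n$ with each $M_i$ $\alpha$-gentle (on $\mathcal S(\mathbb C^d)$). $\|\cdot\|_F$ is the Frobenius norm. **MUBs.** A complete set of mutually unbiased bases is a collection of $d+1$ orthonormal bases $(|e_k^{(b)}\rangle)_{k=1,\dots,d}$, $b=1,\dots,d+1$, of $\mathbb C^d$ with $|\langle e_k^{(b)}|e_l^{(b')}\rangle|^2=1/d$ whenever $b\ne b'$. **Measurement.** Let $\beta=(e^{\delta/2}+1)^{-1}$. For $\omega\in\{0,1\}^d$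 and $b\in\{1,\dots,d+1\}$ let $M_{\delta,\omega,b}=\sqrt{E_{\delta,\omega,b}}$ with $$E_{\delta,\omega,b}=\frac1{d+1}\Big(\frac{e^{\delta/2}}{e^{\delta/2}+1}\Big)^d\sum_{k=1}^d e^{-\frac\delta2\|\omega-e_k\|_1}|e_k^{(b)}\rangle\langle e_k^{(b)}|,$$ where $e_k\in\{0,1\}^d$ is the $k$-th standard basis vector. The measurement $M_\delta=(M_{\delta,\omega,b})_{\omega,b}$ is applied separately to each of $n$ copies of $\rho$, giving i.i.d. outcomes $(W^{(i)},B^{(i)})\in\{0,1\}^d\times\{1,\dots,d+1\}$, $i=1,\dots,n$. **Estimator.** For $k\in\{1,\dots,d\}$ and $b\in\{1,\dots,d+1\}$ let $H^{(i)}_{(b,k)}=1$ if $B^{(i)}=b$ and $W^{(i)}_k=1$, and $H^{(i)}_{(b,k)}=0$ otherwise; $\bar H_{(b,k)}=\frac1n\sum_{i=1}^nH^{(i)}_{(b,k)}$. Define $$\bar\rho_n=\frac{d+1}{\alpha}\sum_{b=1}^{d+1}\sum_{k=1}^d\bar H_{(b,k)}|e_k^{(b)}\rangle\langle e_k^{(b)}|-\Big(1+\frac{d+1}\alpha\beta\Big)\mathbb 1,$$ and let $\check\rho_n$ be the (Frobenius-norm) projection of $\bar\rho_n$ onto the convex set $\mathcal S(\mathbb C^d)$. **Spectral thresholding algorithm $\mathcal A$ with threshold $2t$.** Input: $\check\rho_n=\check U_n\operatorname{diag}(\check\lambda_1,\dots,\check\lambda_d)\check U_n^*$ with $\check\lambda_1\ge\dots\ge\check\lambda_d$.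 Set $\hat\lambda^{(0)}_j=\check\lambda_j$. For $l=1,\dots,d$: if $\hat\lambda^{(l-1)}_{d-l+1}>2t$, stop; otherwise set $\hat\lambda_{d-l+1}^{(l)}=0$ and $\hat\lambda_j^{(l)}=\hat\lambda_j^{(l-1)}+\frac1{d-l}\hat\lambda_{d-l+1}^{(l-1)}$ for $j=1,\dots,d-l$ (eigenvalues already set to zero stay zero; for $l=d$ there is no $j$ to update). Output $\hat\rho_n=\check U_n\operatorname{diag}(\hat\lambda_1,\dots,\hat\lambda_d)\check U_n^*$ with the final values $\hat\lambda_j$. *)

(* Defs.v *)
From HB Require Import structures.
From mathcomp Require Export all_boot all_order all_algebra finmap.
From mathcomp Require Export complex.
From mathcomp Require Export all_classical all_reals all_analysis.

Set Implicit Arguments.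
Unset Strict Implicit.
Unset Printing Implicit Defensive.

Import Order.TTheory GRing.Theory Num.Theory.

Local Open Scope ring_scope.
Local Open Scope sesquilinear_scope.
Local Open Scope complex_scope.

Section Matrices.
Context {R : realType}.

Definition psdmx d (A : 'M[R[i]]_d) : Prop :=
  A ^t* = A /\ forall v : 'cV[R[i]]_d, 0 <= (v ^t* *m A *m v) 0 0.

(* Spectral functional calculus; for psd A this is the unique psd square root. *)
Definition sqrtmx d (A : 'M[R[i]]_d) : 'M[R[i]]_d :=
  invmx (spectralmx A) *m diag_mx (map_mx sqrtC (spectral_diag A))
    *m spectralmx A.

(* Normalised with the factor 1/2 (trace distance). *)
Definition trace_norm d (A : 'M[R[i]]_d) : R :=
  2^-1 * complex.Re (\tr (sqrtmx (A ^t* *m A))).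

Definition frob_norm d (A : 'M[R[i]]_d) : R :=
  Num.sqrt (complex.Re (\tr (A ^t* *m A))).

Definition state d (rho : 'M[R[i]]_d) : Prop := psdmx rho /\ \tr rho = 1.

Definition state_of_rank d (r : nat) (rho : 'M[R[i]]_d) : Prop :=
  state rho /\ \rank rho = r.

(* Smallest nonzero eigenvalue; for a state the set is finite and nonempty, so
   the infimum is a minimum. *)
Definition lambda_min d (rho : 'M[R[i]]_d) : R :=
  inf [set l : R | l != 0 /\ eigenvalue rho l%:C]%classic.

(* sum_w F w = S over a countable index type: unconditional convergence of the
   finite partial sums. *)
Definition sums_to d (Omega : countType) (F : Omega -> 'M[R[i]]_d)
    (S : 'M[R[i]]_d) : Prop :=
  forall eta : R, 0 < eta -> exists A : {fset Omega}, forall B : {fset Omega},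
    (A `<=` B)%fset -> frob_norm (\sum_(w <- B) F w - S) < eta.

Definition measurement d (Omega : countType) (M : Omega -> 'M[R[i]]_d) : Prop :=
  sums_to (fun w => (M w) ^t* *m M w) 1%:M.

Definition outcome_prob d (Omega : Type) (M : Omega -> 'M[R[i]]_d)
    (rho : 'M[R[i]]_d) (w : Omega) : R :=
  complex.Re (\tr (rho *m ((M w) ^t* *m M w))).

Definition post_state d (Omega : Type) (M : Omega -> 'M[R[i]]_d)
    (rho : 'M[R[i]]_d) (w : Omega) : 'M[R[i]]_d :=
  (\tr (rho *m ((M w) ^t* *m M w)))^-1 *: (M w *m rho *m (M w) ^t*).

Definition gentle d (Omega : Type) (alpha : R) (S : 'M[R[i]]_d -> Prop)
    (M : Omega -> 'M[R[i]]_d) : Prop :=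
  forall rho w, S rho -> 0 < outcome_prob M rho w ->
    trace_norm (rho - post_state M rho w) <= alpha.

(* A_1 (x) ... (x) A_n on the n-fold tensor power of C^d, whose standard basis
   is indexed by the functions 'I_n -> 'I_d. *)
Definition tensor n d (A : 'I_n -> 'M[R[i]]_d) :
    'M[R[i]]_#|{ffun 'I_n -> 'I_d}| :=
  \matrix_(x, y) \prod_(i < n)
    A i ((enum_val x : {ffun 'I_n -> 'I_d}) i)
        ((enum_val y : {ffun 'I_n -> 'I_d}) i).

(* N is a product measurement on the n-fold tensor power; an estimator based on
   N is any function of its outcomes {ffun 'I_n -> Omega}. *)
Definition locally_gentle n d (Omega : countType) (alpha : R)
    (N : {ffun 'I_n -> Omega} -> 'M[R[i]]_#|{ffun 'I_n -> 'I_d}|) : Prop :=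
  measurement N /\
  exists M : 'I_n -> Omega -> 'M[R[i]]_d,
    (forall i, measurement (M i) /\ gentle alpha (@state d) (M i)) /\
    forall w, N w = tensor (fun i => M i (w i)).

Definition expectation d (Omega : finType) (M : Omega -> 'M[R[i]]_d)
    (rho : 'M[R[i]]_d) (f : Omega -> R) : R :=
  \sum_w outcome_prob M rho w * f w.

Definition probability_of d (Omega : finType) (M : Omega -> 'M[R[i]]_d)
    (rho : 'M[R[i]]_d) (P : pred Omega) : R :=
  \sum_(w | P w) outcome_prob M rho w.

Definition ketbra d (v : 'cV[R[i]]_d) : 'M[R[i]]_d := v *m v ^t*.

Definition complete_MUB d (e : 'I_d.+1 -> 'I_d -> 'cV[R[i]]_d) : Prop :=
  (forall b k l, ((e b k) ^t* *m e b l) 0 0 = (k == l)%:R) /\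
  (forall b b' k l, b != b' ->
     `| ((e b k) ^t* *m e b' l) 0 0 | ^+ 2 = d%:R^-1).

Definition arctanh (x : R) : R := 2^-1 * ln ((1 + x) / (1 - x)).

Definition l1_dist_basis d (w : {ffun 'I_d -> bool}) (k : 'I_d) : R :=
  \sum_(j < d) `| (w j)%:R - (j == k)%:R |.

Definition E_delta d (e : 'I_d.+1 -> 'I_d -> 'cV[R[i]]_d) (delta : R)
    (wb : {ffun 'I_d -> bool} * 'I_d.+1) : 'M[R[i]]_d :=
  (d.+1%:R^-1 * (expR (delta / 2) / (expR (delta / 2) + 1)) ^+ d)%:C *:
  \sum_(k < d) (expR (- (delta / 2) * l1_dist_basis wb.1 k))%:C *:
     ketbra (e wb.2 k).

Definition M_delta d (e : 'I_d.+1 -> 'I_d -> 'cV[R[i]]_d) (delta : R)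
    (wb : {ffun 'I_d -> bool} * 'I_d.+1) : 'M[R[i]]_d :=
  sqrtmx (E_delta e delta wb).

Definition M_delta_n n d (e : 'I_d.+1 -> 'I_d -> 'cV[R[i]]_d) (delta : R)
    (w : {ffun 'I_n -> {ffun 'I_d -> bool} * 'I_d.+1}) :
    'M[R[i]]_#|{ffun 'I_n -> 'I_d}| :=
  tensor (fun i => M_delta e delta (w i)).

Definition H_bar n d (w : {ffun 'I_n -> {ffun 'I_d -> bool} * 'I_d.+1})
    (b : 'I_d.+1) (k : 'I_d) : R :=
  n%:R^-1 * \sum_(i < n) (((w i).2 == b) && (w i).1 k)%:R.

Definition rho_bar n d (e : 'I_d.+1 -> 'I_d -> 'cV[R[i]]_d) (alpha delta : R)
    (w : {ffun 'I_n -> {ffun 'I_d -> bool} * 'I_d.+1}) : 'M[R[i]]_d :=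
  let beta := (expR (delta / 2) + 1)^-1 in
  (d.+1%:R / alpha)%:C *:
    (\sum_(b < d.+1) \sum_(k < d) (H_bar w b k)%:C *: ketbra (e b k))
  - (1 + d.+1%:R / alpha * beta)%:C%:M.

Definition state_projection d (A P : 'M[R[i]]_d) : Prop :=
  state P /\ forall S, state S -> frob_norm (A - P) <= frob_norm (A - S).

(* The eigenvalues are lam 0 >= ... >= lam d.-1, and m = d - l + 1 of them are
   still active before step l; that step inspects index m.-1. *)
Fixpoint threshold_rec (tau : R) (m : nat) (lam : nat -> R) : nat -> R :=
  if m is k.+1 then
    if tau < lam k then lam
    else threshold_rec tau k (fun j =>
      if (j < k)%N then lam j + k%:R^-1 * lam k
      else if j == k then 0 else lam j)
  else lam.

Definition diag_of d (lam : nat -> R) : 'M[R[i]]_d :=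
  diag_mx (\row_(j < d) (lam j)%:C).

(* A relation: the output may depend on the chosen ordered
   eigendecomposition of A when eigenvalues coincide. *)
Definition spectral_threshold d (tau : R) (A B : 'M[R[i]]_d) : Prop :=
  exists (U : 'M[R[i]]_d) (lam : nat -> R),
    [/\ U \is unitarymx,
        forall i j : nat, (i <= j < d)%N -> lam j <= lam i,
        A = U *m diag_of d lam *m U ^t* &
        B = U *m diag_of d (threshold_rec tau d lam) *m U ^t*].

Definition is_rho_hat n d (e : 'I_d.+1 -> 'I_d -> 'cV[R[i]]_d)
    (alpha delta tau : R)
    (rho_hat : {ffun 'I_n -> {ffun 'I_d -> bool} * 'I_d.+1} -> 'M[R[i]]_d)
    : Prop :=
  forall w, exists rho_check : 'M[R[i]]_d,
    state_projection (rho_bar e alpha delta w) rho_check /\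
    spectral_threshold tau rho_check (rho_hat w).

End Matrices.

(* Main.v *)
Require Import Defs.
From mathcomp Require Import ring lra zify.

(** The theorem combines three facts.

    Gentleness. Every element of the measurement is diagonal in one of the bases.
    As w ranges over bit strings the distance from w to the k-th unit vector
    takes two values that differ by 2, so the eigenvalues of the element lie in an
    interval [lo, h lo] with h = exp (delta / 2) = (1 + alpha) / (1 - alpha).
    Writing a state as A A^*, the state and its update M A A^* M^* are the reduced
    states of two unit vectors, whose trace distance is at most sqrt (1 - F) for
    F their squared overlap; the Kantorovich inequality gives F >= 1 - alpha^2
    ([gentle_spectral]). Traces of tensor products factor, so the n outcomes are
    independent with a common law ([outcome_probE]).

    Concentration. Mutually unbiased bases form a 2-design ([MUB_design]). Hence
    for a unit vector u the number u^* (rho_bar - rho) u is an average of n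
    independent centred scores of size O(d / alpha) and of variance only
    O(d / alpha^2) ([score_mean], [score_bound], [score_var]); as a matrix the
    estimator has variance of order d^2 / alpha^2. This gain of a factor d in
    every fixed direction pays for a union bound over a grid of at most d^(8 d)
    directions, whose entropy is of order d log d. The grid loses only a constant
    factor because the Rayleigh quotient is stationary at an eigenvector
    ([net_form_bound]). One exponential moment of the largest grid error
    ([maxerr_mgf]) yields both its tail at the level t ([maxerr_tail]) and its
    second moment ([second_moment]).

    Perturbation. Let x bound the operator norm of rho_bar - rho and let r be the
    rank of rho. The difference Delta between the projected estimator and rho is
    traceless and has at most r negative eigenvalues, so its trace norm is at most
    2 sqrt r |Delta|_F, while optimality of the projection gives
    |Delta|_F^2 <= <rho_bar - rho, Delta>; thus |Delta|_F^2 <= 4 r x^2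
    ([projection_error]). Thresholding at tau = 2 t removes the eigenvalues from
    some index k on and spreads their sum evenly over the others
    ([threshold_recP]); if k <= r this costs O(r tau^2), and if k > r the removed
    part is a tail of the spectrum controlled by |Delta|_F, by the principle of Ky
    Fan ([thresholded_error]). When x <= t and all nonzero eigenvalues of rho are
    at least 6 t, the optimality conditions of the projection show that exactly
    the eigenvalues beyond the r-th fall below the threshold ([rank_recovery]).

    The mean square bound follows from the second moment when n is at least
    64 (d + 1)^2 log (d / eps). For smaller n the right-hand side is at least a
    constant and the distance between two states is bounded. *)

Set Implicit Arguments.
Unset Strict Implicit.
Unset Printing Implicit Defensive.
Import Order.TTheory GRing.Theory Num.Theory.
Local Open Scope ring_scope.

(** * Complex numbers with real data *)

Section ComplexScalars.
Local Open Scope sesquilinear_scope.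
Local Open Scope complex_scope.
Local Notation conjC := Num.Def.conjC.
Context {R : realType}.
Local Notation C := R[i].
Local Notation Re := (@complex.Re R).
Local Notation Im := (@complex.Im R).

Definition sqmod (z : C) : R := Re z ^+ 2 + Im z ^+ 2.

Lemma sqmod_ge0 z : 0 <= sqmod z.
Proof. by rewrite /sqmod addr_ge0 ?sqr_ge0. Qed.

Lemma conjCE (z : C) : conjC z = (Re z +i* (- Im z))%C.
Proof. by case: z. Qed.

Lemma mul_conjC_sqmod (z : C) : z * conjC z = (sqmod z)%:C.
Proof. by rewrite conjCE; case: z => a b; rewrite /sqmod; apply/eqP; rewrite eq_complex /=;
  apply/andP; split; apply/eqP; ring. Qed.

Lemma conj_mulC_sqmod (z : C) : conjC z * z = (sqmod z)%:C.
Proof. by rewrite mulrC mul_conjC_sqmod. Qed.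

Lemma conjC_real (x : R) : conjC (x%:C) = x%:C.
Proof. by rewrite conjCE /= oppr0. Qed.

Lemma ReD (x y : C) : Re (x + y) = Re x + Re y.
Proof. by case: x; case: y. Qed.

Lemma ReN (x : C) : Re (- x) = - Re x.
Proof. by case: x. Qed.

Lemma ReZ (x : R) (z : C) : Re (x%:C * z) = x * Re z.
Proof. by case: z => a b /=; rewrite mul0r subr0. Qed.

Lemma Re_sum I (r : seq I) P (F : I -> C) :
  Re (\sum_(i <- r | P i) F i) = \sum_(i <- r | P i) Re (F i).
Proof. by apply: (big_morph Re) => // x y; rewrite ReD. Qed.

Lemma sqmodJ (z : C) : sqmod (conjC z) = sqmod z.
Proof. by case: z => a b; rewrite /sqmod conjCE /= sqrrN. Qed.

Lemma sqmodM (x y : C) : sqmod (x * y) = sqmod x * sqmod y.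
Proof. by case: x => a b; case: y => c d; rewrite /sqmod /=; ring. Qed.

Lemma sqmod_real (x : R) : sqmod (x%:C) = x ^+ 2.
Proof. by rewrite /sqmod /= expr0n addr0. Qed.

Lemma sqmodN (z : C) : sqmod (- z) = sqmod z.
Proof. by case: z => a b; rewrite /sqmod /= !sqrrN. Qed.

Lemma sqmod_norm (z : C) : (sqmod z)%:C = `|z| ^+ 2.
Proof. by rewrite -add_Re2_Im2. Qed.

Lemma real_selfJ (z : C) : conjC z = z -> z = (Re z)%:C.
Proof.
case: z => a b; rewrite conjCE => -[] /= h; congr (_ +i* _)%C; lra.
Qed.

End ComplexScalars.

(** * Adjoints and the spectral theorem *)

Section Spectral.
Local Open Scope sesquilinear_scope.
Local Open Scope complex_scope.
Local Notation conjC := Num.Def.conjC.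
Context {R : realType}.
Local Notation C := R[i].
Local Notation Re := (@complex.Re R).

Lemma adjmxE m n (A : 'M[C]_(m, n)) i j : (A ^t*) i j = conjC (A j i).
Proof. by rewrite !mxE. Qed.

Lemma adjmxM m n p (A : 'M[C]_(m, n)) (B : 'M[C]_(n, p)) :
  (A *m B) ^t* = B ^t* *m A ^t*.
Proof. by rewrite trmx_mul map_mxM. Qed.

Lemma adjmxD m n (A B : 'M[C]_(m, n)) : (A + B) ^t* = A ^t* + B ^t*.
Proof. by rewrite linearD /= map_mxD. Qed.

Lemma adjmxN m n (A : 'M[C]_(m, n)) : (- A) ^t* = - A ^t*.
Proof. by rewrite linearN /= map_mxN. Qed.

Lemma adjmxB m n (A B : 'M[C]_(m, n)) : (A - B) ^t* = A ^t* - B ^t*.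
Proof. by rewrite adjmxD adjmxN. Qed.

Lemma adjmxZ m n (x : R) (A : 'M[C]_(m, n)) : (x%:C *: A) ^t* = x%:C *: A ^t*.
Proof. by apply/matrixP => i j; rewrite !mxE rmorphM /= conjC_real. Qed.

Lemma adjmx_sum m n I (r : seq I) P (F : I -> 'M[C]_(m, n)) :
  (\sum_(i <- r | P i) F i) ^t* = \sum_(i <- r | P i) (F i) ^t*.
Proof.
apply: (big_morph (fun A : 'M[C]_(m, n) => A ^t*)) => [A B|]; first exact: adjmxD.
by apply/matrixP => i j; rewrite !mxE conjC0.
Qed.

Lemma mxtrace_adj d (A : 'M[C]_d) : \tr (A ^t*) = conjC (\tr A).
Proof. by rewrite /mxtrace rmorph_sum; apply: eq_bigr => i _; rewrite adjmxE. Qed.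

Definition rdiag d (a : 'I_d -> R) : 'M[C]_d := diag_mx (\row_j (a j)%:C).

Lemma rdiagE d (a : 'I_d -> R) i j : rdiag a i j = (a i)%:C *+ (i == j).
Proof. by rewrite !mxE. Qed.

Lemma adj_rdiag d (a : 'I_d -> R) : (rdiag a) ^t* = rdiag a.
Proof.
apply/matrixP => i j; rewrite adjmxE !rdiagE rmorphMn /= conjC_real eq_sym.
by case: eqVneq => // ->.
Qed.

Lemma mul_rdiag d (a b : 'I_d -> R) : rdiag a *m rdiag b = rdiag (fun j => a j * b j).
Proof.
by rewrite mulmx_diag; congr diag_mx; apply/rowP => j; rewrite !mxE rmorphM.
Qed.

Lemma unitary_mulVA d (U : 'M[C]_d) : U \is unitarymx -> U *m U ^t* = 1%:M.
Proof. by move/unitarymxP. Qed.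

Lemma unitary_mulAV d (U : 'M[C]_d) : U \is unitarymx -> U ^t* *m U = 1%:M.
Proof. by move=> hU; apply: mulmx1C; apply: unitary_mulVA. Qed.

Lemma hermitian_spectral d (A : 'M[C]_d) : A ^t* = A ->
  exists U (a : 'I_d -> R), U \is unitarymx /\ A = U *m rdiag a *m U ^t*.
Proof.
move=> hA; have hh : A \is hermsymmx.
  by apply/is_hermitianmxP; rewrite expr0 scale1r hA.
have /orthomx_spectralP eA := hermitian_normalmx hh.
have hr := hermitian_spectral_diag_real hh.
exists ((spectralmx A) ^t*), (fun j => Re (spectral_diag A 0 j)); split.
  by rewrite trmxC_unitary spectral_unitarymx.
rewrite trmxCK -(invmx_unitary (spectral_unitarymx A)) {1}eA.
suff -> : rdiag (fun j => Re (spectral_diag A 0 j)) = diag_mx (spectral_diag A) by [].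
rewrite /rdiag; congr diag_mx; apply/rowP => j; rewrite mxE.
by apply/esym/real_selfJ/CrealP; exact: (mxOverP hr).
Qed.

End Spectral.

(** * Frobenius geometry and quadratic forms *)

Section QuadraticForms.
Local Open Scope sesquilinear_scope.
Local Open Scope complex_scope.
Local Notation conjC := Num.Def.conjC.
Context {R : realType}.
Local Notation C := R[i].
Local Notation Re := (@complex.Re R).

Definition sqnorm m n (A : 'M[C]_(m, n)) : R := \sum_i \sum_j sqmod (A i j).

Lemma sqnorm_ge0 m n (A : 'M[C]_(m, n)) : 0 <= sqnorm A.
Proof. by apply: sumr_ge0 => i _; apply: sumr_ge0 => j _; apply: sqmod_ge0. Qed.

Lemma sqnorm_tr m n (A : 'M[C]_(m, n)) : \tr (A ^t* *m A) = (sqnorm A)%:C.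
Proof.
rewrite /sqnorm exchange_big /= /mxtrace rmorph_sum; apply: eq_bigr => i _.
rewrite mxE rmorph_sum; apply: eq_bigr => j _.
by rewrite adjmxE conj_mulC_sqmod.
Qed.

Lemma frob_sq d (A : 'M[C]_d) : frob_norm A ^+ 2 = sqnorm A.
Proof. by rewrite /frob_norm sqnorm_tr /= sqr_sqrtr // sqnorm_ge0. Qed.

Lemma frob_le d (A B : 'M[C]_d) : (frob_norm A <= frob_norm B) = (sqnorm A <= sqnorm B).
Proof.
by rewrite -!frob_sq ler_sqr // /frob_norm ?nnegrE sqrtr_ge0.
Qed.

Lemma sqnorm_adj m n (A : 'M[C]_(m, n)) : sqnorm (A ^t*) = sqnorm A.
Proof.
rewrite /sqnorm exchange_big; apply: eq_bigr => i _; apply: eq_bigr => j _.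
by rewrite adjmxE sqmodJ.
Qed.

Lemma sqnorm_unitaryl m n (U : 'M[C]_m) (A : 'M[C]_(m, n)) :
  U \is unitarymx -> sqnorm (U ^t* *m A) = sqnorm A.
Proof.
move=> hU; apply: (@complexI R); rewrite -!sqnorm_tr adjmxM trmxCK.
by rewrite -mulmxA (mulmxA U) unitary_mulVA // mul1mx.
Qed.

Lemma sqnorm_unitaryr m n (U : 'M[C]_n) (A : 'M[C]_(m, n)) :
  U \is unitarymx -> sqnorm (A *m U) = sqnorm A.
Proof. by move=> hU; rewrite -sqnorm_adj adjmxM sqnorm_unitaryl // sqnorm_adj. Qed.

Lemma sqnorm_rdiag d (a : 'I_d -> R) : sqnorm (rdiag a) = \sum_j a j ^+ 2.
Proof.
apply: eq_bigr => i _; rewrite (bigD1 i) //= big1 ?addr0 => [|j /negPf h].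
  by rewrite rdiagE eqxx mulr1n sqmod_real.
by rewrite rdiagE eq_sym h mulr0n /sqmod /= expr0n addr0.
Qed.

Lemma sqnorm_spectral d (U : 'M[C]_d) a : U \is unitarymx ->
  sqnorm (U *m rdiag a *m U ^t*) = \sum_j a j ^+ 2.
Proof.
move=> hU; rewrite sqnorm_unitaryr ?trmxC_unitary // -[U in U *m _]trmxCK.
by rewrite sqnorm_unitaryl ?trmxC_unitary // sqnorm_rdiag.
Qed.

Lemma sqmodD (x y : C) : sqmod (x + y) = sqmod x + 2 * Re (conjC x * y) + sqmod y.
Proof. by case: x => a b; case: y => c d; rewrite /sqmod conjCE /=; ring. Qed.

(** The Frobenius inner product, as a real bilinear form. *)
Definition rdot m n (A B : 'M[C]_(m, n)) : R := Re (\tr (A ^t* *m B)).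

Lemma rdotE m n (A B : 'M[C]_(m, n)) :
  rdot A B = \sum_i \sum_j Re (conjC (A i j) * B i j).
Proof.
rewrite /rdot /mxtrace Re_sum exchange_big; apply: eq_bigr => i _.
by rewrite mxE Re_sum; apply: eq_bigr => j _; rewrite adjmxE.
Qed.

Lemma sqnormD m n (A B : 'M[C]_(m, n)) : sqnorm (A + B) = sqnorm A + 2 * rdot A B + sqnorm B.
Proof.
rewrite rdotE mulr_sumr -!big_split; apply: eq_bigr => i _ /=.
rewrite mulr_sumr -!big_split; apply: eq_bigr => j _ /=.
by rewrite mxE sqmodD.
Qed.

Lemma sqnormZ m n (x : R) (A : 'M[C]_(m, n)) : sqnorm (x%:C *: A) = x ^+ 2 * sqnorm A.
Proof.
rewrite mulr_sumr; apply: eq_bigr => i _.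
rewrite mulr_sumr; apply: eq_bigr => j _.
by rewrite mxE sqmodM sqmod_real.
Qed.

Lemma sqnormN m n (A : 'M[C]_(m, n)) : sqnorm (- A) = sqnorm A.
Proof. by apply: eq_bigr => i _; apply: eq_bigr => j _; rewrite mxE sqmodN. Qed.

Lemma sqnorm_sum_le m n (A B : 'M[C]_(m, n)) : sqnorm (A + B) <= 2 * sqnorm A + 2 * sqnorm B.
Proof.
rewrite !mulr_sumr -big_split; apply: ler_sum => i _ /=.
rewrite !mulr_sumr -big_split; apply: ler_sum => j _ /=.
rewrite mxE /sqmod; case: (A i j) => a b; case: (B i j) => c d /=.
have := sqr_ge0 (a - c); have := sqr_ge0 (b - d); nra.
Qed.

Lemma sqnorm_eq0 m n (A : 'M[C]_(m, n)) : sqnorm A = 0 -> A = 0.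
Proof.
move=> h; apply/matrixP => i j; rewrite mxE.
have /eqP := h; rewrite psumr_eq0 => [/allP /(_ i)|k _]; last first.
  by apply: sumr_ge0 => ? _; apply: sqmod_ge0.
rewrite mem_index_enum => /(_ isT) /implyP /(_ isT).
rewrite psumr_eq0 => [/allP /(_ j)|k _]; last exact: sqmod_ge0.
rewrite mem_index_enum => /(_ isT) /implyP /(_ isT) /eqP.
rewrite /sqmod; case: (A i j) => a b /= /eqP.
rewrite paddr_eq0 ?sqr_ge0 // !sqrf_eq0 => /andP[/eqP -> /eqP ->].
by [].
Qed.

Lemma rdotDl m n (A A' B : 'M[C]_(m, n)) : rdot (A + A') B = rdot A B + rdot A' B.
Proof. by rewrite /rdot adjmxD mulmxDl mxtraceD ReD. Qed.
Lemma rdotNl m n (A B : 'M[C]_(m, n)) : rdot (- A) B = - rdot A B.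
Proof. by rewrite /rdot adjmxN mulNmx raddfN /= ReN. Qed.
Lemma rdotDr m n (A B B' : 'M[C]_(m, n)) : rdot A (B + B') = rdot A B + rdot A B'.
Proof. by rewrite /rdot mulmxDr mxtraceD ReD. Qed.
Lemma rdotNr m n (A B : 'M[C]_(m, n)) : rdot A (- B) = - rdot A B.
Proof. by rewrite /rdot mulmxN raddfN ReN. Qed.
Lemma rdotZr m n x (A B : 'M[C]_(m, n)) : rdot A (x%:C *: B) = x * rdot A B.
Proof. by rewrite /rdot -scalemxAr mxtraceZ ReZ. Qed.
Lemma rdotnn m n (A : 'M[C]_(m, n)) : rdot A A = sqnorm A.
Proof. by rewrite /rdot sqnorm_tr. Qed.

Definition qform d (B : 'M[C]_d) (v : 'cV[C]_d) : R := Re ((v ^t* *m B *m v) 0 0).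
(** The diagonal of [B] in the orthonormal basis formed by the columns of [U]:
    almost every estimate below is an inequality between such diagonals. *)
Definition udiag d (U B : 'M[C]_d) (j : 'I_d) : R := Re ((U ^t* *m B *m U) j j).

Lemma udiag_qform d (U B : 'M[C]_d) j : udiag U B j = qform B (col j U).
Proof.
rewrite /udiag /qform; congr Re; rewrite [LHS]mxE [RHS]mxE; apply: eq_bigr => k _.
rewrite [col j U k 0]mxE; congr (_ * _); rewrite [LHS]mxE [RHS]mxE.
by apply: eq_bigr => i _; rewrite !mxE.
Qed.

Lemma udiagD d (U A B : 'M[C]_d) j : udiag U (A + B) j = udiag U A j + udiag U B j.
Proof. by rewrite /udiag mulmxDr mulmxDl mxE ReD. Qed.
Lemma udiagN d (U A : 'M[C]_d) j : udiag U (- A) j = - udiag U A j.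
Proof. by rewrite /udiag mulmxN mulNmx mxE ReN. Qed.
Lemma udiagB d (U A B : 'M[C]_d) j : udiag U (A - B) j = udiag U A j - udiag U B j.
Proof. by rewrite udiagD udiagN. Qed.
Lemma qformD d (A B : 'M[C]_d) v : qform (A + B) v = qform A v + qform B v.
Proof. by rewrite /qform mulmxDr mulmxDl mxE ReD. Qed.
Lemma qformN d (A : 'M[C]_d) v : qform (- A) v = - qform A v.
Proof. by rewrite /qform mulmxN mulNmx mxE ReN. Qed.
Lemma qformB d (A B : 'M[C]_d) v : qform (A - B) v = qform A v - qform B v.
Proof. by rewrite qformD qformN. Qed.
Lemma qformZ d x (A : 'M[C]_d) v : qform (x%:C *: A) v = x * qform A v.
Proof. by rewrite /qform -scalemxAr -scalemxAl mxE ReZ. Qed.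
Lemma qform_sum d I (r : seq I) P (F : I -> 'M[C]_d) v :
  qform (\sum_(i <- r | P i) F i) v = \sum_(i <- r | P i) qform (F i) v.
Proof.
apply: (big_morph (fun A => qform A v)) => [A B|]; first exact: qformD.
by rewrite /qform mulmx0 mul0mx mxE.
Qed.

Lemma sqnorm_col d (v : 'cV[C]_d) : (v ^t* *m v) 0 0 = (sqnorm v)%:C.
Proof. by rewrite -sqnorm_tr /mxtrace big_ord1. Qed.

Lemma qform1 d (v : 'cV[C]_d) x : qform (x%:C%:M) v = x * sqnorm v.
Proof. by rewrite /qform mul_mx_scalar -scalemxAl mxE sqnorm_col ReZ. Qed.

Lemma sum_udiag d (U B : 'M[C]_d) : U \is unitarymx -> \sum_j udiag U B j = Re (\tr B).
Proof.
move=> hU; rewrite /udiag -Re_sum; congr Re.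
by rewrite -/(mxtrace _) -mulmxA mxtrace_mulC -mulmxA unitary_mulVA // mulmx1.
Qed.

(** The diagonal in one basis is the spectrum averaged by the doubly stochastic
    matrix of squared overlaps of the two bases; see [unitary_row_sum] and
    [unitary_col_sum]. *)
Lemma udiag_spectral d (U V : 'M[C]_d) a j :
  udiag U (V *m rdiag a *m V ^t*) j = \sum_l sqmod ((U ^t* *m V) j l) * a l.
Proof.
rewrite /udiag; have -> : U ^t* *m (V *m rdiag a *m V ^t*) *m U
   = (U ^t* *m V) *m rdiag a *m (U ^t* *m V) ^t*.
  by rewrite adjmxM trmxCK !mulmxA.
rewrite mxE Re_sum; apply: eq_bigr => l _.
rewrite mul_mx_diag [in X in X * _]mxE adjmxE !mxE.
set z := (\sum_k _); have -> : z * (a l)%:C * conjC z = (a l)%:C * (z * conjC z) by ring.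
by rewrite mul_conjC_sqmod ReZ mulrC.
Qed.

Lemma udiag_self d (U : 'M[C]_d) a j : U \is unitarymx ->
  udiag U (U *m rdiag a *m U ^t*) j = a j.
Proof.
move=> hU; rewrite /udiag !mulmxA unitary_mulAV // mul1mx -mulmxA unitary_mulAV // mulmx1.
by rewrite rdiagE eqxx.
Qed.

Lemma unitary_row_sum d (W : 'M[C]_d) j : W \is unitarymx -> \sum_l sqmod (W j l) = 1.
Proof.
move=> hW; have /matrixP /(_ j j) := unitary_mulVA hW.
rewrite !mxE eqxx => /(congr1 Re); rewrite Re_sum /= => <-.
by apply: eq_bigr => l _; rewrite adjmxE mul_conjC_sqmod.
Qed.

Lemma unitary_col_sum d (W : 'M[C]_d) l : W \is unitarymx -> \sum_j sqmod (W j l) = 1.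
Proof.
move=> hW; rewrite -(@unitary_row_sum d (W ^t*) l) ?trmxC_unitary //.
by apply: eq_bigr => j _; rewrite adjmxE sqmodJ.
Qed.

Lemma unitary_adjM d (U V : 'M[C]_d) : U \is unitarymx -> V \is unitarymx ->
  U ^t* *m V \is unitarymx.
Proof. by move=> hU hV; apply: mul_unitarymx => //; rewrite trmxC_unitary. Qed.

Lemma rdot_spectral d (A U : 'M[C]_d) a :
  A ^t* = A -> rdot A (U *m rdiag a *m U ^t*) = \sum_j a j * udiag U A j.
Proof.
move=> hA; rewrite /rdot hA mulmxA mxtrace_mulC !mulmxA mxtrace_mulC /mxtrace Re_sum.
apply: eq_bigr => j _; rewrite mul_diag_mx mxE mxE /= ReZ.
by rewrite /udiag.
Qed.

Lemma spectral_herm d (U : 'M[C]_d) a :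
  (U *m rdiag a *m U ^t*) ^t* = U *m rdiag a *m U ^t*.
Proof. by rewrite !adjmxM trmxCK adj_rdiag mulmxA. Qed.

Lemma spectral_sqr d (V : 'M[C]_d) (m : 'I_d -> R) : V \is unitarymx ->
  V *m rdiag m *m V ^t* *m (V *m rdiag m *m V ^t*) = V *m rdiag (fun j => m j ^+ 2) *m V ^t*.
Proof.
move=> hV; rewrite !mulmxA -[_ *m V ^t* *m V]mulmxA (unitary_mulAV hV) mulmx1.
by rewrite -[V *m rdiag m *m rdiag m]mulmxA mul_rdiag.
Qed.

Lemma adj_mul_spectral d (Y : 'M[C]_d) a : Y \is unitarymx ->
  Y ^t* *m (Y *m rdiag a *m Y ^t*) = rdiag a *m Y ^t*.
Proof. by move=> hY; rewrite !mulmxA (unitary_mulAV hY) mul1mx. Qed.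

Lemma mul_spectral d (U : 'M[C]_d) a : U \is unitarymx ->
  U *m rdiag a *m U ^t* *m U = U *m rdiag a.
Proof. by move=> hU; rewrite -mulmxA (unitary_mulAV hU) mulmx1. Qed.

Lemma udiag_gram d (U B : 'M[C]_d) j :
  udiag U (B ^t* *m B) j = \sum_k sqmod ((B *m U) k j).
Proof.
rewrite /udiag mulmxA -adjmxM -mulmxA mxE Re_sum; apply: eq_bigr => k _.
by rewrite adjmxE conj_mulC_sqmod.
Qed.

Lemma sqnorm_unit_col d (U : 'M[C]_d) j : U \is unitarymx -> sqnorm (col j U) = 1.
Proof.
move=> hU; rewrite -(@unitary_col_sum d U j) //; apply: eq_bigr => i _.
by rewrite big_ord1 mxE.
Qed.

Lemma psd_qform d (A : 'M[C]_d) v : psdmx A -> 0 <= qform A v.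
Proof. by case=> _ /(_ v); rewrite lecE => /andP[_]. Qed.

Lemma psd_udiag d (A U : 'M[C]_d) j : psdmx A -> 0 <= udiag U A j.
Proof. by move=> hA; rewrite udiag_qform psd_qform. Qed.

Lemma rank_diag (F : fieldType) d (a : 'rV[F]_d) :
  \rank (diag_mx a) = #|[set j | a 0 j != 0]|.
Proof.
rewrite -sum1_card big_mkcond /=.
elim: d a => [|d IH] a; first by rewrite big_ord0 flatmx0 mxrank0.
rewrite big_ord_recl.
have -> : diag_mx a = block_mx (diag_mx (lsubmx (a : 'rV_(1 + d)))) 0 0
                               (diag_mx (rsubmx (a : 'rV_(1 + d)))).
  by rewrite -diag_mx_row hsubmxK.
rewrite (@rank_diag_block_mx F 1 1 d d) IH.
congr (_ + _)%N; last by apply: eq_bigr => i _;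
  rewrite !inE mxE (_ : rshift 1 i = lift ord0 i) //; apply: val_inj.
rewrite inE -(_ : lsubmx (a : 'rV_(1 + d)) 0 0 = a 0 ord0); last first.
  by rewrite mxE; congr (a _ _); apply: val_inj.
move: (lsubmx _) => b; have -> : diag_mx b = b by apply/matrixP => i j; rewrite !mxE !ord1 eqxx.
rewrite rank_rV; case: (eqVneq b 0) => [->|hb]; first by rewrite mxE eqxx.
rewrite ifT //; apply: contra hb => /eqP h; apply/eqP/matrixP => i j.
by rewrite !ord1 h mxE.
Qed.

End QuadraticForms.

(** * Projection onto the set of states *)

Section States.
Local Open Scope sesquilinear_scope.
Local Open Scope complex_scope.
Local Notation conjC := Num.Def.conjC.
Context {R : realType}.
Local Notation C := R[i].
Local Notation Re := (@complex.Re R).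

Lemma rank_spectral d (U : 'M[C]_d) a : U \is unitarymx ->
  \rank (U *m rdiag a *m U ^t*) = #|[set j | a j != 0]|.
Proof.
move=> hU; have hu := unitarymx_unit hU.
have hv : U ^t* \in unitmx by apply: unitarymx_unit; rewrite trmxC_unitary.
rewrite mxrankMfree ?row_free_unit // (eqmxMfull _ _) ?row_full_unit // rank_diag.
apply: eq_card => j; rewrite !inE mxE; congr (~~ _).
by apply/eqP/eqP => [[]|->].
Qed.

(** The kernel of [B U] and the coordinate subspace of [S] have dimensions
    adding up to more than [d], so they meet. The point is to find a vector in the
    span of prescribed eigenvectors of one matrix that another matrix annihilates. *)
Lemma kernel_combination d (B U : 'M[C]_d) (S : {set 'I_d}) :
  (\rank B < #|S|)%N ->
  exists x : 'cV[C]_d,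
    [/\ x != 0, forall j, j \notin S -> x j 0 = 0 & B *m (U *m x) = 0].
Proof.
move=> hr; pose s : 'rV[C]_d := \row_j (j \in S)%:R.
pose K := kermx ((B *m U)^T).
have hK : (d - \rank B <= \rank K)%N.
  by rewrite mxrank_ker mxrank_tr leq_sub2l // mxrankM_maxl.
have hs : \rank (diag_mx s) = #|S|.
  rewrite rank_diag; apply: eq_card => j; rewrite !inE mxE.
  by case: (j \in S); rewrite ?oner_eq0 ?eqxx.
have hcap : (K :&: diag_mx s)%MS != 0.
  rewrite -mxrank_eq0 -lt0n.
  have := mxrank_sum_cap K (diag_mx s); rewrite hs.
  have := rank_leq_col (K + diag_mx s)%MS.
  have := rank_leq_row B; lia.
have /rowV0Pn [x hx hx0] := hcap.
have /submxP [y hy] := submx_trans hx (capmxSr _ _).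
have /sub_kermxP hk := submx_trans hx (capmxSl _ _).
exists x^T; split.
- by rewrite trmx_eq0.
- move=> j hj; rewrite mxE hy mul_mx_diag !mxE (negPf hj) mulr0 //.
- by rewrite mulmxA -[LHS]trmxK trmx_mul trmxK hk trmx0.
Qed.

Lemma qform_combination d (U : 'M[C]_d) (a : 'I_d -> R) (x : 'cV[C]_d) :
  U \is unitarymx ->
  qform (U *m rdiag a *m U ^t*) (U *m x) = \sum_j a j * sqmod (x j 0).
Proof.
move=> hU; rewrite /qform adjmxM -!mulmxA (mulmxA (U ^t*) U) unitary_mulAV // mul1mx.
rewrite (mulmxA (U ^t*) U) unitary_mulAV // mul1mx mul_diag_mx mxE Re_sum.
apply: eq_bigr => j _; rewrite adjmxE !mxE.
rewrite mulrCA conj_mulC_sqmod ReZ //.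
Qed.

Lemma sqnorm_combination d (U : 'M[C]_d) (x : 'cV[C]_d) : U \is unitarymx ->
  sqnorm (U *m x) = \sum_j sqmod (x j 0).
Proof.
move=> hU; rewrite -[U]trmxCK sqnorm_unitaryl ?trmxC_unitary //.
by apply: eq_bigr => j _; rewrite big_ord1.
Qed.

Lemma sqmod_eq0 (z : C) : sqmod z = 0 -> z = 0.
Proof.
case: z => a b /eqP; rewrite /sqmod /= paddr_eq0 ?sqr_ge0 // !sqrf_eq0.
by case/andP => /eqP -> /eqP ->.
Qed.

Lemma sqnorm_gt0 m n (A : 'M[C]_(m, n)) : A != 0 -> 0 < sqnorm A.
Proof.
by move=> hA; rewrite lt_def sqnorm_ge0 andbT; apply: contra hA => /eqP /sqnorm_eq0 ->.
Qed.

(** The quadratic form of a Hermitian matrix is real, so nonnegativity of its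
    real part suffices. *)
Lemma psdI d (A : 'M[C]_d) : A ^t* = A -> (forall v, 0 <= qform A v) -> psdmx A.
Proof.
move=> hA h; split => // v; have := h v; rewrite /qform.
have : conjC ((v ^t* *m A *m v) 0 0) = (v ^t* *m A *m v) 0 0.
  by rewrite -adjmxE !adjmxM trmxCK hA mulmxA.
by move=> /real_selfJ -> /=; rewrite ler0c.
Qed.

Lemma state_herm d (A : 'M[C]_d) : state A -> A ^t* = A.
Proof. by case=> -[]. Qed.

Lemma state_eig_ge0 d (U : 'M[C]_d) a j : U \is unitarymx ->
  state (U *m rdiag a *m U ^t*) -> 0 <= a j.
Proof. by move=> hU [hp _]; rewrite -(udiag_self a j hU); apply: psd_udiag. Qed.

Lemma state_eig_sum d (U : 'M[C]_d) a : U \is unitarymx ->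
  state (U *m rdiag a *m U ^t*) -> \sum_j a j = 1.
Proof.
move=> hU [_ ht]; have := sum_udiag (U *m rdiag a *m U ^t*) hU.
by rewrite ht /= => <-; apply: eq_bigr => j _; rewrite udiag_self.
Qed.

Lemma sum_udiag_state d (U A : 'M[C]_d) : U \is unitarymx -> state A ->
  \sum_j udiag U A j = 1.
Proof. by move=> hU [_ ht]; rewrite sum_udiag // ht. Qed.

Lemma state_sqnorm_le1 d (A : 'M[C]_d) : state A -> sqnorm A <= 1.
Proof.
move=> hA; have [U [a [hU eA]]] := hermitian_spectral (state_herm hA).
rewrite eA in hA *; rewrite sqnorm_spectral // -(state_eig_sum hU hA).
apply: ler_sum => j _; rewrite expr2 ler_piMl ?(state_eig_ge0 _ hU hA) //.
rewrite -(state_eig_sum hU hA) (bigD1 j) //= lerDl sumr_ge0 // => i _.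
exact: state_eig_ge0 hA.
Qed.

Lemma state_convex d (A B : 'M[C]_d) s : state A -> state B -> 0 <= s <= 1 ->
  state (A + s%:C *: (B - A)).
Proof.
move=> hA hB /andP[s0 s1]; split.
  apply: psdI.
    by rewrite adjmxD adjmxZ adjmxB !state_herm.
  move=> v; rewrite qformD qformZ qformB.
  have := psd_qform v hA.1; have := psd_qform v hB.1; nra.
rewrite mxtraceD mxtraceZ raddfB /= hA.2 hB.2; ring.
Qed.

(** First order condition at the minimizer: moving a small step [s] from [P]
    towards [S] cannot decrease the distance to [A]. *)
Lemma projection_variational d (A P S : 'M[C]_d) :
  state_projection A P -> state S -> rdot (A - P) (S - P) <= 0.
Proof.
move=> [hP hmin] hS; rewrite leNgt; apply/negP => hip.
set q := rdot _ _ in hip; pose N := sqnorm (S - P).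
have hN : 0 <= N := sqnorm_ge0 _.
(* Any s in (0, 1] with s N <= q contradicts minimality. *)
pose s := q / (q + N).
have hqN : 0 < q + N by lra.
have s0 : 0 < s by rewrite divr_gt0.
have s1 : s <= 1 by rewrite ler_pdivrMr // mul1r; lra.
have := hmin _ (state_convex hP hS (s := s) _); rewrite (ltW s0) s1 => /(_ isT).
rewrite frob_le opprD addrA [sqnorm (A - P - _)]sqnormD rdotNr rdotZr sqnormN sqnormZ -/q -/N.
have hsN : s * N <= q.
  rewrite /s mulrAC ler_pdivrMr //; nra.
nra.
Qed.

(** The Cauchy-Schwarz inequality against the constant 1, as nonnegativity of
    the variance. *)
Lemma sum_sqr_le (I : finType) (S : {set I}) (a : I -> R) :
  (\sum_(i in S) a i) ^+ 2 <= #|S|%:R * \sum_(i in S) a i ^+ 2.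
Proof.
have [->|hS] := eqVneq S (finset.set0 : {set I}); first by rewrite !big_set0 expr0n mulr0.
have hc : 0 < #|S|%:R :> R by rewrite ltr0n card_gt0.
set T := \sum_(i in S) a i; pose m := T / #|S|%:R.
have : 0 <= \sum_(i in S) (a i - m) ^+ 2 by apply: sumr_ge0 => i _; apply: sqr_ge0.
rewrite (eq_bigr (fun i => a i ^+ 2 + (- (2 * m) * a i + m ^+ 2))); last first.
  by move=> i _; ring.
rewrite big_split big_split /= -mulr_sumr -/T sumr_const -[m ^+ 2 *+ _]mulr_natl.
have hm : #|S|%:R * m = T by rewrite /m mulrC divfK ?gt_eqF.
clearbody m; clearbody T; move: hm; move: (\sum_(i in S) _) => Q hm.
rewrite -hm; nra.
Qed.

(** For Hermitian [D] this bounds the operator norm by [x]. *)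
Definition form_bound d (D : 'M[C]_d) (x : R) := forall v, `|qform D v| <= x * sqnorm v.

Lemma form_bound_udiag d (D U : 'M[C]_d) x j : form_bound D x -> U \is unitarymx ->
  `|udiag U D j| <= x.
Proof. by move=> h hU; rewrite udiag_qform (le_trans (h _)) // sqnorm_unit_col // mulr1. Qed.

(** On a nonzero combination of eigenvectors of [P - rho] for negative
    eigenvalues the form of [P - rho] is negative. If there were more of them than the
    rank, some combination would lie in the kernel of [rho], where the form of
    [P - rho] is that of [P], hence nonnegative. *)
Lemma negative_eigs_le_rank d (P rho U : 'M[C]_d) a :
  psdmx P -> U \is unitarymx -> P - rho = U *m rdiag a *m U ^t* ->
  (#|[set j | (a j < 0)%R]| <= \rank rho)%N.
Proof.
move=> hP hU eD; rewrite leqNgt; apply/negP => hlt.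
have [x [x0 hx hk]] := kernel_combination U hlt.
have := psd_qform (U *m x) hP.
have : qform P (U *m x) = qform (P - rho) (U *m x).
  by rewrite qformB [X in _ - X](_ : _ = 0) ?subr0 // /qform -mulmxA hk mulmx0 mxE.
move=> ->; rewrite eD qform_combination // leNgt => /negP; apply.
have [j hj] : exists j, x j 0 != 0.
  apply/existsP; rewrite -negb_forall; apply: contra x0 => /forallP h.
  by apply/eqP/matrixP => j k; rewrite ord1 mxE; apply/eqP.
have hn i : a i * sqmod (x i 0) <= 0.
  case: (boolP (i \in [set j | a j < 0])) => [|hi].
    by rewrite inE => ha; rewrite mulr_le0_ge0 ?(ltW ha) ?sqmod_ge0.
  by rewrite hx // /sqmod /= expr0n addr0 mulr0.
rewrite (bigD1 j) //= -[X in _ < X]addr0 ltr_leD //; last by apply: sumr_le0.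
have : j \in [set j | a j < 0] by apply: contraNT hj => /hx ->.
rewrite inE => ha; rewrite nmulr_rlt0 // lt_def sqmod_ge0 andbT.
by apply: contra hj => /eqP /sqmod_eq0 ->.
Qed.

(** With [Delta = P - rho], optimality gives |Delta|^2 <= <A - rho, Delta>, which
    is at most [x] times the trace norm of [Delta]. As [Delta] is traceless, its trace
    norm is twice the sum of its negative parts, of which there are at most
    [\rank rho]; Cauchy-Schwarz bounds that sum by a multiple of |Delta|. *)
Lemma projection_error d (A P rho : 'M[C]_d) x :
  state_projection A P -> state rho -> A ^t* = A -> form_bound (A - rho) x ->
  sqnorm (P - rho) <= 4 * (\rank rho)%:R * x ^+ 2.
Proof.
move=> hP hrho hA hx.
have hip := projection_variational hP hrho.
have hDel : (P - rho) ^t* = P - rho by rewrite adjmxB !state_herm //; case: hP.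
have [U [a [hU eD]]] := hermitian_spectral hDel.
set r := \rank rho.
have h1 : sqnorm (P - rho) <= rdot (A - rho) (P - rho).
  rewrite -rdotnn; move: hip.
  have -> : A - P = (A - rho) - (P - rho) by rewrite opprB addrA subrK.
  rewrite -[in X in rdot _ X <= _ -> _]opprB rdotNr rdotDl rdotNl; lra.
have hd : (A - rho) ^t* = A - rho by rewrite adjmxB hA state_herm.
have htr : \sum_j a j = 0.
  have := sum_udiag (P - rho) hU; rewrite eD (eq_bigr a) => [->|j _]; last by rewrite udiag_self.
  by rewrite -eD raddfB /= hrho.2 (proj1 hP).2 subrr.
have x0 (j : 'I_d) : 0 <= x by have := form_bound_udiag j hx hU; apply: le_trans.
pose S := [set j | a j < 0].
pose T := \sum_(j in S) a j.
have habs : \sum_j `|a j| = - 2 * T.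
  rewrite (bigID (mem S)) /= (eq_bigr (fun j => - a j)) => [|j]; last first.
    by rewrite inE => /ltW h; rewrite ler0_norm.
  rewrite [X in _ + X](eq_bigr a) => [|j]; last first.
    by rewrite inE -leNgt => h; rewrite ger0_norm.
  move: htr; rewrite (bigID (mem S)) /= -/T sumrN -/T.
  by move: (\sum_(i < d | i \notin S) _); clearbody T; clear => z; lra.
have h2 : rdot (A - rho) (P - rho) <= - 2 * x * T.
  have -> : - 2 * x * T = x * \sum_j `|a j| by rewrite habs; ring.
  rewrite eD rdot_spectral // mulr_sumr; apply: ler_sum => j _.
  apply: le_trans (ler_norm _) _; rewrite normrM mulrC ler_wpM2r //.
  exact: form_bound_udiag.
have h3 : T ^+ 2 <= r%:R * sqnorm (P - rho).
  apply: le_trans (sum_sqr_le S a) _; rewrite eD sqnorm_spectral //.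
  apply: ler_pM; rewrite ?ler0n //.
  - by apply: sumr_ge0 => j _; apply: sqr_ge0.
  - by rewrite ler_nat; apply: negative_eigs_le_rank hU eD; case: hP => -[].
  - rewrite [X in _ <= X](bigID (mem S)) /= lerDl.
    by apply: sumr_ge0 => j _; apply: sqr_ge0.
have hN := sqnorm_ge0 (P - rho).
clearbody T; clear habs x0; move: h1 h2 h3 hN;
  move: (sqnorm _) (rdot _ _) T (r%:R : R) (ler0n R r) => N q T r' hr h1 h2 h3 hN.
have h4 : N ^+ 2 <= 4 * x ^+ 2 * (r' * N).
  have : N ^+ 2 <= (- 2 * x * T) ^+ 2 by rewrite ler_sqr ?nnegrE //; lra.
  have : 0 <= x ^+ 2 := sqr_ge0 _. nra.
have [->|N0] := eqVneq N 0.
  by rewrite mulr_ge0 ?sqr_ge0 // mulr_ge0.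
have Np : 0 < N by rewrite lt_def N0.
rewrite -(ler_pM2r Np); move: h4; rewrite expr2; lra.
Qed.

(** Weights in [0, 1] of total mass [d - r] pick up least from a decreasing
    sequence when they sit on its last [d - r] terms: compare each term with the
    pivot [a r]. *)
Lemma ky_fan_tail d r (a w : 'I_d -> R) : (r <= d)%N ->
  (forall i j : 'I_d, (i <= j)%N -> a j <= a i) -> (forall j, 0 <= a j) ->
  (forall j, 0 <= w j <= 1) -> \sum_j w j = (d - r)%:R ->
  \sum_(j < d | (r <= j)%N) a j <= \sum_j w j * a j.
Proof.
move=> hr hmono ha hw hsum; have [hrd|hrd] := ltnP r d; last first.
  rewrite big_pred0 => [|j]; last by rewrite leqNgt (leq_trans (ltn_ord j)).
  by apply: sumr_ge0 => j _; rewrite mulr_ge0 //; case/andP: (hw j).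
pose p := a (Ordinal hrd).
have hcard : \sum_(j < d) (r <= j)%N%:R = (d - r)%:R :> R.
  rewrite -(big_mkord xpredT (fun j => (r <= j)%N%:R)) (@big_cat_nat _ _ _ r) //=.
  rewrite big_nat_cond big1 ?add0r => [|j /andP[/andP[_ h] _]]; last first.
    by rewrite leqNgt h.
  rewrite big_nat_cond (eq_bigr (fun=> 1)) => [|j /andP[/andP[-> _] _]] //.
  by rewrite -big_nat_cond sumr_const_nat.
have hp : \sum_j p * (w j - (r <= j)%N%:R) = 0.
  by rewrite -mulr_sumr big_split /= sumrN hsum hcard subrr mulr0.
rewrite -subr_ge0 [X in _ - X]big_mkcond -sumrB -[X in X <= _]hp; apply: ler_sum => j _.
case/andP: (hw j) => w0 w1; case: leqP => hj.
  have : a j <= p by apply: hmono.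
  by rewrite mulr1n; nra.
have : p <= a j by apply: hmono; apply: ltnW.
by rewrite mulr0n; nra.
Qed.

End States.

(** * Spectral thresholding *)

Section Threshold.
Local Open Scope sesquilinear_scope.
Local Open Scope complex_scope.
Local Notation conjC := Num.Def.conjC.
Context {R : realType}.
Local Notation C := R[i].
Local Notation Re := (@complex.Re R).

Lemma sum_udiag_sq d (U B : 'M[C]_d) (S : {set 'I_d}) : U \is unitarymx ->
  \sum_(j in S) udiag U B j ^+ 2 <= sqnorm B.
Proof.
move=> hU; rewrite -(sqnorm_unitaryl B hU) -(sqnorm_unitaryr _ hU) big_mkcond.
apply: ler_sum => j _; rewrite (bigD1 j) //= ler_wpDr ?sumr_ge0 // => [i _|].
  exact: sqmod_ge0.
case: ifP => _; last exact: sqmod_ge0.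
by rewrite /udiag /sqmod lerDl sqr_ge0.
Qed.

(** Compressing to the [d - r] basis vectors outside [S] averages the spectrum
    with weights in [0, 1] of total mass [d - r]. *)
Lemma tail_le_compression d r (Y V : 'M[C]_d) (S : {set 'I_d}) (g : 'I_d -> R) :
  Y \is unitarymx -> V \is unitarymx -> #|S| = r ->
  (forall i j : 'I_d, (i <= j)%N -> g j <= g i) -> (forall j, 0 <= g j) ->
  \sum_(j < d | (r <= j)%N) g j <= \sum_(i in ~: S) udiag Y (V *m rdiag g *m V ^t*) i.
Proof.
move=> hY hV hS hmono hg.
have hW := unitary_adjM hY hV.
pose w (j : 'I_d) := \sum_(i in ~: S) sqmod ((Y ^t* *m V) i j).
have -> : \sum_(i in ~: S) udiag Y (V *m rdiag g *m V ^t*) i = \sum_j w j * g j.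
  rewrite (eq_bigr (fun i => \sum_l sqmod ((Y ^t* *m V) i l) * g l)); last first.
    by move=> i _; rewrite udiag_spectral.
  by rewrite exchange_big; apply: eq_bigr => l _; rewrite mulr_suml.
apply: ky_fan_tail => //.
- by rewrite -hS -[X in (_ <= X)%N]card_ord max_card.
- move=> j; rewrite sumr_ge0 => [|i _]; last exact: sqmod_ge0.
  rewrite -(unitary_col_sum j hW) [X in _ <= X](bigID (mem (~: S))) /= lerDl.
  by apply: sumr_ge0 => i _; apply: sqmod_ge0.
- rewrite exchange_big (eq_bigr (fun=> 1)) => [|i _]; last exact: unitary_row_sum.
  by rewrite sumr_const cardsCs finset.setCK card_ord hS.
Qed.

Lemma sum_udiag_support d (rho Y : 'M[C]_d) mu (S : {set 'I_d}) : Y \is unitarymx -> state rho ->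
  rho = Y *m rdiag mu *m Y ^t* -> S = [set i | mu i != 0] ->
  \sum_(i in S) udiag Y rho i = 1.
Proof.
move=> hY hrho e eS; rewrite -(sum_udiag_state hY hrho) [RHS](bigID (mem S)) /=.
rewrite [X in _ + X]big1 ?addr0 // => i; rewrite eS inE negbK => /eqP h.
by rewrite e udiag_self.
Qed.

(** Take for [Y] an eigenbasis of [rho]. The mass of [P] outside the support of
    [rho] is minus the trace of [P - rho] on that support, a sum of [\rank rho] diagonal
    entries of [P - rho]. *)
Lemma tail_trace d (P rho V : 'M[C]_d) (lam : 'I_d -> R) :
  state rho -> state P -> V \is unitarymx -> P = V *m rdiag lam *m V ^t* ->
  (forall i j : 'I_d, (i <= j)%N -> lam j <= lam i) ->
  (\sum_(j < d | (\rank rho <= j)%N) lam j) ^+ 2 <= (\rank rho)%:R * sqnorm (P - rho).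
Proof.
move=> hrho hP hV eP hmono.
have [Y [mu [hY erho]]] := hermitian_spectral (state_herm hrho).
pose S := [set i | mu i != 0].
have hS : #|S| = \rank rho by rewrite erho rank_spectral.
have hlam j : 0 <= lam j by apply: (@state_eig_ge0 _ d V); rewrite -?eP.
have h1 := tail_le_compression hY hV hS hmono hlam.
rewrite -eP in h1.
have h2 : \sum_(i in ~: S) udiag Y P i = - \sum_(i in S) udiag Y (P - rho) i.
  have h := sum_udiag_state hY hP; rewrite (bigID (mem S)) /= in h.
  have -> : \sum_(i in S) udiag Y (P - rho) i = \sum_(i in S) udiag Y P i - 1.
    rewrite -(sum_udiag_support hY hrho erho (erefl S)) -sumrB.
    by apply: eq_bigr => i _; rewrite udiagB.
  rewrite (eq_bigl (fun i => i \notin S)) => [|i]; last by rewrite inE.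
  by rewrite opprB -h addrAC subrr add0r.
apply: (@le_trans _ _ ((\sum_(i in S) udiag Y (P - rho) i) ^+ 2)).
  rewrite -[X in _ <= X]sqrrN -h2 ler_sqr ?nnegrE //; first by apply: sumr_ge0.
  by apply: le_trans h1; apply: sumr_ge0.
apply: le_trans (sum_sqr_le _ _) _; rewrite hS ler_wpM2l ?ler0n //.
exact: sum_udiag_sq.
Qed.

(** Outside the support of [rho] the columns of [P - rho] are those of [P], and
    their squared norms are the diagonal entries of P^2. *)
Lemma tail_squares d (P rho V : 'M[C]_d) (lam : 'I_d -> R) :
  state rho -> state P -> V \is unitarymx -> P = V *m rdiag lam *m V ^t* ->
  (forall i j : 'I_d, (i <= j)%N -> lam j <= lam i) ->
  \sum_(j < d | (\rank rho <= j)%N) lam j ^+ 2 <= sqnorm (P - rho).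
Proof.
move=> hrho hP hV eP hmono.
have [Y [mu [hY erho]]] := hermitian_spectral (state_herm hrho).
pose S := [set i | mu i != 0].
have hS : #|S| = \rank rho by rewrite erho rank_spectral.
have hlam j : 0 <= lam j by apply: (@state_eig_ge0 _ d V); rewrite -?eP.
pose g j := lam j ^+ 2.
have h1 : \sum_(j < d | (\rank rho <= j)%N) g j <= _ :=
  tail_le_compression hY hV hS (g := g) _ _.
apply: le_trans (h1 _ _) _ => [i j hij|j|].
- by rewrite /g ler_sqr ?nnegrE // hmono.
- exact: sqr_ge0.
have -> : V *m rdiag g *m V ^t* = P ^t* *m P.
  by rewrite (state_herm hP) eP spectral_sqr.
rewrite -(sqnorm_unitaryr _ hY) -sqnorm_adj.
rewrite [X in _ <= X](bigID (mem (~: S))) /= ler_wpDr //.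
  by apply: sumr_ge0 => i _; apply: sumr_ge0 => k _; apply: sqmod_ge0.
apply: ler_sum => i; rewrite !inE negbK => /eqP hi.
rewrite udiag_gram; apply: ler_sum => k _; rewrite adjmxE sqmodJ.
have e : (rho *m Y) k i = 0.
  by rewrite erho (mul_spectral _ hY) mul_mx_diag mxE mxE hi mulr0.
have sub (A B : 'M[C]_d) : (A - B) k i = A k i - B k i by rewrite !mxE.
by rewrite mulmxBl sub e subr0.
Qed.

(** Spreading the eigenvalue of index [k] over the [k] others and then the tail
    from [p] on over the first [p] is the same as spreading the whole tail at once. *)
Lemma shift_tail (lam : nat -> R) p k : (0 < p <= k)%N ->
  k%:R^-1 * lam k + p%:R^-1 * \sum_(p <= l < k) (lam l + k%:R^-1 * lam k) =
  p%:R^-1 * \sum_(p <= l < k.+1) lam l.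
Proof.
move=> /andP[p0 pk]; rewrite big_nat_recr //= big_split /= sumr_const_nat.
have hp : p%:R != 0 :> R by rewrite pnatr_eq0 -lt0n.
have hk : k%:R != 0 :> R by rewrite pnatr_eq0 -lt0n (leq_trans p0).
rewrite -[_ *+ (k - p)]mulr_natl natrB //.
by field; rewrite hp hk.
Qed.

(** All surviving eigenvalues receive the same total shift, so the outcome is
    described by the cut [k] alone: the last two clauses say that every removed
    eigenvalue was below the threshold when inspected, and that the first surviving
    one was not. *)
Lemma threshold_recP tau m (lam : nat -> R) :
  exists k, [/\ (k <= m)%N,
    forall j, (j < k)%N ->
      threshold_rec tau m lam j = lam j + k%:R^-1 * \sum_(k <= i < m) lam i,
    forall j, (k <= j < m)%N -> threshold_rec tau m lam j = 0,
    forall i, (k <= i < m)%N ->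
      lam i + i.+1%:R^-1 * \sum_(i.+1 <= l < m) lam l <= tau &
    (0 < k)%N -> tau < lam k.-1 + k%:R^-1 * \sum_(k <= i < m) lam i].
Proof.
suff [k [h1 h2 [h3 _] h4 h5]] : exists k, [/\ (k <= m)%N,
    forall j, (j < k)%N ->
      threshold_rec tau m lam j = lam j + k%:R^-1 * \sum_(k <= i < m) lam i,
    (forall j, (k <= j < m)%N -> threshold_rec tau m lam j = 0) /\
    (forall j, (m <= j)%N -> threshold_rec tau m lam j = lam j),
    forall i, (k <= i < m)%N ->
      lam i + i.+1%:R^-1 * \sum_(i.+1 <= l < m) lam l <= tau &
    (0 < k)%N -> tau < lam k.-1 + k%:R^-1 * \sum_(k <= i < m) lam i] by exists k.
elim: m lam => [|m IH] lam.
  by exists 0%N; split => // i; rewrite ltn0 andbF.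
rewrite /=; case: ltP => [hlt|hle].
  exists m.+1; split => //.
  - by move=> j _; rewrite big_geq // mulr0 addr0.
  - by split=> // j; lia.
  - by move=> j; lia.
  - by rewrite big_geq // mulr0 addr0.
pose lam' j := if (j < m)%N then lam j + m%:R^-1 * lam m else if j == m then 0 else lam j.
have [k [h1 h2 [h3 h4] h5 h6]] := IH lam'.
have e1 j : (j < m)%N -> lam' j = lam j + m%:R^-1 * lam m by rewrite /lam' => ->.
have e2 p : (0 < p <= m)%N -> \sum_(p <= l < m) lam' l =
    \sum_(p <= l < m) (lam l + m%:R^-1 * lam m).
  by move=> _; apply: eq_big_nat => l /andP[_ hl]; rewrite e1.
exists k; split.
- exact: leqW.
- move=> j hj; rewrite h2 // e2; last by lia.
  by rewrite e1 -?addrA ?shift_tail //; lia.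
- split=> j hj.
    have [e|hne] := eqVneq j m; first by rewrite e h4 // /lam' ltnn eqxx.
    by rewrite h3 //; lia.
  rewrite h4 /lam'; last by lia.
  by rewrite ltnNge ltnW //= gtn_eqF.
- move=> i hi; have [->|hne] := eqVneq i m; first by rewrite big_geq // mulr0 addr0.
  have him : (k <= i < m)%N by lia.
  have := h5 i him; rewrite e2 ?e1 -?addrA ?shift_tail //; lia.
- move=> k0; have := h6 k0; rewrite e2 ?e1 -?addrA ?shift_tail //; lia.
Qed.

(** If [k <= r], the [r - k] removed eigenvalues outside the tail are at most
    [tau], and the stopping rule bounds the redistributed mass by [2 k tau]. If [k > r],
    only tail eigenvalues are removed and their mass, shared by [k >= r] others, is
    controlled by the hypotheses on the tail. *)
Lemma threshold_error tau d r (lam : nat -> R) N :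
  (1 <= r <= d)%N -> 0 <= tau -> (forall i j, (i <= j < d)%N -> lam j <= lam i) ->
  (forall j, (j < d)%N -> 0 <= lam j) ->
  (\sum_(r <= j < d) lam j) ^+ 2 <= r%:R * N ->
  \sum_(r <= j < d) lam j ^+ 2 <= N ->
  \sum_(0 <= j < d) (threshold_rec tau d lam j - lam j) ^+ 2 <=
    2 * N + 5 * r%:R * tau ^+ 2.
Proof.
move=> /andP[r1 rd] tau0 hmono hlam hs hq.
have [k [kd hk hz hcond _]] := threshold_recP tau d lam.
set s := \sum_(k <= i < d) lam i in hk.
have N0 : 0 <= N.
  by apply: le_trans hq; apply: sumr_ge0 => j _; apply: sqr_ge0.
have r0 : 0 < r%:R :> R by rewrite ltr0n.
have sum0 p q : (q <= d)%N -> 0 <= \sum_(p <= j < q) lam j.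
  move=> hqd; rewrite big_nat_cond; apply: sumr_ge0 => j /andP[/andP[_ h] _].
  by apply: hlam; apply: leq_trans hqd.
rewrite (@big_cat_nat _ _ _ k) //=.
have -> : \sum_(0 <= j < k) (threshold_rec tau d lam j - lam j) ^+ 2
    = k%:R^-1 * s ^+ 2.
  have [k0|k0] := posnP k; first by rewrite k0 big_geq // invr0 mul0r.
  rewrite (eq_big_nat _ _ (F2 := fun=> (k%:R^-1 * s) ^+ 2)); last first.
    by move=> j /andP[_ hj]; rewrite hk // addrC addKr.
  rewrite sumr_const_nat subn0 -[_ *+ k]mulr_natl.
  by field; rewrite pnatr_eq0 -lt0n.
have -> : \sum_(k <= j < d) (threshold_rec tau d lam j - lam j) ^+ 2
    = \sum_(k <= j < d) lam j ^+ 2.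
  by apply: eq_big_nat => j hj; rewrite hz // sub0r sqrrN.
have hle j : (k <= j < d)%N -> lam j <= tau.
  move=> hj; apply: le_trans (hcond j hj); rewrite lerDl mulr_ge0 //.
  by apply: sum0.
have [kr|rk] := leqP k r.
- have hB : \sum_(k <= j < d) lam j ^+ 2 <= r%:R * tau ^+ 2 + N.
    rewrite (@big_cat_nat _ _ _ r) //= lerD //.
    apply: (@le_trans _ _ (\sum_(k <= j < r) tau ^+ 2)).
      rewrite big_nat_cond [X in _ <= X]big_nat_cond; apply: ler_sum => j /andP[/andP[h1 h2] _].
      rewrite ler_sqr ?nnegrE // ?hle ?hlam // ?h1 //=; exact: leq_trans rd.
    rewrite sumr_const_nat -[_ *+ (r - k)]mulr_natl ler_wpM2r ?sqr_ge0 //.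
    by rewrite ler_nat leq_subr.
  have hA : k%:R^-1 * s ^+ 2 <= 4 * r%:R * tau ^+ 2.
    have [k0|k0] := posnP k.
      by rewrite k0 invr0 mul0r mulr_ge0 ?sqr_ge0 // mulr_ge0.
    have kp : 0 < k%:R :> R by rewrite ltr0n.
    have hs2 : s <= 2 * k%:R * tau.
      have [kdd|] := ltnP k d; last first.
        by move=> h; rewrite /s big_geq // mulr_ge0 // mulr_ge0.
      have := hcond k; rewrite leqnn kdd => /(_ isT).
      have -> : s = lam k + \sum_(k.+1 <= l < d) lam l by rewrite /s big_ltn.
      have := sum0 k.+1 d (leqnn d); have := hlam k kdd.
      move: (\sum_(k.+1 <= l < d) _) (lam k) => T l l0 T0.
      have k1 : 1 <= k%:R :> R by rewrite ler1n.
      have kS : 0 < (k.+1)%:R :> R by rewrite ltr0n.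
      rewrite -(ler_pM2l kS) mulrDr mulrA divff ?gt_eqF // mul1r.
      rewrite -addn1 natrD; nra.
    have s0 : 0 <= s := sum0 k d (leqnn d).
    rewrite mulrC ler_pdivrMr //.
    have : s ^+ 2 <= (2 * k%:R * tau) ^+ 2.
      by rewrite ler_sqr ?nnegrE // (le_trans s0).
    have : k%:R <= r%:R :> R by rewrite ler_nat.
    have := sqr_ge0 tau => t2 kr' /le_trans; apply.
    rewrite (_ : _ ^+ 2 = 4 * k%:R * tau ^+ 2 * k%:R); last by ring.
    by rewrite ler_pM2r // ler_wpM2r // ler_wpM2l.
  lra.
- have hB : \sum_(k <= j < d) lam j ^+ 2 <= N.
    apply: le_trans hq; rewrite [X in _ <= X](@big_cat_nat _ _ _ k) //=; last exact: ltnW.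
    by rewrite lerDr; apply: sumr_ge0 => j _; apply: sqr_ge0.
  have hA : k%:R^-1 * s ^+ 2 <= N.
    have kp : 0 < k%:R :> R by rewrite ltr0n (leq_trans _ rk).
    rewrite mulrC ler_pdivrMr // (@le_trans _ _ (r%:R * N)) //; last first.
      by rewrite mulrC ler_wpM2l // ler_nat ltnW.
    apply: le_trans hs; rewrite ler_sqr ?nnegrE ?sum0 //.
    rewrite [X in _ <= X](@big_cat_nat _ _ _ k) //=; last exact: ltnW.
    by rewrite lerDr; apply: sum0.
  have : 0 <= r%:R * tau ^+ 2 by rewrite mulr_ge0 ?sqr_ge0 // ltW.
  lra.
Qed.

End Threshold.

(** * Error and rank of the thresholded estimator *)

Section Deterministic.
Local Open Scope sesquilinear_scope.
Local Open Scope complex_scope.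
Local Notation conjC := Num.Def.conjC.
Context {R : realType}.
Local Notation C := R[i].
Local Notation Re := (@complex.Re R).

Lemma thresholded_error d (P B rho : 'M[C]_d) tau : (1 <= \rank rho)%N ->
  0 <= tau -> state rho -> state P -> spectral_threshold tau P B ->
  sqnorm (B - rho) <= 6 * sqnorm (P - rho) + 10 * (\rank rho)%:R * tau ^+ 2.
Proof.
move=> r1 tau0 hrho hP [U [lam [hU hmono eP eB]]].
have hmono' : forall i j : 'I_d, (i <= j)%N -> lam j <= lam i.
  by move=> i j hij; apply: hmono; rewrite hij ltn_ord.
have hlam j : (j < d)%N -> 0 <= lam j.
  move=> hj; have hP' : state (U *m rdiag (fun j : 'I_d => lam j) *m U ^t*)
    by rewrite -[_ *m _ *m _]eP.
  exact: (state_eig_ge0 (Ordinal hj) hU hP').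
have hs := tail_trace hrho hP hU eP hmono'.
have hq := tail_squares hrho hP hU eP hmono'.
have rd : (\rank rho <= d)%N := rank_leq_row rho.
have := @threshold_error _ tau d (\rank rho) lam (sqnorm (P - rho)) _ tau0 hmono hlam.
rewrite !big_geq_mkord r1 rd /= => /(_ isT hs hq).
have -> : \sum_(i < d) (threshold_rec tau d lam i - lam i) ^+ 2 = sqnorm (B - P).
  rewrite eB eP -mulmxBl -mulmxBr.
  have -> : diag_of d (threshold_rec tau d lam) - diag_of d lam =
     rdiag (fun j : 'I_d => threshold_rec tau d lam j - lam j).
    by rewrite /diag_of -raddfB /=; congr diag_mx; apply/rowP => j; rewrite !mxE rmorphB.
  by rewrite sqnorm_spectral.
move=> h; have -> : B - rho = (B - P) + (P - rho) by rewrite addrA subrK.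
apply: le_trans (sqnorm_sum_le _ _) _; lra.
Qed.

(** In an eigenbasis, a vanishing sum of nonnegative terms forces every product of
    an eigenvalue and a coordinate to vanish. *)
Lemma psd_null d (Z : 'M[C]_d) v : psdmx Z -> qform Z v = 0 -> Z *m v = 0.
Proof.
move=> hZ hv; have [W [z [hW eZ]]] := hermitian_spectral hZ.1.
have z0 j : 0 <= z j by rewrite -(udiag_self z j hW) -eZ psd_udiag.
pose y := W ^t* *m v.
have ev : v = W *m y by rewrite mulmxA unitary_mulVA // mul1mx.
move: hv; rewrite {1}ev eZ qform_combination // => /eqP.
rewrite psumr_eq0 => [/allP h|j _]; last by rewrite mulr_ge0 ?sqmod_ge0.
rewrite -!mulmxA -/y [X in W *m X](_ : _ = 0) ?mulmx0 //.
apply/matrixP => j k; rewrite ord1 mul_diag_mx !mxE.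
have := h j; rewrite mem_index_enum => /(_ isT) /= /eqP /eqP.
rewrite mulf_eq0 => /orP[/eqP ->|/eqP /sqmod_eq0]; first by rewrite mul0r.
by rewrite !mxE => ->; rewrite mulr0.
Qed.

Lemma state_ketbra d (v : 'cV[C]_d) : sqnorm v = 1 -> state (ketbra v).
Proof.
move=> hv; split; last first.
  by rewrite /ketbra mxtrace_mulC sqnorm_tr hv.
apply: psdI; first by rewrite /ketbra adjmxM trmxCK.
move=> w; rewrite /qform /ketbra !mulmxA -mulmxA.
set a := w ^t* *m v; have -> : v ^t* *m w = a ^t* by rewrite adjmxM trmxCK.
by rewrite mxE big_ord1 adjmxE mul_conjC_sqmod sqmod_ge0.
Qed.

Lemma rdot_ketbra d (G : 'M[C]_d) v : G ^t* = G -> rdot G (ketbra v) = qform G v.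
Proof.
by move=> hG; rewrite /rdot hG /ketbra /qform mulmxA mxtrace_mulC mulmxA /mxtrace big_ord1.
Qed.

(** The variational inequality tested on the pure state along [v]: the form of
    [A - P] is at most the multiplier [rdot (A - P) P]. *)
Lemma projection_gap d (A P : 'M[C]_d) v : A ^t* = A -> state_projection A P ->
  qform (A - P) v <= rdot (A - P) P * sqnorm v.
Proof.
move=> hA hP; have hG : (A - P) ^t* = A - P by rewrite adjmxB hA state_herm //; case: hP.
have [->|v0] := eqVneq v 0.
  by rewrite /qform mulmx0 mxE /= -rdotnn /rdot mulmx0 mxtrace0 mulr0.
pose N := sqnorm v; have N0 : 0 < N := sqnorm_gt0 v0.
pose s := (Num.sqrt N)^-1.
have s2 : s ^+ 2 = N^-1 by rewrite /s exprVn sqr_sqrtr // ltW.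
have hs : sqnorm (s%:C *: v) = 1 by rewrite sqnormZ s2 mulVf // gt_eqF.
have := projection_variational hP (state_ketbra hs).
rewrite rdotDr rdotNr rdot_ketbra // subr_le0.
have -> : qform (A - P) (s%:C *: v) = s ^+ 2 * qform (A - P) v.
  by rewrite /qform adjmxZ -!scalemxAl -scalemxAr !mxE !ReZ mulrA expr2.
by rewrite s2 -/N mulrC ler_pdivrMr.
Qed.

Lemma lambda_min_le d (rho Y : 'M[C]_d) mu i : state rho -> Y \is unitarymx ->
  rho = Y *m rdiag mu *m Y ^t* -> mu i != 0 -> lambda_min rho <= mu i.
Proof.
move=> hrho hY e hi; rewrite /lambda_min; apply: ge_inf.
  exists 0 => l /= [_ /eigenvalueP [v hv v0]].
  have := psd_qform (v ^t*) hrho.1; rewrite /qform trmxCK hv -scalemxAl mxE.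
  have -> : (v *m v ^t*) 0 0 = (sqnorm (v ^t*))%:C by rewrite -sqnorm_col trmxCK.
  rewrite ReZ /= pmulr_lge0 // sqnorm_adj; exact: sqnorm_gt0.
split=> //; apply/eigenvalueP; exists (row i (Y ^t*)).
  rewrite e -row_mul !mulmxA unitary_mulAV // mul1mx.
  by apply/rowP => k; rewrite mxE mul_diag_mx !mxE.
have := sqnorm_unit_col i hY; apply: contra_eq_neq => h.
have -> : sqnorm (col i Y) = sqnorm (row i (Y ^t*)).
  by rewrite -(sqnorm_adj (col i Y)) tr_col map_row.
by rewrite h /sqnorm big1 ?(eq_sym 0) ?oner_eq0 // => k _; rewrite big1 // => l _;
  rewrite mxE /sqmod /= expr0n addr0.
Qed.

(** Let [G = A - P] and [c = rdot G P]. By [projection_gap] and complementary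
    slackness [c - G] is positive semidefinite and annihilates the eigenvectors of [P]
    with positive eigenvalues. Testing it on vectors of the kernel of [rho] gives
    [lam m <= t - c] for [m >= r], and on the support of [rho] gives a tail mass of at
    most [r (t + c)], so every value inspected beyond index [r] is at most [2 t].
    Testing it on the support of [rho] against the low eigenvectors of [P] gives
    [lam (r - 1) >= 5 t - c >= 4 t], so the algorithm stops there. *)
Lemma rank_recovery d (A P B rho : 'M[C]_d) t : (1 <= \rank rho)%N ->
  0 < t -> 6 * t <= lambda_min rho ->
  state rho -> A ^t* = A -> state_projection A P ->
  form_bound (A - rho) t -> spectral_threshold (2 * t) P B ->
  \rank B = \rank rho.
Proof.
set r := \rank rho => r1 t0 hlmin hrho hA hP hop [V [lam [hV hmono eP eB]]].
have rd : (r <= d)%N := rank_leq_row rho.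
have sP : state P by case: hP.
pose G := A - P; pose c := rdot G P.
have hgap v : qform G v <= c * sqnorm v := projection_gap v hA hP.
have hG : G ^t* = G by rewrite adjmxB hA state_herm.
pose lo (j : 'I_d) := lam j.
have ePo : P = V *m rdiag lo *m V ^t* := eP.
have hmono' : forall i j : 'I_d, (i <= j)%N -> lo j <= lo i.
  by move=> i j hij; apply: hmono; rewrite hij ltn_ord.
have hlo j : 0 <= lo j by apply: (@state_eig_ge0 _ d V); rewrite -?ePo.
have hlam j : (j < d)%N -> 0 <= lam j by move=> hj; apply: (hlo (Ordinal hj)).
have hA_le v : qform A v <= qform rho v + t * sqnorm v.
  by have := hop v; rewrite qformB ler_distl => /andP[].
have hA_ge v : qform rho v - t * sqnorm v <= qform A v.
  by have := hop v; rewrite qformB ler_distl => /andP[].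
have qAE v : qform A v = qform G v + qform P v by rewrite /G qformB subrK.
have hnc j : sqnorm (col j V) = 1 := sqnorm_unit_col j hV.
(* Complementary slackness: the mean of c - G over the spectrum of P is zero. *)
have hslack j : 0 < lo j -> udiag V G j = c.
  have hz i : 0 <= lo i * (c - udiag V G i).
    rewrite mulr_ge0 // subr_ge0 udiag_qform.
    by have := hgap (col i V); rewrite hnc mulr1.
  have : \sum_i lo i * (c - udiag V G i) = 0.
    under eq_bigr do rewrite mulrBr.
    rewrite sumrB -mulr_suml (state_eig_sum hV) -?ePo // mul1r.
    by rewrite -rdot_spectral // -ePo subrr.
  move/eqP; rewrite psumr_eq0 // => /allP /(_ j); rewrite mem_index_enum => /(_ isT).
  by move=> /= /eqP/eqP; rewrite mulf_eq0 => /orP[/eqP ->|];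
    rewrite ?ltxx // subr_eq0 eq_sym => /eqP.
pose Z := c%:C%:M - G.
have hZ : psdmx Z.
  apply: psdI; last by move=> v; rewrite qformB qform1 subr_ge0.
  rewrite adjmxB hG; congr (_ - _).
  by apply/matrixP => i j; rewrite adjmxE !mxE rmorphMn /= conjC_real eq_sym.
have hZ0 j : 0 < lo j -> Z *m col j V = 0.
  by move=> hj; apply: psd_null => //; rewrite qformB qform1 hnc -udiag_qform hslack // mulr1 subrr.
have hloE j : lo j = udiag V A j - udiag V G j.
  by rewrite -(udiag_self lo j hV) -ePo /G udiagB opprB addrCA subrr addr0.
have hsum1 : \sum_j lo j = 1 by apply: (state_eig_sum hV); rewrite -ePo.
have hc : c <= t.
  rewrite leNgt; apply/negP => hct.
  have hpos j : 0 < lo j -> lo j < udiag V rho j.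
    move=> hj; have := hA_le (col j V); rewrite -!udiag_qform hnc mulr1.
    rewrite hloE (hslack j hj); move: (udiag V A j) (udiag V rho j) hct => p q.
    by clear; lra.
  have hle j : 0 <= udiag V rho j - lo j.
    rewrite subr_ge0; have := hlo j; rewrite le_eqVlt => /orP[/eqP <-|/hpos/ltW //].
    exact: psd_udiag hrho.1.
  have : \sum_j (udiag V rho j - lo j) = 0.
    by rewrite sumrB hsum1 sum_udiag_state // subrr.
  move/eqP; rewrite psumr_eq0 // => /allP h0.
  have hz j : lo j = 0.
    apply/eqP; apply: contraTT isT => hj; have hj' : 0 < lo j by rewrite lt_def hj hlo.
    have := h0 j; rewrite mem_index_enum => /(_ isT) /= /eqP.
    by have := hpos j hj'; lra.
  by have := hsum1; rewrite big1 // => /eqP; rewrite eq_sym oner_eq0.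
(* The leading m + 1 > r eigenvectors of P span a vector that rho annihilates. *)
have hlow (m : 'I_d) : (r <= m)%N -> 0 < lo m -> lo m <= t - c.
  move=> hrm hm; pose S := [set j : 'I_d | (j <= m)%N].
  have hS : (\rank rho < #|S|)%N.
    have -> : #|S| = m.+1; last by rewrite ltnS.
    rewrite -sum1_card (eq_bigl (fun j : 'I_d => (j < m.+1)%N)) => [|j]; last by rewrite inE ltnS.
    by rewrite -(big_ord_widen d (fun=> 1%N)) // sum1_card card_ord.
  have [x [x0 hx hk]] := kernel_combination V hS.
  have hxn : 0 < sqnorm (V *m x).
    rewrite sqnorm_combination //; have := sqnorm_gt0 x0; rewrite /sqnorm.
    by under eq_bigr do rewrite big_ord1.
  have hZx : Z *m (V *m x) = 0.
    rewrite mulmxA; apply/matrixP => i k; rewrite ord1 !mxE big1 // => j _.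
    case: (boolP (j \in S)) => [|/hx ->]; last by rewrite mulr0.
    rewrite inE => hj; have hlj : 0 < lo j by apply: lt_le_trans hm (hmono' _ _ hj).
    have /matrixP /(_ i 0) := hZ0 j hlj.
    rewrite mxE [in X in _ = X -> _]mxE => h.
    rewrite mxE (_ : \sum_j0 Z i j0 * V j0 j = 0) ?mul0r // -[RHS]h.
    by apply: eq_bigr => l _; congr (_ * _); rewrite mxE.
  have hq : qform G (V *m x) = c * sqnorm (V *m x).
    have : qform Z (V *m x) = 0 by rewrite /qform -mulmxA hZx mulmx0 mxE.
    by rewrite qformB qform1 => /eqP; rewrite subr_eq0 eq_sym => /eqP.
  have hr0 : qform rho (V *m x) = 0 by rewrite /qform -mulmxA hk mulmx0 mxE.
  have hPx : lo m * sqnorm (V *m x) <= qform P (V *m x).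
    rewrite ePo qform_combination // sqnorm_combination // mulr_sumr; apply: ler_sum => j _.
    case: (boolP (j \in S)) => [|/hx ->]; last by rewrite /sqmod /= expr0n addr0 !mulr0.
    by rewrite inE => hj; rewrite ler_wpM2r ?sqmod_ge0 // hmono'.
  rewrite -(ler_pM2r hxn); have := hA_le (V *m x); rewrite qAE hq hr0.
  by move: hPx; move: (qform _ _) (sqnorm _) (lo m); clear => p q l; lra.
have [Y [mu [hY erho]]] := hermitian_spectral (state_herm hrho).
pose S := [set i | mu i != 0].
have hS : #|S| = r by rewrite /r erho rank_spectral.
have htail : \sum_(j < d | (r <= j)%N) lo j <= r%:R * (t + c).
  have := tail_le_compression hY hV hS hmono' hlo.
  rewrite -ePo => h; apply: le_trans h _.
  have h1 := sum_udiag_state hY sP; rewrite (bigID (mem S)) /= in h1.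
  rewrite (eq_bigl (fun i => i \notin S)) => [|i]; last by rewrite inE.
  have h2 : \sum_(i in S) (udiag Y rho i - (t + c)) <= \sum_(i in S) udiag Y P i.
    apply: ler_sum => i _; have := hA_ge (col i Y); have := hgap (col i Y).
    have := qAE (col i Y); rewrite sqnorm_unit_col // -!udiag_qform.
    by move: (udiag Y A i) (udiag Y G i) (udiag Y P i) (udiag Y rho i); clear => *; lra.
  rewrite sumrB (sum_udiag_support hY hrho erho (erefl S)) sumr_const hS -[_ *+ r]mulr_natl in h2.
  set p := \sum_(i in S) _ in h1 h2; set q := \sum_(i | i \notin S) _ in h1 *.
  by move: h1 h2; clearbody p q; clear; lra.
have htail0 : 0 <= \sum_(j < d | (r <= j)%N) lo j by apply: sumr_ge0.
have htc : 0 <= t + c.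
  by have := le_trans htail0 htail; rewrite pmulr_rge0 // ltr0n.
(* The eigenvectors of P of index at least r - 1 are too many to avoid the support
   of rho, whose complement is the range of the matrix with diagonal a. *)
have htop : 4 * t <= lam r.-1.
  have hr1 : (r.-1 < d)%N by rewrite prednK.
  pose T := [set j : 'I_d | (r.-1 <= j)%N].
  pose a (i : 'I_d) : R := (mu i == 0)%:R.
  have hT : (\rank (Y *m rdiag a *m Y ^t*) < #|T|)%N.
    rewrite rank_spectral //.
    have -> : #|[set j | a j != 0]| = (d - r)%N.
      have -> : (d - r)%N = #|~: S| by rewrite cardsCs finset.setCK card_ord hS.
      apply: eq_card => j.
      by rewrite !inE /a; case: (mu j == 0); rewrite ?oner_eq0 ?eqxx.
    have -> : #|T| = (d - r.-1)%N; last by lia.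
    rewrite cardsCs card_ord; congr (_ - _)%N.
    rewrite -sum1_card (eq_bigl (fun j : 'I_d => (j < r.-1)%N)) => [|j];
      last by rewrite !inE -ltnNge.
    by rewrite -(big_ord_widen d (fun=> 1%N)) ?(ltnW hr1) // sum1_card card_ord.
  have [x [x0 hx hk]] := kernel_combination V hT.
  set u := V *m x in hk.
  have hun : 0 < sqnorm u.
    rewrite sqnorm_combination //; have := sqnorm_gt0 x0; rewrite /sqnorm.
    by under eq_bigr do rewrite big_ord1.
  have hPu : qform P u <= lam r.-1 * sqnorm u.
    rewrite ePo qform_combination // sqnorm_combination // mulr_sumr; apply: ler_sum => j _.
    case: (boolP (j \in T)) => [|/hx ->]; last by rewrite /sqmod /= expr0n addr0 !mulr0.
    by rewrite inE => hj; rewrite ler_wpM2r ?sqmod_ge0 // hmono // hj ltn_ord.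
  pose y := Y ^t* *m u.
  have eu : u = Y *m y by rewrite mulmxA unitary_mulVA // mul1mx.
  have hy i : mu i = 0 -> y i 0 = 0.
    move=> hi; have : rdiag a *m y = 0.
      have := congr1 (mulmx (Y ^t*)) hk.
      by rewrite mulmx0 mulmxA (adj_mul_spectral _ hY) -mulmxA.
    by move/matrixP => /(_ i 0); rewrite mul_diag_mx !mxE /a hi eqxx mul1r.
  have hru : 6 * t * sqnorm u <= qform rho u.
    rewrite eu erho qform_combination // sqnorm_combination // mulr_sumr; apply: ler_sum => i _.
    have [/hy ->|hi] := eqVneq (mu i) 0; first by rewrite /sqmod /= expr0n addr0 !mulr0.
    rewrite ler_wpM2r ?sqmod_ge0 // (le_trans hlmin) //; exact: (lambda_min_le hrho hY erho hi).
  have := hA_ge u; have := hgap u; have := qAE u => h1 h2 h3.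
  have hcn : c * sqnorm u <= t * sqnorm u by rewrite ler_pM2r.
  rewrite -(ler_pM2r hun); move: h1 h2 h3 hru hPu hcn.
  move: (qform A u) (qform G u) (qform P u) (qform rho u) (sqnorm u) (lam r.-1).
  by clear => *; lra.
have [k [kd hk hz hcond hstop]] := threshold_recP (2 * t) d lam.
have hs (p : nat) : (r <= p)%N -> \sum_(p <= i < d) lam i <= r%:R * (t + c).
  move=> hp; apply: le_trans htail.
  have -> : \sum_(j < d | (r <= j)%N) lo j = \sum_(r <= j < d) lam j.
    by rewrite big_geq_mkord.
  have [hpd|hpd] := leqP p d; last first.
       rewrite big_geq ?(ltnW hpd) // big_nat_cond.
    by apply: sumr_ge0 => j /andP[/andP[_ h] _]; apply: hlam.
  rewrite [X in _ <= X](@big_cat_nat _ _ _ p) //= lerDr big_nat_cond.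
  by apply: sumr_ge0 => j /andP[/andP[_ h] _]; apply: hlam; apply: leq_trans hpd.
have hkr : k = r.
  apply/eqP; rewrite eqn_leq; apply/andP; split.
    rewrite leqNgt; apply/negP => rk; have k0 : (0 < k)%N by apply: leq_trans rk.
    have hkd : (k.-1 < d)%N by rewrite prednK.
    have := hstop k0; apply/negP; rewrite -leNgt.
    have := hlam k.-1 hkd; rewrite le_eqVlt => /orP[/eqP h0|hpos].
      rewrite -h0 add0r big_nat_cond big1 ?mulr0 ?mulr_ge0 ?(ltW t0) // => j /andP[/andP[hj1 hj2] _].
      apply/eqP; rewrite eq_le hlam // h0 hmono // hj2 andbT.
      exact: leq_trans (leq_pred k) hj1.
    have hrk : (r <= k.-1)%N by rewrite -ltnS prednK.
    have h1 : lam k.-1 <= t - c := hlow (Ordinal hkd) hrk hpos.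
    have kp : 0 < k%:R :> R by rewrite ltr0n.
    have h2 : k%:R^-1 * \sum_(k <= i < d) lam i <= t + c.
      rewrite mulrC ler_pdivrMr // (le_trans (hs k (ltnW rk))) // mulrC ler_wpM2l //.
      by rewrite ler_nat ltnW.
    by move: h1 h2; lra.
  rewrite leqNgt; apply/negP => kr.
  have h := hcond r.-1; rewrite prednK // in h.
  have {}h : lam r.-1 + r%:R^-1 * \sum_(r <= l < d) lam l <= 2 * t.
    by apply: h; rewrite -ltnS prednK // kr /=; exact: leq_trans rd.
  have : 0 <= r%:R^-1 * \sum_(r <= l < d) lam l.
    rewrite mulr_ge0 // big_nat_cond sumr_ge0 // => j /andP[/andP[_ hj] _]; exact: hlam.
  by move: htop h t0; lra.
rewrite eB rank_spectral // -hkr.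
rewrite -sum1_card (eq_bigl (fun j : 'I_d => (j < k)%N)).
  by rewrite -(big_ord_widen d (fun=> 1%N)) // sum1_card card_ord.
move=> j; rewrite inE; have [hj|hj] := ltnP j k; last by rewrite hz ?eqxx // hj ltn_ord.
rewrite hk // gt_eqF //.
have k0 : (0 < k)%N by apply: leq_ltn_trans hj.
apply: lt_le_trans (lt_trans _ (hstop k0)) _; first by rewrite mulr_gt0.
by rewrite lerD2r hmono // prednK // kd andbT -ltnS prednK.
Qed.

End Deterministic.

(** * Gentle measurements *)

Section Gentle.
Local Open Scope sesquilinear_scope.
Local Open Scope complex_scope.
Local Notation conjC := Num.Def.conjC.
Context {R : realType}.
Local Notation C := R[i].
Local Notation Re := (@complex.Re R).

Lemma sqrtC_real (a : R) : 0 <= a -> sqrtC (a%:C) = (Num.sqrt a)%:C.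
Proof.
move=> a0; rewrite -[in LHS](sqr_sqrtr a0) rmorphXn /= sqrCK //.
by rewrite ler0c sqrtr_ge0.
Qed.

(** The functional calculus is independent of the diagonalization: the change of
    basis [W] between two of them intertwines the diagonals, hence their square roots. *)
Lemma sqrtmx_spectral d (U : 'M[C]_d) (a : 'I_d -> R) : U \is unitarymx ->
  (forall j, 0 <= a j) ->
  sqrtmx (U *m rdiag a *m U ^t*) = U *m rdiag (fun j => Num.sqrt (a j)) *m U ^t*.
Proof.
move=> hU a0; rewrite /sqrtmx.
have [A eA'] : exists A, A = U *m rdiag a *m U ^t* by exists (U *m rdiag a *m U ^t*).
rewrite -eA'; set P := spectralmx A; set s := spectral_diag A.
have hP : P \is unitarymx by apply: spectral_unitarymx.
have /orthomx_spectralP eA : A \is normalmx.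
  by apply/normalmxP; rewrite eA' spectral_herm.
rewrite -/P -/s (invmx_unitary hP) in eA; rewrite (invmx_unitary hP).
clearbody P s; pose W := P *m U.
have h1 : diag_mx s *m W = W *m rdiag a.
  have : P *m A *m U = P *m (P ^t* *m diag_mx s *m P) *m U by rewrite -eA.
  rewrite eA' !mulmxA -[X in X = _]mulmxA (unitary_mulAV hU) mulmx1.
  by rewrite (unitary_mulVA hP) mul1mx -!mulmxA => ->.
have h2 : diag_mx (map_mx sqrtC s) *m W = W *m rdiag (fun j => Num.sqrt (a j)).
  apply/matrixP => i j; have /matrixP /(_ i j) := h1.
  rewrite !mul_diag_mx !mul_mx_diag !mxE -!/(W i j).
  set z := \sum_k _; have [->|z0] := eqVneq z 0; first by rewrite !mulr0 !mul0r.
  by rewrite mulrC => /(mulfI z0) ->; rewrite sqrtC_real // mulrC.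
have -> : P ^t* *m diag_mx (map_mx sqrtC s) *m P
    = P ^t* *m (diag_mx (map_mx sqrtC s) *m W) *m U ^t*.
  by rewrite /W -!mulmxA (unitary_mulVA hU) mulmx1.
by rewrite h2 /W !mulmxA (unitary_mulAV hP) mul1mx.
Qed.

Lemma trace_norm_spectral d (Z : 'M[C]_d) (x : 'I_d -> R) : Z \is unitarymx ->
  trace_norm (Z *m rdiag x *m Z ^t*) = 2^-1 * \sum_j `|x j|.
Proof.
move=> hZ; rewrite /trace_norm spectral_herm; congr (_ * _).
rewrite spectral_sqr //.
rewrite sqrtmx_spectral // => [|j]; last exact: sqr_ge0.
rewrite -(sum_udiag _ hZ); apply: eq_bigr => j _.
by rewrite udiag_self // sqrtr_sqr.
Qed.

(** Expand the square of [A - (<A, B> / |B|^2) B]. *)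
Lemma rdot_CS m n (A B : 'M[C]_(m, n)) : rdot A B ^+ 2 <= sqnorm A * sqnorm B.
Proof.
have [->|B0] := eqVneq B 0.
  by rewrite /rdot mulmx0 mxtrace0 expr0n /= mulr_ge0 // sqnorm_ge0.
have N0 := sqnorm_gt0 B0; set q := rdot A B; set N := sqnorm B in N0 *.
have := sqnorm_ge0 (A - (q / N)%:C *: B).
rewrite sqnormD rdotNr rdotZr sqnormN sqnormZ -/q -/N.
have -> : sqnorm A + 2 * - (q / N * q) + (q / N) ^+ 2 * N = sqnorm A - q ^+ 2 / N.
  by field; rewrite gt_eqF.
by rewrite subr_ge0 ler_pdivrMr.
Qed.

Definition maskmx m n (S : {set 'I_m}) (A : 'M[C]_(m, n)) : 'M[C]_(m, n) :=
  \matrix_(i, j) (if i \in S then A i j else 0).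

Lemma sqnorm_mask m n S (A : 'M[C]_(m, n)) :
  sqnorm (maskmx S A) = \sum_(i in S) \sum_j sqmod (A i j).
Proof.
rewrite [RHS]big_mkcond; apply: eq_bigr => i _; case: ifP => hi.
  by apply: eq_bigr => j _; rewrite mxE hi.
by rewrite big1 // => j _; rewrite mxE hi /sqmod /= expr0n addr0.
Qed.

Lemma sqnorm_mask_split m n S (A : 'M[C]_(m, n)) :
  sqnorm A = sqnorm (maskmx S A) + sqnorm (maskmx (~: S) A).
Proof.
rewrite !sqnorm_mask /sqnorm (bigID (mem S)) /=; congr (_ + _).
by apply: eq_bigl => i; rewrite inE.
Qed.

Lemma rdot_mask_split m n S (A B : 'M[C]_(m, n)) :
  rdot A B = rdot (maskmx S A) (maskmx S B) + rdot (maskmx (~: S) A) (maskmx (~: S) B).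
Proof.
rewrite !rdotE -big_split; apply: eq_bigr => i _.
rewrite -big_split; apply: eq_bigr => j _ /=; rewrite !mxE inE.
by case: (i \in S) => /=; rewrite oppr0 mul0r subr0 ?addr0 ?add0r.
Qed.

(** For unit vectors [a], [b] and a projection, the probabilities X and Y of
    passing it satisfy |X - Y| <= sqrt (1 - <a, b>^2): split <a, b> along the projection
    and apply Cauchy-Schwarz to both parts. *)
Lemma projection_overlap m n S (a b : 'M[C]_(m, n)) : sqnorm a = 1 -> sqnorm b = 1 ->
  (sqnorm (maskmx S a) - sqnorm (maskmx S b)) ^+ 2 <= 1 - rdot a b ^+ 2.
Proof.
move=> ha hb; have h1 := rdot_CS (maskmx S a) (maskmx S b).
have h2 := rdot_CS (maskmx (~: S) a) (maskmx (~: S) b).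
have ea := sqnorm_mask_split S a; have eb := sqnorm_mask_split S b.
have := sqnorm_ge0 (maskmx S a); have := sqnorm_ge0 (maskmx S b).
have := sqnorm_ge0 (maskmx (~: S) a); have := sqnorm_ge0 (maskmx (~: S) b).
rewrite (rdot_mask_split S a b).
move: ea eb h1 h2; rewrite ha hb.
move: (sqnorm (maskmx S a)) (sqnorm (maskmx S b))
  (sqnorm (maskmx (~: S) a)) (sqnorm (maskmx (~: S) b)).
move: (rdot (maskmx S a) _) (rdot (maskmx (~: S) a) _) => u v X Y X' Y' ea eb h1 h2 Y'0 X'0 Y0 X0.
have h3 : 2 * u * v <= X * X' + Y * Y'.
  have hs : (2 * u * v) ^+ 2 <= (X * X' + Y * Y') ^+ 2.
    have : u ^+ 2 * v ^+ 2 <= (X * Y) * (X' * Y').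
      by apply: ler_pM; rewrite ?sqr_ge0.
    have : 0 <= (X * X' - Y * Y') ^+ 2 := sqr_ge0 _.
    clear; lra.
  have h0 : 0 <= X * X' + Y * Y' by rewrite addr_ge0 // mulr_ge0.
  have [hn|hp] := ltP (2 * u * v) 0; first by rewrite (le_trans (ltW hn)).
  by rewrite -ler_sqr.
have e1 : X' = 1 - X by rewrite ea addrAC subrr add0r.
have e2 : Y' = 1 - Y by rewrite eb addrAC subrr add0r.
move: h1 h2 h3; rewrite e1 e2; clear; lra.
Qed.

Lemma spectral_factor d (U : 'M[C]_d) (a : 'I_d -> R) :
  (U *m rdiag a) *m (U *m rdiag a) ^t* = U *m rdiag (fun j => a j ^+ 2) *m U ^t*.
Proof. by rewrite adjmxM adj_rdiag mulmxA -[U *m rdiag a *m rdiag a]mulmxA mul_rdiag. Qed.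

Lemma eq_rdiag d (a b : 'I_d -> R) : a =1 b -> rdiag a = rdiag b.
Proof. by move=> /funext ->. Qed.

(** A purification of [rho]: the vector [A] of the doubled space has reduced
    state [rho]. *)
Lemma psd_factor d (rho : 'M[C]_d) : psdmx rho -> exists A : 'M[C]_d, rho = A *m A ^t*.
Proof.
move=> hrho; have [U [mu [hU erho]]] := hermitian_spectral hrho.1.
have mu0 j : 0 <= mu j by rewrite -(udiag_self mu j hU) -erho psd_udiag.
exists (U *m rdiag (fun j => Num.sqrt (mu j))); rewrite spectral_factor (@eq_rdiag _ _ mu) // => j.
by rewrite sqr_sqrtr.
Qed.

Lemma sqnorm_factor_tr d (M A : 'M[C]_d) :
  \tr ((M *m A) ^t* *m (M *m A)) = \tr (A *m A ^t* *m (M ^t* *m M)).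
Proof. by rewrite adjmxM -mulmxA mxtrace_mulC [in RHS]mxtrace_mulC !mulmxA. Qed.

Lemma scaled_factor d (s : R) (M A : 'M[C]_d) :
  (s%:C *: (M *m A)) *m (s%:C *: (M *m A)) ^t* =
  (s ^+ 2)%:C *: (M *m (A *m A ^t*) *m M ^t*).
Proof.
rewrite adjmxZ -scalemxAl -scalemxAr scalerA -rmorphM /= -expr2.
by rewrite adjmxM !mulmxA.
Qed.

Lemma rdot_unitary m n (U : 'M[C]_m) (A B : 'M[C]_(m, n)) : U \is unitarymx ->
  rdot (U ^t* *m A) (U ^t* *m B) = rdot A B.
Proof.
move=> hU; rewrite /rdot adjmxM trmxCK -mulmxA (mulmxA U).
by rewrite (unitary_mulVA hU) mul1mx.
Qed.

Lemma rdot_factor d (M A : 'M[C]_d) : rdot A (M *m A) = Re (\tr (A *m A ^t* *m M)).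
Proof. by rewrite /rdot mxtrace_mulC [in RHS]mxtrace_mulC mulmxA. Qed.

(** Half the trace norm of a traceless Hermitian matrix is its trace against the
    projection on its positive part. With [rho = A A^*], the state and its update are
    the reduced states of the unit vectors [A] and [M A / sqrt p], so
    [projection_overlap] applies. Their overlap is tr (rho M) / sqrt (tr (rho M^2)), and
    (hi - m) (m - lo) >= 0 for the eigenvalues m of M yields the Kantorovich bound
    1 - alpha^2 for its square. *)
Lemma gentle_spectral d (V rho M : 'M[C]_d) (m : 'I_d -> R) (lo hi alpha p : R) :
  V \is unitarymx -> state rho -> 0 < lo -> 0 <= alpha ->
  (forall k, lo <= m k <= hi) -> hi - lo <= alpha * (hi + lo) -> lo <= hi ->
  M = V *m rdiag m *m V ^t* ->
  \tr (rho *m (M ^t* *m M)) = p%:C -> 0 < p ->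
  trace_norm (rho - p^-1%:C *: (M *m rho *m M ^t*)) <= alpha.
Proof.
move=> hV hrho lo0 al0 hm hal hlohi eM hp p0.
have hM : M ^t* = M by rewrite eM spectral_herm.
have [A eA] := psd_factor hrho.1.
have [X eX0] : exists X, X = rho - p^-1%:C *: (M *m rho *m M ^t*) by eexists.
rewrite -eX0; have hX : X ^t* = X.
  rewrite eX0 adjmxB adjmxZ !adjmxM trmxCK (state_herm hrho).
  by rewrite [M *m (_ *m _)]mulmxA.
have [Z [x [hZ eX]]] := hermitian_spectral hX.
rewrite eX trace_norm_spectral //.
pose q k := udiag V rho k.
have q0 k : 0 <= q k by apply: psd_udiag hrho.1.
have q1 : \sum_k q k = 1 by apply: sum_udiag_state.
have trM a : Re (\tr (rho *m (V *m rdiag a *m V ^t*))) = \sum_k a k * q k.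
  by rewrite -{1}(state_herm hrho) -/(rdot _ _) rdot_spectral // state_herm.
have eMM : M ^t* *m M = V *m rdiag (fun k => m k ^+ 2) *m V ^t*.
  by rewrite hM {1 2}eM spectral_sqr.
pose e1 := \sum_k m k * q k.
have ep : p = \sum_k m k ^+ 2 * q k by rewrite -trM -eMM hp.
(* (p + hi lo)^2 >= 4 p hi lo, and 4 hi lo = (hi + lo)^2 - (hi - lo)^2. *)
have kant : (1 - alpha ^+ 2) * p <= e1 ^+ 2.
  have hlin : p <= (hi + lo) * e1 - hi * lo.
    rewrite ep mulr_sumr -[hi * lo]mulr1 -q1 mulr_sumr -sumrB; apply: ler_sum => k _.
    have /andP[h1 h2] := hm k.
    have : 0 <= q k * ((m k - lo) * (hi - m k)) by rewrite !mulr_ge0 ?subr_ge0.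
    by move: (m k) (q k); clear => *; lra.
  have e10 : 0 <= e1.
    apply: sumr_ge0 => k _; rewrite mulr_ge0 //.
    by case/andP: (hm k) => h _; apply: le_trans h; apply: ltW.
  have hs : (p + hi * lo) ^+ 2 <= ((hi + lo) * e1) ^+ 2.
    by rewrite ler_sqr ?nnegrE; [lra|rewrite addr_ge0 ?mulr_ge0 //; lra|rewrite mulr_ge0 //; lra].
  have ha2 : (hi - lo) ^+ 2 <= (alpha * (hi + lo)) ^+ 2.
    by rewrite ler_sqr ?nnegrE ?subr_ge0 // mulr_ge0 // addr_ge0 // ltW // (lt_le_trans lo0).
  have hh : 0 < (hi + lo) ^+ 2 by rewrite exprn_gt0 // addr_gt0 // (lt_le_trans lo0).
  rewrite -(ler_pM2r hh).
  have : 0 <= (p - hi * lo) ^+ 2 := sqr_ge0 _.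
  have : (hi - lo) ^+ 2 * p <= (alpha * (hi + lo)) ^+ 2 * p by rewrite ler_pM2r.
  by move: hs; clear; lra.
pose s := (Num.sqrt p)^-1.
have s2 : s ^+ 2 = p^-1 by rewrite /s exprVn sqr_sqrtr // ltW.
pose a := Z ^t* *m A; pose b := s%:C *: (Z ^t* *m (M *m A)).
have na : sqnorm a = 1.
  rewrite sqnorm_unitaryl // -sqnorm_adj; apply: (@complexI R).
  by rewrite -sqnorm_tr trmxCK -eA hrho.2.
have nb : sqnorm b = 1.
  rewrite sqnormZ sqnorm_unitaryl // s2 (_ : sqnorm (M *m A) = p) ?mulVf ?gt_eqF //.
  by apply: (@complexI R); rewrite -sqnorm_tr -hp eA sqnorm_factor_tr.
have hab : rdot a b = s * e1.
  by rewrite rdotZr rdot_unitary // rdot_factor -eA eM trM.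
have hover S := projection_overlap S na nb.
pose S := [set j | 0 < x j].
have rowa (B : 'M[C]_d) : sqnorm (maskmx S (Z ^t* *m B)) = \sum_(j in S) udiag Z (B *m B ^t*) j.
  rewrite sqnorm_mask; apply: eq_bigr => j _; rewrite /udiag.
  have -> : Z ^t* *m (B *m B ^t*) *m Z = (Z ^t* *m B) *m (Z ^t* *m B) ^t*.
    by rewrite adjmxM trmxCK !mulmxA.
  by rewrite mxE Re_sum; apply: eq_bigr => k _; rewrite adjmxE mul_conjC_sqmod.
have xsum0 : \sum_j x j = 0.
  have := sum_udiag X hZ; rewrite [in X in X = _]eX; under eq_bigr do rewrite udiag_self //.
  move=> ->; rewrite eX0 raddfB /= mxtraceZ hrho.2.
  have -> : \tr (M *m rho *m M ^t*) = p%:C by rewrite -hp -mulmxA mxtrace_mulC -mulmxA.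
  by rewrite -rmorphM /= mulVf ?gt_eqF // subrr.
have hpos : 2^-1 * \sum_j `|x j| = \sum_(j in S) x j.
  rewrite (bigID (mem S)) /= (eq_bigr x) => [|j]; last first.
    by rewrite inE => /ltW h; rewrite ger0_norm.
  rewrite [X in _ + X](eq_bigr (fun j => - x j)) => [|j]; last first.
    by rewrite inE -leNgt => h; rewrite ler0_norm.
  rewrite sumrN; move: xsum0; rewrite (bigID (mem S)) /=.
  set u := \sum_(j in S) _; set v := \sum_(j | _) _.
  by clearbody u v; clear; lra.
rewrite hpos.
have -> : \sum_(j in S) x j = sqnorm (maskmx S a) - sqnorm (maskmx S b).
  have -> : b = Z ^t* *m (s%:C *: (M *m A)) by rewrite /b -scalemxAr.
  rewrite !rowa -sumrB; apply: eq_bigr => j _.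
  by rewrite scaled_factor s2 -eA -udiagB -eX0 eX udiag_self.
have := hover S; rewrite hab exprMn s2 => h.
have h2 : (sqnorm (maskmx S a) - sqnorm (maskmx S b)) ^+ 2 <= alpha ^+ 2.
  apply: le_trans h _; rewrite lerBlDl -lerBlDr mulrC ler_pdivlMr //.
rewrite (le_trans (ler_norm _)) // -sqrtr_sqr -(ger0_norm al0) -(sqrtr_sqr alpha).
exact: ler_wsqrtr.
Qed.

End Gentle.

(** * Product measurements *)

Section Tensor.
Local Open Scope sesquilinear_scope.
Local Open Scope complex_scope.
Local Notation conjC := Num.Def.conjC.
Context {R : realType}.
Local Notation C := R[i].
Local Notation Re := (@complex.Re R).

(** Over a finite index type the partial sums are eventually the total sum. *)
Lemma sums_to_fin d (Omega : finType) (F : Omega -> 'M[C]_d) S :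
  \sum_w F w = S -> sums_to F S.
Proof.
move=> hS eta eta0; exists [fset w in enum Omega]%fset => B hB.
have -> : \sum_(w <- B) F w = S.
  rewrite -hS (perm_big (enum Omega)) ?big_enum //=.
  apply: uniq_perm; rewrite ?fset_uniq ?enum_uniq // => w.
  by rewrite mem_enum; apply: (fsubsetP hB); rewrite !inE mem_enum.
by rewrite subrr /frob_norm mulmx0 mxtrace0 /= sqrtr0.
Qed.

Context (n d : nat).
Local Notation T := {ffun 'I_n -> 'I_d}.

Lemma tensor_mul (A B : 'I_n -> 'M[C]_d) :
  tensor A *m tensor B = tensor (fun i => A i *m B i).
Proof.
apply/matrixP => x y; rewrite !mxE.
under [RHS]eq_bigr do rewrite mxE.
rewrite bigA_distr_bigA /= (reindex _ (onW_bij _ (@enum_val_bij T))).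
by apply: eq_bigr => z _; rewrite !mxE -big_split.
Qed.

Lemma tensor_adj (A : 'I_n -> 'M[C]_d) :
  (tensor A) ^t* = tensor (fun i => (A i) ^t*).
Proof.
apply/matrixP => x y; rewrite !mxE rmorph_prod.
by apply: eq_bigr => i _; rewrite !mxE.
Qed.

Lemma tensor_tr (A : 'I_n -> 'M[C]_d) : \tr (tensor A) = \prod_i \tr (A i).
Proof.
rewrite bigA_distr_bigA /= /mxtrace (reindex _ (onW_bij _ (@enum_val_bij T))).
by apply: eq_bigr => z _; rewrite !mxE.
Qed.

Lemma tensor1 : tensor (fun=> 1%:M) = 1%:M :> 'M[C]_#|{: T}|.
Proof.
apply/matrixP => x y; rewrite !mxE.
have [->|hxy] := eqVneq x y.
  by rewrite big1 // => i _; rewrite mxE eqxx.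
have [i hi] : exists i, (enum_val x : T) i != (enum_val y : T) i.
  apply/existsP; rewrite -negb_forall; apply: contra hxy => /forallP h.
  by apply/eqP/enum_val_inj/ffunP => i; apply/eqP.
by rewrite (bigD1 i) //= mxE (negPf hi) mul0r.
Qed.

Lemma tensor_sum (Omega : finType) (F : 'I_n -> Omega -> 'M[C]_d) :
  \sum_(w : {ffun 'I_n -> Omega}) tensor (fun i => F i (w i)) =
  tensor (fun i => \sum_v F i v).
Proof.
apply/matrixP => x y; rewrite summxE mxE.
under [RHS]eq_bigr do rewrite summxE.
by rewrite bigA_distr_bigA /=; apply: eq_bigr => w _; rewrite mxE.
Qed.

Lemma measurement_tensor (Omega : finType) (M : 'I_n -> Omega -> 'M[C]_d) :
  (forall i, \sum_v (M i v) ^t* *m M i v = 1%:M) ->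
  measurement (fun w : {ffun 'I_n -> Omega} => tensor (fun i => M i (w i))).
Proof.
move=> h; apply: sums_to_fin.
under eq_bigr do rewrite tensor_adj tensor_mul.
rewrite (tensor_sum (fun i v => (M i v) ^t* *m M i v)) -tensor1.
by congr tensor; apply/funext => i.
Qed.

Lemma outcome_prob_tensor (Omega : finType) (M : Omega -> 'M[C]_d) rho (p : Omega -> R) :
  (forall v, \tr (rho *m ((M v) ^t* *m M v)) = (p v)%:C) ->
  forall w : {ffun 'I_n -> Omega},
  outcome_prob (fun w : {ffun 'I_n -> Omega} => tensor (fun i => M (w i)))
    (tensor (fun=> rho)) w = \prod_i p (w i).
Proof.
move=> h w; rewrite /outcome_prob tensor_adj !tensor_mul tensor_tr.
by rewrite (eq_bigr (fun i => (p (w i))%:C)) // -rmorph_prod.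
Qed.

End Tensor.

(** * The measurement in mutually unbiased bases *)

Section POVM.
Local Open Scope sesquilinear_scope.
Local Open Scope complex_scope.
Local Notation conjC := Num.Def.conjC.
Context {R : realType}.
Local Notation C := R[i].
Local Notation Re := (@complex.Re R).

Definition basis_mx d (v : 'I_d -> 'cV[C]_d) : 'M[C]_d := \matrix_(i, k) v k i 0.

Lemma col_basis_mx d (v : 'I_d -> 'cV[C]_d) k : col k (basis_mx v) = v k.
Proof. by apply/matrixP => i j; rewrite ord1 !mxE. Qed.

Lemma basis_mx_unitary d (v : 'I_d -> 'cV[C]_d) :
  (forall k l, ((v k) ^t* *m v l) 0 0 = (k == l)%:R) -> basis_mx v \is unitarymx.
Proof.
move=> h; rewrite -trmxC_unitary; apply/unitarymxP; rewrite trmxCK.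
apply/matrixP => k l; rewrite [RHS]mxE -h !mxE.
by apply: eq_bigr => i _; rewrite !mxE.
Qed.

Lemma sum_ketbra d (v : 'I_d -> 'cV[C]_d) (a : 'I_d -> R) :
  \sum_k (a k)%:C *: ketbra (v k) = basis_mx v *m rdiag a *m (basis_mx v) ^t*.
Proof.
apply/matrixP => i j; rewrite summxE mxE; apply: eq_bigr => k _.
rewrite mul_mx_diag !mxE big_ord1 !mxE; ring.
Qed.

Context (d : nat) (alpha : R) (e : 'I_d.+1 -> 'I_d -> 'cV[C]_d).
Context (halpha : 0 < alpha < 1).
Context (hmub : complete_MUB e).
Let delta := 4 * arctanh alpha.
Local Notation W := {ffun 'I_d -> bool}.
Local Notation B b := (basis_mx (e b)).

Lemma basis_unitary b : B b \is unitarymx.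
Proof. by apply: basis_mx_unitary => k l; exact: (hmub.1 b k l). Qed.

(** The choice of [delta]: delta / 4 is the inverse hyperbolic tangent of [alpha]. *)
Lemma expR_half_delta : expR (delta / 2) = (1 + alpha) / (1 - alpha).
Proof.
have /andP[a0 a1] := halpha.
have -> : delta / 2 = ln ((1 + alpha) / (1 - alpha)).
  by rewrite /delta /arctanh; field.
by rewrite lnK // posrE divr_gt0 //; lra.
Qed.

Lemma expR_half_delta_frac : expR (delta / 2) / (expR (delta / 2) + 1) = (1 + alpha) / 2.
Proof.
have /andP[a0 a1] := halpha; rewrite expR_half_delta.
by field; rewrite !gt_eqF //; lra.
Qed.

Lemma expR_half_delta_inv : (expR (delta / 2) + 1)^-1 = (1 - alpha) / 2.
Proof.
have /andP[a0 a1] := halpha; rewrite expR_half_delta.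
by field; rewrite !gt_eqF //; lra.
Qed.

(** Randomized response: the recorded bit [x] agrees with the true bit [y] with
    probability (1 + alpha) / 2. *)
Definition bit_prob (x y : bool) : R := if x == y then (1 + alpha) / 2 else (1 - alpha) / 2.

(** The probability of recording the basis [b] and the bits [w] when the state is
    the [k]-th vector of that basis: each bit of the [k]-th unit vector is sent through
    [bit_prob] independently. *)
Definition effect_eig (w : W) (k : 'I_d) : R :=
  d.+1%:R^-1 * \prod_j bit_prob (w j) (j == k).

(** Both sides are products over the bits of [w]: a correct bit contributes
    h / (h + 1) and a wrong one h / (h + 1) * h^-1, with h = exp (delta / 2). *)
Lemma effect_eigE w k : effect_eig w k =
  d.+1%:R^-1 * (expR (delta / 2) / (expR (delta / 2) + 1)) ^+ d *
    expR (- (delta / 2) * l1_dist_basis w k).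
Proof.
have /andP[a0 a1] := halpha.
rewrite /effect_eig -mulrA; congr (_ * _); rewrite /l1_dist_basis mulr_sumr expR_sum.
rewrite -[in X in _ ^+ X](card_ord d) -prodr_const -big_split.
apply: eq_bigr => j _ /=; rewrite expR_half_delta_frac /bit_prob.
case: (w j); case: (j == k) => /=; rewrite ?subrr ?normr0 ?mulr0 ?expR0 ?mulr1 //.
- rewrite subr0 normr1 mulr1 expRN expR_half_delta; field.
  by rewrite !gt_eqF //; lra.
- rewrite sub0r normrN normr1 mulr1 expRN expR_half_delta; field.
  by rewrite !gt_eqF //; lra.
Qed.

Lemma E_deltaE wb : E_delta e delta wb = B wb.2 *m rdiag (effect_eig wb.1) *m (B wb.2) ^t*.
Proof.
rewrite -sum_ketbra /E_delta scaler_sumr; apply: eq_bigr => k _.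
by rewrite scalerA -rmorphM /= effect_eigE.
Qed.

Lemma bit_prob_gt0 x y : 0 < bit_prob x y.
Proof.
have /andP[a0 a1] := halpha; rewrite /bit_prob.
by case: (x == y); rewrite divr_gt0 //; lra.
Qed.

Lemma effect_eig_gt0 w k : 0 < effect_eig w k.
Proof. by rewrite mulr_gt0 // ?invr_gt0 ?ltr0n // prodr_gt0 // => j _; apply: bit_prob_gt0. Qed.

Lemma M_deltaE wb :
  M_delta e delta wb = B wb.2 *m rdiag (fun k => Num.sqrt (effect_eig wb.1 k)) *m (B wb.2) ^t*.
Proof.
rewrite /M_delta E_deltaE sqrtmx_spectral ?basis_unitary // => k.
exact/ltW/effect_eig_gt0.
Qed.

Lemma M_delta_sqr wb : (M_delta e delta wb) ^t* *m M_delta e delta wb = E_delta e delta wb.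
Proof.
rewrite M_deltaE spectral_herm spectral_sqr ?basis_unitary // E_deltaE.
rewrite (@eq_rdiag _ _ _ (effect_eig wb.1)) // => k.
by rewrite sqr_sqrtr // ltW // effect_eig_gt0.
Qed.

Lemma sum_bit_prob y : \sum_x bit_prob x y = 1.
Proof. by rewrite big_bool /bit_prob; case: y => /=; field. Qed.

Lemma sum_effect_eig k : \sum_w effect_eig w k = d.+1%:R^-1.
Proof.
rewrite -mulr_sumr -[RHS]mulr1; congr (_ * _).
rewrite -(bigA_distr_bigA (fun j x => bit_prob x (j == k))).
by rewrite big1 // => j _; rewrite sum_bit_prob.
Qed.

Lemma sum_E_delta : \sum_wb E_delta e delta wb = 1%:M.
Proof.
rewrite -(pair_bigA _ (fun w b => E_delta e delta (w, b))) exchange_big /=.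
rewrite (eq_bigr (fun=> (d.+1%:R^-1)%:C *: 1%:M)) => [|b _].
  rewrite sumr_const card_ord -scaler_nat scalerA -(rmorph_nat (real_complex R)) -rmorphM /=.
  by rewrite divff ?scale1r // pnatr_eq0.
under eq_bigr do rewrite E_deltaE -sum_ketbra /=.
rewrite exchange_big /= (eq_bigr (fun k => (d.+1%:R^-1)%:C *: ketbra (e b k))) => [|k _];
  last first.
  by rewrite -scaler_suml -rmorph_sum sum_effect_eig.
rewrite sum_ketbra.
have -> : rdiag (fun=> d.+1%:R^-1) = (d.+1%:R^-1)%:C%:M :> 'M[C]_d.
  by apply/matrixP => i j; rewrite !mxE.
by rewrite mul_mx_scalar -scalemxAl (unitary_mulVA (basis_unitary b)).
Qed.

Lemma measurement_M_delta_n n : measurement (M_delta_n e delta (n := n)).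
Proof.
apply: (measurement_tensor (M := fun _ v => M_delta e delta v)) => i.
by under eq_bigr do rewrite M_delta_sqr; exact: sum_E_delta.
Qed.

Lemma measurement_M_delta : measurement (M_delta e delta).
Proof.
by apply: sums_to_fin; under eq_bigr do rewrite M_delta_sqr; exact: sum_E_delta.
Qed.

(** The law of one outcome: choose a basis uniformly, measure in it, and record
    the result through randomized response. *)
Definition outcome_law rho (wb : W * 'I_d.+1) : R :=
  \sum_k effect_eig wb.1 k * qform rho (e wb.2 k).

Lemma tr_outcome_law rho wb : rho ^t* = rho ->
  \tr (rho *m ((M_delta e delta wb) ^t* *m M_delta e delta wb)) = (outcome_law rho wb)%:C.
Proof.
move=> hrho; rewrite M_delta_sqr E_deltaE.
have -> : outcome_law rho wb = rdot rho (B wb.2 *m rdiag (effect_eig wb.1) *m (B wb.2) ^t*).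
  rewrite rdot_spectral //; apply: eq_bigr => k _.
  by rewrite udiag_qform col_basis_mx.
rewrite /rdot hrho; apply: real_selfJ; rewrite -mxtrace_adj adjmxM spectral_herm hrho.
exact: mxtrace_mulC.
Qed.

Lemma outcome_probE n rho w : rho ^t* = rho ->
  outcome_prob (M_delta_n e delta (n := n)) (tensor (fun=> rho)) w =
  \prod_i outcome_law rho (w i).
Proof. by move=> hrho; apply: outcome_prob_tensor => v; apply: tr_outcome_law. Qed.

(** With [N] the number of ones in [w], the distance from [w] to a unit vector is
    [N - 1] or [N + 1], so the eigenvalues of the square root lie between two numbers of
    ratio exp (delta / 2). *)
Lemma gentle_M_delta : gentle alpha (@state R d) (M_delta e delta).
Proof.
have /andP[a0 a1] := halpha.
move=> rho wb hrho; rewrite /outcome_prob /post_state (tr_outcome_law _ (state_herm hrho)) => hp.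
pose K : R := d.+1%:R^-1 * (expR (delta / 2) / (expR (delta / 2) + 1)) ^+ d.
have K0 : 0 < K.
  rewrite mulr_gt0 ?invr_gt0 ?ltr0n // exprn_gt0 // divr_gt0 ?addr_gt0 ?expR_gt0 //.
pose N : R := \sum_j (wb.1 j)%:R.
pose h := expR (delta / 2).
have hE : h = (1 + alpha) / (1 - alpha) := expR_half_delta.
have h0 : 0 < h := expR_gt0 _.
pose lo := Num.sqrt (K * expR (- (delta / 2) * (N + 1))).
pose hi := Num.sqrt (K * expR (- (delta / 2) * (N - 1))).
have dhalf_gt0 : 0 < delta / 2.
  by rewrite -expR_gt1 -/h hE ltr_pdivlMr; lra.
have ehi : hi = h * lo.
  rewrite /hi /lo -[h in RHS]ger0_norm ?ltW // -sqrtr_sqr -sqrtrM ?sqr_ge0 //.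
  congr Num.sqrt; rewrite mulrCA; congr (_ * _).
  by rewrite /h expr2 -!expRD; congr expR; field.
have lo0 : 0 < lo by rewrite sqrtr_gt0 mulr_gt0 ?expR_gt0.
have hl1 k : N - 1 <= l1_dist_basis wb.1 k <= N + 1.
  rewrite /l1_dist_basis /N.
  have -> : \sum_(j < d) `|(wb.1 j)%:R - (j == k)%:R| =
     \sum_(j < d) ((wb.1 j)%:R + (j == k)%:R * (1 - 2 * (wb.1 j)%:R)) :> R.
    apply: eq_bigr => j _; case: (wb.1 j); case: (j == k) => /=.
    - by rewrite subrr normr0; ring.
    - by rewrite subr0 normr1; ring.
    - by rewrite sub0r normrN normr1; ring.
    - by rewrite subrr normr0; ring.
  have e1 : \sum_(j < d) (j == k)%:R * (1 - 2 * (wb.1 j)%:R) = 1 - 2 * (wb.1 k)%:R :> R.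
    rewrite (bigD1 k) //= eqxx mul1r big1 ?addr0 // => j /negPf ->.
    by rewrite mul0r.
  rewrite big_split /= e1.
  by case: (wb.1 k) => /=; apply/andP; split; rewrite lerD2l; lra.
rewrite -fmorphV.
apply: (@gentle_spectral _ _ (B wb.2) _ _ (fun k => Num.sqrt (effect_eig wb.1 k)) lo hi) => //.
- exact: basis_unitary.
- exact: ltW.
- move=> k; have /andP[h1 h2] := hl1 k; rewrite effect_eigE -/K.
  apply/andP; split; apply: ler_wsqrtr; rewrite ler_pM2l // ler_expR ler_nM2l // oppr_lt0 //.
- rewrite ehi hE.
  rewrite (_ : _ - lo = (2 * alpha) * (lo / (1 - alpha))); last by field; rewrite gt_eqF //; lra.
  by rewrite (_ : _ + lo = 2 * (lo / (1 - alpha))) ?mulrA 1?[alpha * 2]mulrC //; field;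
    rewrite gt_eqF //; lra.
- by rewrite ehi -[X in X <= _]mul1r ler_pM2r // hE ler_pdivlMr; lra.
- exact: M_deltaE.
- by rewrite (tr_outcome_law _ (state_herm hrho)).
Qed.

End POVM.

(** * Mutually unbiased bases are a 2-design *)

Section Design.
Local Open Scope sesquilinear_scope.
Local Open Scope complex_scope.
Local Notation conjC := Num.Def.conjC.
Context {R : realType}.
Local Notation C := R[i].
Local Notation Re := (@complex.Re R).
Context (d : nat) (e : 'I_d.+1 -> 'I_d -> 'cV[C]_d).
Context (hmub : complete_MUB e).

Lemma sum_basis b : \sum_k ketbra (e b k) = 1%:M.
Proof.
have := sum_ketbra (e b) (fun=> 1); under eq_bigr do rewrite scale1r.
move=> ->; have -> : rdiag (fun=> 1) = 1%:M :> 'M[C]_d.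
  by apply/matrixP => i j; rewrite !mxE.
by rewrite mulmx1 (unitary_mulVA (basis_unitary hmub b)).
Qed.

Lemma mxvec_adj_dot (X Y : 'M[C]_d) : mxvec X *m (mxvec Y) ^t* = (\tr (X *m Y ^t*))%:M.
Proof.
apply/matrixP => i j; rewrite !ord1 [RHS]mxE mulr1n mxE.
have -> : \tr (X *m Y ^t*) = \sum_i \sum_j X i j * conjC (Y i j).
  by apply: eq_bigr => k _; rewrite mxE; apply: eq_bigr => l _; rewrite adjmxE.
rewrite (reindex _ (curry_mxvec_bij _ _)) pair_bigA /=.
by apply: eq_bigr => -[k l] _ /=; rewrite adjmxE !mxvecE.
Qed.

Lemma ketbra_adj (v : 'cV[C]_d) : (ketbra v) ^t* = ketbra v.
Proof. by rewrite /ketbra adjmxM trmxCK. Qed.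

Lemma tr_ketbra2 (u v : 'cV[C]_d) :
  \tr (ketbra u *m ketbra v) = `| ((u ^t* *m v) 0 0) | ^+ 2.
Proof.
rewrite /ketbra -sqmod_norm -mul_conjC_sqmod mulmxA mxtrace_mulC !mulmxA.
rewrite /mxtrace big_ord1 -mulmxA mxE big_ord1 mulrC; congr (_ * _).
by rewrite -adjmxE adjmxM trmxCK.
Qed.

Lemma tr_ketbra_MUB b k b' k' :
  \tr (ketbra (e b k) *m ketbra (e b' k')) =
  if b == b' then (k == k')%:R else d%:R^-1.
Proof.
rewrite tr_ketbra2; case: (eqVneq b b') => [->|hb]; last exact: (hmub.2 b b' k k').
rewrite (hmub.1 b' k k').
by case: (k == k'); rewrite ?normr1 ?normr0 ?expr1n ?expr0n.
Qed.

(** Let [Q] be the operator X |-> sum_bk tr (X P_bk) P_bk - tr (X) 1, as a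
    matrix of size d^2. Unbiasedness says that [Q] fixes every P_bk and the identity, whose
    span contains its range. So [Q] is an orthogonal projection, of trace
    (d + 1) d - d = d^2, and a projection whose rank is the full dimension is the identity. *)
Lemma MUB_design (X : 'M[C]_d) : (0 < d)%N ->
  \sum_b \sum_k \tr (X *m ketbra (e b k)) *: ketbra (e b k) = X + (\tr X)%:M.
Proof.
move=> d0; pose p b k := mxvec (ketbra (e b k)).
pose v := mxvec (1%:M : 'M[C]_d).
pose Q := \sum_b \sum_k (p b k) ^t* *m p b k - v ^t* *m v.
have rdiag0 : d%:R != 0 :> C by rewrite pnatr_eq0 -lt0n.
have vE b : \sum_k p b k = v by rewrite -linear_sum /= sum_basis.
have XQ (Y : 'M[C]_d) : mxvec Y *m Q =
    mxvec (\sum_b \sum_k \tr (Y *m ketbra (e b k)) *: ketbra (e b k) - (\tr Y)%:M).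
  rewrite mulmxBr mulmx_sumr linearB linear_sum /=; congr (_ - _).
    apply: eq_bigr => b _; rewrite mulmx_sumr linear_sum; apply: eq_bigr => k _.
    by rewrite mulmxA mxvec_adj_dot mul_scalar_mx linearZ /= ketbra_adj.
  rewrite mulmxA mxvec_adj_dot mul_scalar_mx -linearZ /= scalemx1.
  by congr (mxvec (_%:M)); rewrite trmx1 map_mx1 mulmx1.
have pQ b k : p b k *m Q = p b k.
  rewrite XQ; congr mxvec.
  rewrite (bigD1 b) //= (eq_bigr (fun k' => (k == k')%:R *: ketbra (e b k'))); last first.
    by move=> k' _; rewrite tr_ketbra_MUB eqxx.
  rewrite (bigD1 k) //= eqxx scale1r big1 ?addr0 => [|k' /negPf hk]; last first.
    by rewrite eq_sym hk scale0r.
  rewrite (eq_bigr (fun=> d%:R^-1 *: 1%:M)) => [|b' /negPf hb]; last first.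
    rewrite -(sum_basis b') scaler_sumr; apply: eq_bigr => k' _.
    by rewrite tr_ketbra_MUB eq_sym hb.
  rewrite sumr_const cardC1 card_ord -scaler_nat scalerA divff // scale1r.
  have -> : \tr (ketbra (e b k)) = 1.
    by rewrite /ketbra mxtrace_mulC /mxtrace big_ord1 (hmub.1 b k k) eqxx.
  by rewrite addrK.
have vQ : v *m Q = v.
  by rewrite -(vE ord0) mulmx_suml; apply: eq_bigr => k _.
have QQ : Q *m Q = Q.
  rewrite [in X in X *m _]/Q mulmxBl mulmx_suml /Q; congr (_ - _).
    apply: eq_bigr => b _; rewrite mulmx_suml; apply: eq_bigr => k _.
    by rewrite -mulmxA pQ.
  by rewrite -mulmxA vQ.
have Qh : Q ^t* = Q.
  rewrite /Q adjmxB adjmx_sum; congr (_ - _); last by rewrite adjmxM trmxCK.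
  apply: eq_bigr => b _; rewrite adjmx_sum; apply: eq_bigr => k _.
  by rewrite adjmxM trmxCK.
have trQ : \tr Q = (d * d)%:R.
  rewrite /Q raddfB raddf_sum /=.
  have trd (Y : 'M[C]_d) : \tr ((mxvec Y) ^t* *m mxvec Y) = \tr (Y *m Y ^t*).
    by rewrite mxtrace_mulC mxvec_adj_dot mxtrace_scalar mulr1n.
  rewrite trd trmx1 map_mx1 mulmx1 mxtrace1.
  rewrite (eq_bigr (fun=> d%:R)) => [|b _]; last first.
    rewrite raddf_sum /= (eq_bigr (fun=> 1)) ?sumr_const ?card_ord // => k _.
    by rewrite trd ketbra_adj tr_ketbra_MUB !eqxx.
  rewrite sumr_const card_ord -[_ *+ d.+1]mulr_natl natrM -natr1; ring.
have Q1 : Q = 1%:M.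
  apply/eqP; rewrite eq_sym -subr_eq0; apply/eqP; apply: sqnorm_eq0.
  apply: (@complexI R); rewrite -sqnorm_tr adjmxB Qh trmx1 map_mx1.
  rewrite mulmxBl mul1mx mulmxBr mulmx1 QQ subrr subr0 raddfB /= trQ mxtrace1.
  by rewrite subrr.
have := XQ X; rewrite Q1 mulmx1 => /(can_inj mxvecK) {2}->.
by rewrite subrK.
Qed.

Lemma MUB_design_qform (X : 'M[C]_d) u : (0 < d)%N -> X ^t* = X ->
  \sum_b \sum_k qform X (e b k) * qform (ketbra (e b k)) u = qform X u + Re (\tr X) * sqnorm u.
Proof.
move=> d0 hX; have ht : \tr X = (Re (\tr X))%:C.
  by apply: real_selfJ; rewrite -mxtrace_adj hX.
rewrite -qform1 -qformD -ht -MUB_design // qform_sum; apply: eq_bigr => b _.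
rewrite qform_sum; apply: eq_bigr => k _; rewrite -qformZ; congr (qform (_ *: _) _).
rewrite -(rdot_ketbra _ hX) /rdot hX -real_selfJ // -mxtrace_adj adjmxM hX ketbra_adj.
exact: mxtrace_mulC.
Qed.

Lemma qform_ketbra (v u : 'cV[C]_d) : qform (ketbra v) u = sqmod ((v ^t* *m u) 0 0).
Proof.
rewrite /qform /ketbra !mulmxA -mulmxA mxE big_ord1.
have -> : (u ^t* *m v) 0 0 = conjC ((v ^t* *m u) 0 0).
  by rewrite -adjmxE adjmxM trmxCK.
by rewrite conj_mulC_sqmod.
Qed.

Lemma qform_ketbraC (v u : 'cV[C]_d) : qform (ketbra v) u = qform (ketbra u) v.
Proof.
by rewrite !qform_ketbra -sqmodJ -adjmxE adjmxM trmxCK.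
Qed.

Lemma qform_ketbra_ge0 (v u : 'cV[C]_d) : 0 <= qform (ketbra v) u.
Proof. by rewrite qform_ketbra sqmod_ge0. Qed.

Lemma sum_qform_basis b u : \sum_k qform (ketbra (e b k)) u = sqnorm u.
Proof. by rewrite -qform_sum sum_basis -[1%:M]/((1%:C)%:M) qform1 mul1r. Qed.

End Design.

(** * Moments of the estimator in a fixed direction *)

Section Moments.
Local Open Scope sesquilinear_scope.
Local Open Scope complex_scope.
Local Notation conjC := Num.Def.conjC.
Context {R : realType}.
Local Notation C := R[i].
Local Notation Re := (@complex.Re R).
Context (d : nat) (alpha : R) (e : 'I_d.+1 -> 'I_d -> 'cV[C]_d).
Context (halpha : 0 < alpha < 1) (hmub : complete_MUB e) (d2 : (2 <= d)%N).
Local Notation W := {ffun 'I_d -> bool}.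
Local Notation outcome_law := (@outcome_law R d alpha e).

Let beta : R := (1 - alpha) / 2.
Definition bits_prob (k : 'I_d) (w : W) : R := \prod_j bit_prob alpha (w j) (j == k).

(** Independence of the recorded bits. *)
Lemma sum_bits_prob_prod k (h : 'I_d -> bool -> R) :
  \sum_w bits_prob k w * \prod_j h j (w j) = \prod_j \sum_x bit_prob alpha x (j == k) * h j x.
Proof.
rewrite (bigA_distr_bigA (fun j x => bit_prob alpha x (j == k) * h j x)).
by apply: eq_bigr => w _; rewrite -big_split.
Qed.

Lemma sum_bits_prob k : \sum_w bits_prob k w = 1.
Proof.
rewrite -(bigA_distr_bigA (fun j x => bit_prob alpha x (j == k))).
by rewrite big1 // => j _; rewrite sum_bit_prob.
Qed.

Lemma sum_bits_prob1 k l (h : bool -> R) :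
  \sum_w bits_prob k w * h (w l) = \sum_x bit_prob alpha x (l == k) * h x.
Proof.
have := sum_bits_prob_prod k (fun j x => if j == l then h x else 1).
rewrite (eq_bigr (fun w : W => bits_prob k w * h (w l))) => [|w _]; last first.
  congr (_ * _); rewrite (bigD1 l) //= eqxx big1 ?mulr1 // => j /negPf hj.
  by rewrite hj.
move=> ->; rewrite (bigD1 l) //= eqxx [X in _ * X]big1 ?mulr1 // => j /negPf hj.
by rewrite hj; under eq_bigr do rewrite mulr1; rewrite sum_bit_prob.
Qed.

Lemma sum_bits_prob2 k l m (h : bool -> R) : l != m ->
  \sum_w bits_prob k w * (h (w l) * h (w m)) =
  (\sum_x bit_prob alpha x (l == k) * h x) * (\sum_x bit_prob alpha x (m == k) * h x).
Proof.
move=> hlm.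
have := sum_bits_prob_prod k (fun j x => if (j == l) || (j == m) then h x else 1).
have -> : \prod_j (\sum_x bit_prob alpha x (j == k) * (if (j == l) || (j == m) then h x else 1))
   = (\sum_x bit_prob alpha x (l == k) * h x) * (\sum_x bit_prob alpha x (m == k) * h x).
  rewrite (bigD1 l) //= eqxx /= (bigD1 m) //=; last by rewrite eq_sym.
  rewrite eqxx orbT [X in _ * (_ * X)]big1 ?mulr1 // => j /andP[/negPf -> /negPf ->] /=.
  by under eq_bigr do rewrite mulr1; rewrite sum_bit_prob.
move=> <-; apply: eq_bigr => w _; congr (_ * _).
rewrite (bigD1 l) //= eqxx (bigD1 m) /=; last by rewrite eq_sym.
by rewrite eqxx orbT big1 ?mulr1 // => j /andP[/negPf -> /negPf ->].
Qed.

(** The bit minus its mean when the true bit is 0. *)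
Definition centered_bit (x : bool) : R := x%:R - beta.

Lemma centered_bit_mean b : \sum_x bit_prob alpha x b * centered_bit x = alpha * b%:R.
Proof. by rewrite big_bool /centered_bit /beta /bit_prob; case: b => /=; field. Qed.

Lemma centered_bit_square b :
  \sum_x bit_prob alpha x b * centered_bit x ^+ 2 = (1 - alpha ^+ 2) / 4 + alpha ^+ 2 * b%:R.
Proof. by rewrite big_bool /centered_bit /beta /bit_prob; case: b => /=; field. Qed.

Lemma centered_bit_sum_mean k (p : 'I_d -> R) :
  \sum_w bits_prob k w * (\sum_l centered_bit (w l) * p l) = alpha * p k.
Proof.
under eq_bigr do rewrite mulr_sumr; rewrite exchange_big /=.
rewrite (eq_bigr (fun l => alpha * (l == k)%:R * p l)) => [|l _]; last first.
  by rewrite -centered_bit_mean -sum_bits_prob1 mulr_suml; apply: eq_bigr => w _; rewrite mulrA.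
rewrite (bigD1 k) //= eqxx mulr1 big1 ?addr0 // => l /negPf ->.
by rewrite mulr0 mul0r.
Qed.

(** Distinct bits are independent and at most one of them has nonzero mean, so the
    cross terms vanish. *)
Lemma centered_bit_sum_square k (p : 'I_d -> R) :
  \sum_w bits_prob k w * (\sum_l centered_bit (w l) * p l) ^+ 2 =
  (1 - alpha ^+ 2) / 4 * (\sum_l p l ^+ 2) + alpha ^+ 2 * p k ^+ 2.
Proof.
rewrite (eq_bigr (fun w => \sum_l \sum_m p l * p m * (bits_prob k w *
  (centered_bit (w l) * centered_bit (w m))))); last first.
  move=> w _; rewrite expr2 mulr_suml mulr_sumr; apply: eq_bigr => l _.
  by rewrite !mulr_sumr; apply: eq_bigr => m _; ring.
rewrite exchange_big /=; under eq_bigr do rewrite exchange_big /=.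
rewrite (eq_bigr (fun l => p l ^+ 2 * ((1 - alpha ^+ 2) / 4 + alpha ^+ 2 * (l == k)%:R))).
  under eq_bigr do rewrite mulrDr; rewrite big_split /= -mulr_suml mulrC; congr (_ + _).
  rewrite (bigD1 k) //= eqxx mulr1 mulrC big1 ?addr0 // => l /negPf ->.
  by rewrite !mulr0.
move=> l _; rewrite (bigD1 l) //= [X in _ + X]big1 ?addr0 => [|m hm].
  rewrite -mulr_sumr -expr2 -centered_bit_square -(sum_bits_prob1 k l
    (fun x => centered_bit x ^+ 2)).
  by congr (_ * _); apply: eq_bigr => w _; rewrite expr2.
rewrite -mulr_sumr sum_bits_prob2; last by rewrite eq_sym.
rewrite !centered_bit_mean; have [hl|] := eqVneq l k; last by rewrite mulr0 mul0r mulr0.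
by rewrite -hl (negPf hm) !mulr0.
Qed.

Context (rho : 'M[C]_d) (hrho : state rho).
Local Notation q b k := (qform rho (e b k)).

Lemma outcome_law_ge0 wb : 0 <= outcome_law rho wb.
Proof.
apply: sumr_ge0 => k _; rewrite mulr_ge0 ?(psd_qform _ hrho.1) //.
exact/ltW/effect_eig_gt0.
Qed.

Lemma sum_q b : \sum_k q b k = 1.
Proof.
rewrite -(sum_udiag_state (basis_unitary hmub b) hrho); apply: eq_bigr => k _.
by rewrite udiag_qform col_basis_mx.
Qed.

Lemma q_le1 b k : q b k <= 1.
Proof.
rewrite -(sum_q b) (bigD1 k) //= lerDl sumr_ge0 // => l _.
exact: psd_qform hrho.1.
Qed.

(** Conditioning on the basis [b] and on the measured vector [k]. *)
Lemma outcome_law_expect (f : W * 'I_d.+1 -> R) :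
  \sum_wb outcome_law rho wb * f wb =
  d.+1%:R^-1 * \sum_b \sum_k q b k * (\sum_w bits_prob k w * f (w, b)).
Proof.
have -> : \sum_wb outcome_law rho wb * f wb = \sum_w \sum_b outcome_law rho (w, b) * f (w, b).
  by rewrite pair_bigA; apply: eq_bigr => -[].
rewrite exchange_big mulr_sumr /=.
apply: eq_bigr => b _; rewrite mulr_sumr /outcome_law.
under eq_bigr do rewrite mulr_suml; rewrite exchange_big /=; apply: eq_bigr => k _.
rewrite !mulr_sumr; apply: eq_bigr => w _; rewrite /effect_eig -/(bits_prob k w); ring.
Qed.

Lemma d1_neq0 : d.+1%:R != 0 :> R. Proof. by rewrite pnatr_eq0. Qed.

Lemma sum_outcome_law : \sum_wb outcome_law rho wb = 1.
Proof.
have := outcome_law_expect (fun=> 1); under eq_bigr do rewrite mulr1.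
move=> ->; rewrite (eq_bigr (fun=> 1)) => [|b _].
  by rewrite sumr_const card_ord mulVf // d1_neq0.
rewrite -[RHS](sum_q b); apply: eq_bigr => k _.
by rewrite (eq_bigr (bits_prob k)) ?sum_bits_prob ?mulr1 // => w _; rewrite mulr1.
Qed.

Context (u : 'cV[C]_d) (hu : sqnorm u = 1).
Local Notation p b k := (qform (ketbra (e b k)) u).

(** The contribution of one outcome to u^* (rho_bar - rho) u; the bits can be
    centred by the constant [beta] because [p] sums to 1 in every basis. *)
Definition score (wb : W * 'I_d.+1) : R :=
  d.+1%:R / alpha * (\sum_l centered_bit (wb.1 l) * p wb.2 l) - (1 + qform rho u).

Lemma p_sum b : \sum_k p b k = 1.
Proof. by rewrite (sum_qform_basis hmub). Qed.

(** This is the second moment of the 2-design, tested on the pure state along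
    [u]. *)
Lemma p_sq_sum : \sum_b \sum_k p b k ^+ 2 = 2.
Proof.
have := MUB_design_qform hmub u (ltnW d2) (ketbra_adj u).
have -> : qform (ketbra u) u + Re (\tr (ketbra u)) * sqnorm u = 2.
  have -> : \tr (ketbra u) = 1 by rewrite (state_ketbra hu).2.
  by rewrite qform_ketbra sqnorm_col hu sqmod_real /= ; ring.
move=> <-; apply: eq_bigr => b _; apply: eq_bigr => k _.
by rewrite expr2 [in X in X * _]qform_ketbraC.
Qed.

Lemma qp_sum : \sum_b \sum_k q b k * p b k = 1 + qform rho u.
Proof.
rewrite (MUB_design_qform hmub u (ltnW d2) (state_herm hrho)) hu hrho.2 /=; ring.
Qed.

Lemma alpha_neq0 : alpha != 0.
Proof. by case/andP: halpha => a0 _; rewrite gt_eqF. Qed.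

(** Randomized response shrinks the mean by the factor [alpha], and the 2-design
    inverts the average over the bases. *)
Lemma score_mean_aux : \sum_wb outcome_law rho wb * (\sum_l centered_bit (wb.1 l) * p wb.2 l) =
  alpha / d.+1%:R * (1 + qform rho u).
Proof.
rewrite (outcome_law_expect (fun wb => \sum_l centered_bit (wb.1 l) * p wb.2 l)) /= -qp_sum.
rewrite [alpha / _]mulrC -mulrA; congr (_ * _); rewrite mulr_sumr.
apply: eq_bigr => b _; rewrite mulr_sumr; apply: eq_bigr => k _.
by rewrite (centered_bit_sum_mean k (fun l => p b l)) mulrCA.
Qed.

Lemma score_mean : \sum_wb outcome_law rho wb * score wb = 0.
Proof.
rewrite /score; under eq_bigr do rewrite mulrBr mulrCA.
rewrite sumrB -mulr_sumr -mulr_suml sum_outcome_law score_mean_aux.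
by move: (d.+1%:R : R) d1_neq0 => D D0; field; rewrite ?alpha_neq0 ?D0.
Qed.

(** Conditionally on the basis, the second moment is at most a multiple of the sum
    of [p ^+ 2], and over all the bases these sums add up to 2 instead of d + 1. *)
Lemma score_var : \sum_wb outcome_law rho wb * score wb ^+ 2 <= 2 * d.+1%:R / alpha ^+ 2.
Proof.
have /andP[a0 a1] := halpha.
pose Y (wb : W * 'I_d.+1) := \sum_l centered_bit (wb.1 l) * p wb.2 l.
pose s := 1 + qform rho u.
have -> : \sum_wb outcome_law rho wb * score wb ^+ 2 =
   (d.+1%:R / alpha) ^+ 2 * (\sum_wb outcome_law rho wb * Y wb ^+ 2) - s ^+ 2.
  rewrite (eq_bigr (fun wb => (d.+1%:R / alpha) ^+ 2 * (outcome_law rho wb * Y wb ^+ 2)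
     - 2 * s * (d.+1%:R / alpha) * (outcome_law rho wb * Y wb) + s ^+ 2 * outcome_law rho wb)).
    rewrite big_split sumrB /= -!mulr_sumr sum_outcome_law score_mean_aux -/s.
    by move: (d.+1%:R : R) d1_neq0 => D D0; field; rewrite ?alpha_neq0 ?D0.
  by move=> wb _; rewrite /score -/(Y wb) -/s; ring.
have hY : \sum_wb outcome_law rho wb * Y wb ^+ 2 <= 2 / d.+1%:R.
  rewrite (outcome_law_expect (fun wb => Y wb ^+ 2)) mulrC ler_pM2r ?invr_gt0 ?ltr0n //.
  apply: (@le_trans _ _ (\sum_b \sum_k p b k ^+ 2)); last by rewrite p_sq_sum.
  apply: ler_sum => b _.
  under eq_bigr do rewrite (centered_bit_sum_square _ (fun l => p b l)) mulrDr.
  rewrite big_split /= -mulr_suml sum_q mul1r.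
  have : \sum_k q b k * (alpha ^+ 2 * p b k ^+ 2) <= alpha ^+ 2 * \sum_k p b k ^+ 2.
    rewrite mulr_sumr; apply: ler_sum => k _; rewrite ler_piMl ?q_le1 //.
    by rewrite mulr_ge0 ?sqr_ge0.
  have : 0 <= \sum_k p b k ^+ 2 by apply: sumr_ge0 => k _; apply: sqr_ge0.
  have : alpha ^+ 2 <= 1 by rewrite expr_le1 // ltW.
  move: (\sum_k p b k ^+ 2) (\sum_k _) (alpha ^+ 2) => S T a2; clear => *; nra.
have hs : 0 <= s ^+ 2 := sqr_ge0 _.
rewrite lerBlDr (le_trans (ler_wpM2l (sqr_ge0 _) hY)) //.
rewrite (_ : (d.+1%:R / alpha) ^+ 2 * (2 / d.+1%:R) = 2 * d.+1%:R / alpha ^+ 2) ?lerDl //.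
by move: (d.+1%:R : R) d1_neq0 => D D0; field; rewrite ?alpha_neq0 ?D0.
Qed.

(** The form is a Frobenius inner product of two states. *)
Lemma qform_rho_le1 : 0 <= qform rho u <= 1.
Proof.
rewrite (psd_qform u hrho.1) /=.
have -> : qform rho u = rdot rho (ketbra u) by rewrite rdot_ketbra // state_herm.
have h1 := state_sqnorm_le1 hrho; have h2 := state_sqnorm_le1 (state_ketbra hu).
have := le_trans (rdot_CS rho (ketbra u)) (mulr_ile1 (sqnorm_ge0 _) (sqnorm_ge0 _) h1 h2).
move: (rdot _ _) => c hc; rewrite leNgt; apply/negP => c1.
by move: hc; rewrite leNgt exprn_egt1.
Qed.

Lemma score_bound wb : `|score wb| <= 2 * d.+1%:R / alpha.
Proof.
have /andP[a0 a1] := halpha; have /andP[s0 s1] := qform_rho_le1.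
rewrite /score; case: wb => w b /=.
set Y := \sum_l _.
have hY : - beta <= Y <= 1 - beta.
  have e1 c : c = \sum_l c * p b l by rewrite -mulr_sumr p_sum mulr1.
  apply/andP; split; [rewrite [X in X <= _]e1 | rewrite [X in _ <= X]e1];
    apply: ler_sum => l _; rewrite ler_wpM2r ?qform_ketbra_ge0 // /centered_bit;
    by case: (w l) => /=; rewrite /beta; lra.
have hD : 3 <= d.+1%:R / alpha.
  rewrite ler_pdivlMr //; have : 3 <= d.+1%:R :> R by rewrite ler_nat.
  by nra.
have /andP[y1 y2] := hY.
have -> : 2 * d.+1%:R / alpha = 2 * (d.+1%:R / alpha) by rewrite mulrA.
have D0 : 0 <= d.+1%:R / alpha by lra.
have h1 : d.+1%:R / alpha * Y <= d.+1%:R / alpha * 1.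
  by rewrite ler_wpM2l //; move: y2; rewrite /beta; lra.
have h2 : d.+1%:R / alpha * (- (2^-1)) <= d.+1%:R / alpha * Y.
  by rewrite ler_wpM2l //; move: y1; rewrite /beta; lra.
rewrite ler_norml; apply/andP; split; lra.
Qed.

Lemma qform_estimator n (w : {ffun 'I_n -> W * 'I_d.+1}) : (0 < n)%N ->
  qform (rho_bar e alpha (4 * arctanh alpha) w - rho) u = n%:R^-1 * \sum_i score (w i).
Proof.
move=> n0; have hn : n%:R != 0 :> R by rewrite pnatr_eq0 -lt0n.
rewrite qformB /rho_bar qformB qformZ qform1 hu mulr1 (expR_half_delta_inv halpha) -/beta.
have -> : qform (\sum_b \sum_k (H_bar w b k)%:C *: ketbra (e b k)) u =
   n%:R^-1 * \sum_i \sum_k ((w i).1 k)%:R * p (w i).2 k.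
  rewrite qform_sum (eq_bigr (fun b => \sum_k H_bar w b k * p b k)); last first.
    by move=> b _; rewrite qform_sum; apply: eq_bigr => k _; rewrite qformZ.
  rewrite (eq_bigr (fun b => n%:R^-1 * \sum_i \sum_k (((w i).2 == b) && (w i).1 k)%:R * p b k));
    last first.
    move=> b _; rewrite exchange_big mulr_sumr; apply: eq_bigr => k _.
    by rewrite /H_bar -mulrA mulr_suml.
  rewrite -mulr_sumr exchange_big; congr (_ * _); apply: eq_bigr => i _.
  rewrite (bigD1 (w i).2) //= eqxx [X in _ + X]big1 ?addr0 // => b.
  by rewrite eq_sym => /negPf hb; rewrite big1 // => k _; rewrite hb mul0r.
have -> : \sum_i score (w i) = d.+1%:R / alpha * (\sum_i \sum_k ((w i).1 k)%:R * p (w i).2 k)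
   - n%:R * (d.+1%:R / alpha * beta + (1 + qform rho u)).
  have cst (c : R) : n%:R * c = \sum_(i < n) c by rewrite sumr_const card_ord mulr_natl.
  rewrite mulr_sumr cst -sumrB.
  apply: eq_bigr => i _; rewrite /score.
  have -> : \sum_l centered_bit ((w i).1 l) * p (w i).2 l =
      \sum_k ((w i).1 k)%:R * p (w i).2 k - beta.
    rewrite -[X in _ - X]mulr1 -[X in beta * X](p_sum (w i).2) mulr_sumr -sumrB.
    by apply: eq_bigr => l _; rewrite /centered_bit mulrBl.
  by ring.
by field; rewrite hn alpha_neq0.
Qed.

Lemma rho_bar_adj n (w : {ffun 'I_n -> W * 'I_d.+1}) delta :
  (rho_bar e alpha delta w) ^t* = rho_bar e alpha delta w.
Proof.
rewrite /rho_bar adjmxB adjmxZ; congr (_ *: _ - _).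
  rewrite adjmx_sum; apply: eq_bigr => b _; rewrite adjmx_sum; apply: eq_bigr => k _.
  by rewrite adjmxZ ketbra_adj.
apply/matrixP => i j; rewrite adjmxE !mxE rmorphMn /= conjC_real eq_sym //.
Qed.

End Moments.

(** * Exponential moments of sums of independent variables *)

Section Mgf.
Local Open Scope sesquilinear_scope.
Local Open Scope complex_scope.
Local Notation conjC := Num.Def.conjC.
Context {R : realType}.

(** With y = x / 4, exp x <= (1 - y)^-4. The fourth power brings the quadratic
    coefficient from 1, as for (1 - x)^-1, down to 5/8, below the 3/4 that the constant 92
    can afford. *)
Lemma expR_quadratic (x : R) : `|x| <= 1 / 4 -> expR x <= 1 + x + 3 / 4 * x ^+ 2.
Proof.
rewrite ler_norml => /andP[x1 x2]; pose y := x / 4.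
have ey : x = y *+ 4 by rewrite /y -mulr_natr divfK.
have y1 : - (1 / 16) <= y by rewrite /y; lra.
have y2 : y <= 1 / 16 by rewrite /y; lra.
have h1 : 0 < 1 - y by lra.
have h2 : expR y <= (1 - y)^-1.
  rewrite -[expR y]invrK lef_pV2 ?posrE ?invr_gt0 ?expR_gt0 // -expRN.
  exact: expR_ge1Dx.
have h3 : expR x <= (1 - y) ^- 4.
  rewrite ey -mulr_natl expRM_natl -exprVn.
  by rewrite lerXn2r ?nnegrE ?expR_ge0 // invr_ge0 ltW.
apply: le_trans h3 _; rewrite -[(_ ^- 4)]mul1r ler_pdivrMr ?exprn_gt0 //.
have h4 : 0 <= y ^+ 2 * (2 - 28 * y + 57 * y ^+ 2 - 44 * y ^+ 3 + 12 * y ^+ 4).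
  apply: mulr_ge0; first exact: sqr_ge0.
  have q2 : 0 <= y ^+ 2 := sqr_ge0 _.
  have q4 : 0 <= y ^+ 4 by rewrite (exprM y 2 2) sqr_ge0.
  have q3 : y ^+ 3 <= y ^+ 2 by rewrite [y ^+ 3]exprSr ler_piMr //; lra.
  lra.
rewrite -subr_ge0 ey; move: h4; rewrite (_ : y ^+ 2 * _ = (1 + y *+ 4 + 3 / 4 * (y *+ 4) ^+ 2) *
  (1 - y) ^+ 4 - 1) //.
by rewrite -mulr_natl; field.
Qed.

Context (T : finType) (p Z : T -> R) (v : R).
Context (p0 : forall x, 0 <= p x) (p1 : \sum_x p x = 1).
Context (Z0 : \sum_x p x * Z x = 0) (Zv : \sum_x p x * Z x ^+ 2 <= v).

Lemma mgf_single th : (forall x, `|th * Z x| <= 1 / 4) ->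
  \sum_x p x * expR (th * Z x) <= expR (3 / 4 * th ^+ 2 * v).
Proof.
move=> hb; apply: le_trans (expR_ge1Dx _).
apply: (@le_trans _ _ (\sum_x p x * (1 + th * Z x + 3 / 4 * (th * Z x) ^+ 2))).
  by apply: ler_sum => x _; rewrite ler_wpM2l ?p0 // expR_quadratic.
rewrite (eq_bigr (fun x => p x + th * (p x * Z x) + 3 / 4 * th ^+ 2 * (p x * Z x ^+ 2)));
  last first.
  by move=> x _; field.
rewrite !big_split /= -!mulr_sumr p1 Z0 mulr0 addr0 lerD2l ler_wpM2l //.
by rewrite mulr_ge0 ?sqr_ge0.
Qed.

(** Independence turns the exponential moment of the sum into a power. *)
Lemma mgf_product n th : (forall x, `|th * Z x| <= 1 / 4) ->
  \sum_(w : {ffun 'I_n -> T}) (\prod_i p (w i)) * expR (th * \sum_i Z (w i)) <=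
  expR (3 / 4 * th ^+ 2 * v * n%:R).
Proof.
move=> hb; rewrite (eq_bigr (fun w : {ffun 'I_n -> T} => \prod_i (p (w i) * expR (th * Z
  (w i))))); last first.
  by move=> w _; rewrite mulr_sumr expR_sum -big_split.
rewrite -(bigA_distr_bigA (fun _ x => p x * expR (th * Z x))).
rewrite prodr_const card_ord mulrC expRM_natl lerXn2r ?nnegrE ?expR_ge0 ?mgf_single //.
by apply: sumr_ge0 => x _; rewrite mulr_ge0 ?expR_ge0.
Qed.

Lemma sum_product_prob n : \sum_(w : {ffun 'I_n -> T}) \prod_i p (w i) = 1.
Proof. by rewrite -(bigA_distr_bigA (fun _ x => p x)) big1. Qed.

End Mgf.

(** * A grid of directions *)

Section Net.
Local Open Scope sesquilinear_scope.
Local Open Scope complex_scope.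
Local Notation conjC := Num.Def.conjC.
Context {R : realType}.
Local Notation C := R[i].
Context (d : nat) (d2 : (2 <= d)%N).
Local Notation I := {ffun 'I_d -> 'I_(6 * d).+1 * 'I_(6 * d).+1}.

Definition gridpt (a : nat) : R := (a%:R - (3 * d)%:R) / (3 * d)%:R.

Definition grid (g : I) : 'cV[C]_d := \col_j (gridpt (g j).1 +i* gridpt (g j).2)%C.

(** Normalized grid vectors; the zero vector is replaced by a unit vector, so that
    every index gives a direction. *)
Definition net (g : I) : 'cV[C]_d :=
  if grid g == 0 then delta_mx (Ordinal (ltnW d2)) 0
  else ((Num.sqrt (sqnorm (grid g)))^-1)%:C *: grid g.

Lemma sqnorm_net g : sqnorm (net g) = 1.
Proof.
rewrite /net; case: eqVneq => [_|g0].
  rewrite /sqnorm (bigD1 (Ordinal (ltnW d2))) //= big_ord1 mxE !eqxx /=.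
  rewrite big1 => [|i /negPf hi]; first by rewrite /sqmod /=; ring.
  by rewrite big_ord1 mxE hi /sqmod /= expr0n addr0.
by rewrite sqnormZ exprVn sqr_sqrtr ?sqnorm_ge0 // mulVf // gt_eqF // sqnorm_gt0.
Qed.

Lemma qform_grid (D : 'M[C]_d) g : qform D (grid g) = sqnorm (grid g) * qform D (net g).
Proof.
rewrite /net; case: eqVneq => [->|g0].
  rewrite [sqnorm 0](_ : _ = 0) ?mul0r; first by rewrite /qform mulmx0 mxE.
  by rewrite /sqnorm big1 // => i _; rewrite big1 // => j _; rewrite mxE /sqmod /= expr0n addr0.
have N0 := sqnorm_gt0 g0.
have -> : qform D ((Num.sqrt (sqnorm (grid g)))^-1%:C *: grid g) =
   (Num.sqrt (sqnorm (grid g)))^-1 ^+ 2 * qform D (grid g).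
  by rewrite /qform adjmxZ -!scalemxAl -scalemxAr !mxE !ReZ mulrA expr2.
by rewrite exprVn sqr_sqrtr ?ltW // mulVKf // gt_eqF.
Qed.

Lemma sqr_le_itv (b x : R) : 0 <= b -> (x ^+ 2 <= b ^+ 2) = (- b <= x <= b).
Proof. by move=> b0; rewrite -ler_norml -[x ^+ 2]real_normK ?num_real // ler_sqr ?nnegrE. Qed.

(** The grid has mesh 1 / (3 d), and rounding errs by half a mesh at most. *)
Lemma gridpt_cover (x : R) : -1 <= x <= 1 ->
  exists a : 'I_(6 * d).+1, (gridpt a - x) ^+ 2 <= (1 / (6 * d%:R)) ^+ 2.
Proof.
move=> /andP[x1 x2]; have dp : 0 < d%:R :> R by rewrite ltr0n ltnW.
pose t : R := 3 * d%:R * (x + 1) + 1 / 2.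
have t0 : 0 <= t by rewrite addr_ge0 // !mulr_ge0 //; lra.
have /andP[h1 h2] := truncn_itv t0.
have ha : (Num.truncn t < (6 * d).+1)%N.
  rewrite -(ltr_nat R) (le_lt_trans h1) // -addn1 natrD natrM /t; nra.
exists (Ordinal ha) => /=; rewrite /gridpt natrM.
set a : R := (Num.truncn t)%:R in h1 *.
have h3 : t < a + 1 by rewrite natr1.
rewrite (_ : _ - x = (a - (3 * d%:R * (x + 1))) / (3 * d%:R)); last first.
  by field; rewrite gt_eqF.
rewrite sqr_le_itv ?divr_ge0 ?mulr_ge0 //.
rewrite (_ : 1 / (6 * d%:R) = 1 / 2 * (3 * d%:R)^-1); last by field; rewrite gt_eqF.
rewrite -mulNr !ler_pM2r ?invr_gt0 ?mulr_gt0 //.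
by move: h1 h3; rewrite /t => *; apply/andP; split; lra.
Qed.

(** There are 2 d real coordinates, each with an error of at most 1 / (6 d), and
    2 d / (36 d^2) <= 1 / 36 for d >= 2. *)
Lemma grid_cover (v : 'cV[C]_d) : sqnorm v = 1 -> exists g, sqnorm (grid g - v) <= 1 / 36.
Proof.
move=> hv; have dp : 0 < d%:R :> R by rewrite ltr0n ltnW.
have hle j : sqmod (v j 0) <= 1.
  rewrite -hv /sqnorm (bigD1 j) //= big_ord1 lerDl sumr_ge0 // => i _.
  by rewrite big_ord1 sqmod_ge0.
have h1 j : -1 <= complex.Re (v j 0) <= 1.
  rewrite -sqr_le_itv // expr1n; apply: le_trans (hle j).
  by rewrite /sqmod lerDl sqr_ge0.
have h2 j : -1 <= complex.Im (v j 0) <= 1.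
  rewrite -sqr_le_itv // expr1n; apply: le_trans (hle j).
  by rewrite /sqmod lerDr sqr_ge0.
pose a j := xchoose (gridpt_cover (h1 j)); pose b j := xchoose (gridpt_cover (h2 j)).
exists [ffun j => (a j, b j)].
apply: (@le_trans _ _ (\sum_(j < d) 2 * (1 / (6 * d%:R)) ^+ 2)).
  apply: ler_sum => j _; rewrite big_ord1 /grid !mxE ffunE /=.
  have := xchooseP (gridpt_cover (h1 j)); have := xchooseP (gridpt_cover (h2 j)).
  rewrite -/(a j) -/(b j) /sqmod; case: (v j 0) => r m /=; lra.
rewrite sumr_const card_ord -[_ *+ d]mulr_natl.
rewrite (_ : _ * _ = 1 / (18 * d%:R)); last by field; rewrite gt_eqF.
have : 2 <= d%:R :> R by rewrite ler_nat.
by move=> hd; rewrite ler_pdivrMr ?mulr_gt0 //; lra.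
Qed.

(** Let [v] be a unit eigenvector for the eigenvalue of largest modulus [x], and
    [u] a grid vector near [v]. Expanding in the eigenbasis, the form at [u] is at least
    x (|u|^2 - 2 |u - v|^2): the error is quadratic in |u - v|. Since |u - v| <= 1/6
    forces |u|^2 >= 25 |u - v|^2, the loss is a factor 23/25. *)
Lemma net_form_bound (D : 'M[C]_d) s : D ^t* = D ->
  (forall g, `|qform D (net g)| <= s) -> form_bound D (25 / 23 * s).
Proof.
move=> hD hs; have [U [l [hU eD]]] := hermitian_spectral hD.
pose j0 := Ordinal (ltnW d2).
pose j := [arg max_(i > j0) `|l i|]%O.
have hj i : `|l i| <= `|l j|.
  by rewrite /j; case: arg_maxP => // k _ h; apply: h.
set x := `|l j| in hj.
have x0 : 0 <= x by rewrite normr_ge0.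
have hop w : `|qform D w| <= x * sqnorm w.
  have -> : w = U *m (U ^t* *m w) by rewrite mulmxA (unitary_mulVA hU) mul1mx.
  rewrite eD qform_combination // sqnorm_combination // mulr_sumr.
  apply: le_trans (ler_norm_sum _ _ _) _; apply: ler_sum => i _.
  by rewrite normrM (ger0_norm (sqmod_ge0 _)) ler_wpM2r ?sqmod_ge0.
pose v := col j U; have hv : sqnorm v = 1 := sqnorm_unit_col j hU.
have [g hg] := grid_cover hv; set u := grid g in hg.
pose z := U ^t* *m u.
have ez : u = U *m z by rewrite mulmxA (unitary_mulVA hU) mul1mx.
pose m := \sum_(i | i != j) sqmod (z i 0).
have hm : m <= sqnorm (u - v).
  rewrite -(sqnorm_unitaryl _ hU) mulmxBr -/z /sqnorm
    (bigD1 j) //= ler_wpDl ?big_ord1 ?sqmod_ge0 //.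
  apply: ler_sum => i hij; rewrite big_ord1.
  suff -> : (z - U ^t* *m v) i 0 = z i 0 by [].
  rewrite /v colE mulmxA (unitary_mulAV hU) mul1mx !mxE (negPf hij) subr0 //.
have hu : sqnorm u = sqmod (z j 0) + m by rewrite ez sqnorm_combination // (bigD1 j).
have hq : x * (sqnorm u - 2 * m) <= `|qform D u|.
  rewrite [in X in _ <= X]ez eD qform_combination // (bigD1 j) //= hu.
  have h1 : `|\sum_(i | i != j) l i * sqmod (z i 0)| <= x * m.
    apply: le_trans (ler_norm_sum _ _ _) _; rewrite /m mulr_sumr; apply: ler_sum => i _.
    by rewrite normrM (ger0_norm (sqmod_ge0 _)) ler_wpM2r ?sqmod_ge0.
  have h2 : `|l j * sqmod (z j 0)| = x * sqmod (z j 0).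
    by rewrite normrM (ger0_norm (sqmod_ge0 _)).
  have := lerB_normD (l j * sqmod (z j 0)) (\sum_(i | i != j) l i * sqmod (z i 0)).
  rewrite h2; move: (`|_ + _|) h1; move: `|\sum_(i | _) _| (sqmod _) => A B E.
  by clear => *; lra.
have m0 : 0 <= m by apply: sumr_ge0 => i _; apply: sqmod_ge0.
(* |v + 6 (u - v)|^2 >= 0 bounds the cross term with the best weight. *)
have hum : 25 * sqnorm (u - v) <= sqnorm u.
  have e1 := sqnormD v (u - v); rewrite [v + _]addrC subrK hv in e1.
  have h6 : 0 <= sqnorm (v + 6%:R%:C *: (u - v)) := sqnorm_ge0 _.
  rewrite sqnormD rdotZr sqnormZ hv in h6; rewrite e1.
  by move: h6 hg; move: (rdot _ _) (sqnorm (u - v)); clear => *; lra.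
have hqs : `|qform D u| <= sqnorm u * s.
  by rewrite qform_grid normrM (ger0_norm (sqnorm_ge0 _)) ler_wpM2l ?sqnorm_ge0.
have nu0 : 0 < sqnorm u.
  rewrite lt_def sqnorm_ge0 andbT; apply/eqP => n0.
  have : sqnorm (u - v) = 0 by apply/eqP; rewrite eq_le sqnorm_ge0 andbT; move: hum; rewrite n0;
    lra.
  move/sqnorm_eq0/eqP; rewrite subr_eq0 => /eqP euv.
  by move: n0; rewrite euv hv => /eqP; rewrite oner_eq0.
have hx : x <= 25 / 23 * s.
  have h1 : x * (23 / 25 * sqnorm u) <= sqnorm u * s.
    apply: le_trans hqs; apply: le_trans hq; apply: ler_wpM2l => //.
    by move: hum hm; move: (sqnorm u) (sqnorm (u - v)); clear => *; lra.
  by rewrite -(ler_pM2r nu0); move: h1; move: (sqnorm u); clear => *; lra.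
by move=> w; apply: le_trans (hop w) _; rewrite ler_wpM2r ?sqnorm_ge0.
Qed.

(** Each of the 2 d coordinates takes 6 d + 1 <= d^4 values. *)
Lemma net_card : 2 * #|{: I}|%:R <= expR ((8 * d + 1)%:R * ln d%:R) :> R.
Proof.
have dp : (0 < d)%N by apply: ltnW.
rewrite expRM_natl lnK ?posrE ?ltr0n // -natrX -natrM ler_nat.
rewrite card_ffun card_prod !card_ord addn1 expnS; apply: leq_mul => //.
rewrite expnM leq_exp2r // (@leq_trans (d ^ 4 * d ^ 4)) //; last by rewrite -expnD.
suff : ((6 * d).+1 <= d ^ 4)%N by move=> h; apply: leq_mul.
have h8 : (8 <= d ^ 3)%N by rewrite (@leq_exp2r 2 d 3).
by rewrite expnSr; apply: leq_trans (leq_mul h8 (leqnn d)); lia.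
Qed.

End Net.

(** * Uniform control over the grid *)

Section Auxiliary.
Local Open Scope sesquilinear_scope.
Local Open Scope complex_scope.
Local Notation conjC := Num.Def.conjC.
Context {R : realType}.

Lemma le_sum_term (I : finType) (F : I -> R) i :
  (forall j, 0 <= F j) -> F i <= \sum_j F j.
Proof. by move=> h; rewrite (bigD1 i) //= lerDl sumr_ge0. Qed.

Lemma expR_abs_le (th x : R) : expR (th * `|x|) <= expR (th * x) + expR (- th * x).
Proof.
have [h|h] := ger0P x; first by rewrite lerDl expR_ge0.
by rewrite mulrN mulNr lerDr expR_ge0.
Qed.

End Auxiliary.

Section Concentration.
Local Open Scope sesquilinear_scope.
Local Open Scope complex_scope.
Local Notation conjC := Num.Def.conjC.
Context {R : realType}.
Local Notation C := R[i].
Context (d n : nat) (alpha : R) (e : 'I_d.+1 -> 'I_d -> 'cV[C]_d).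
Context (halpha : 0 < alpha < 1) (hmub : complete_MUB e) (d2 : (2 <= d)%N) (n1 : (1 <= n)%N).
Context (rho : 'M[C]_d) (hrho : state rho).
Local Notation W := {ffun 'I_d -> bool}.
Local Notation Om := {ffun 'I_n -> W * 'I_d.+1}.
Local Notation I := {ffun 'I_d -> 'I_(6 * d).+1 * 'I_(6 * d).+1}.
Local Notation outcome_law := (@outcome_law R d alpha e).
Local Notation err w := (rho_bar e alpha (4 * arctanh alpha) w - rho).

Definition sample_prob (w : Om) : R := \prod_i outcome_law rho (w i).

Lemma sample_prob_ge0 (w : Om) : 0 <= sample_prob w.
Proof. by apply: prodr_ge0 => i _; apply: outcome_law_ge0. Qed.

Lemma sum_sample_prob : \sum_w sample_prob w = 1.
Proof. by apply: sum_product_prob; apply: sum_outcome_law. Qed.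

Definition worst_direction (w : Om) : I :=
  [arg max_(g > [ffun=> (ord0, ord0)]) `|qform (err w) (net d2 g)|]%O.

Definition maxerr (w : Om) : R := `|qform (err w) (net d2 (worst_direction w))|.

Lemma maxerr_ge (w : Om) g : `|qform (err w) (net d2 g)| <= maxerr w.
Proof. by rewrite /maxerr /worst_direction; case: arg_maxP => // i _ h; apply: h. Qed.

Lemma err_adj (w : Om) : (err w) ^t* = err w.
Proof. by rewrite adjmxB rho_bar_adj state_herm. Qed.

Lemma err_form_bound (w : Om) : form_bound (err w) (25 / 23 * maxerr w).
Proof. by apply: (net_form_bound (d2 := d2)) => [|g]; [exact: err_adj|exact: maxerr_ge]. Qed.

Lemma mgf_direction g th :
  `|th| * (2 * d.+1%:R / alpha) <= n%:R / 4 ->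
  \sum_(w : Om) sample_prob w * expR (th * qform (err w) (net d2 g)) <=
  expR (3 / 2 * d.+1%:R * th ^+ 2 / (n%:R * alpha ^+ 2)).
Proof.
move=> hth; have nu : sqnorm (net d2 g : 'cV[C]_d) = 1 := sqnorm_net d2 g.
have np : 0 < n%:R :> R by rewrite ltr0n.
have ap : alpha != 0 by case/andP: halpha => a0 _; rewrite gt_eqF.
have := @mgf_product R _ (outcome_law rho) (score alpha e rho (net d2 g)) (2 * d.+1%:R / alpha ^+ 2)
  (outcome_law_ge0 e halpha hrho) (sum_outcome_law alpha hmub hrho)
    (score_mean halpha hmub d2 hrho nu)
  (score_var halpha hmub d2 hrho nu) n (th / n%:R).
have -> : 3 / 4 * (th / n%:R) ^+ 2 * (2 * d.+1%:R / alpha ^+ 2) * n%:R =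
   3 / 2 * d.+1%:R * th ^+ 2 / (n%:R * alpha ^+ 2).
  by move: (d.+1%:R : R) => D; field; rewrite ap gt_eqF.
move=> h; apply: le_trans (h _) => [|x].
  rewrite le_eqVlt; apply/orP; left; apply/eqP; apply: eq_bigr => w _; congr (_ * expR _).
  by rewrite (qform_estimator halpha hmub rho nu) // mulrA.
rewrite normrM normrM normfV (ger0_norm (ltW np)).
have := score_bound halpha hmub d2 hrho nu x => hz.
rewrite mulrAC ler_pdivrMr // (le_trans (ler_wpM2l (normr_ge0 _) hz)) //.
by apply: le_trans hth _; lra.
Qed.

(** The exponential of a maximum is at most the sum of the exponentials, over all
    grid directions and both signs. *)
Lemma maxerr_mgf th : 0 <= th ->
  th * (2 * d.+1%:R / alpha) <= n%:R / 4 ->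
  \sum_(w : Om) sample_prob w * expR (th * maxerr w) <=
  2 * #|{: I}|%:R * expR (3 / 2 * d.+1%:R * th ^+ 2 / (n%:R * alpha ^+ 2)).
Proof.
move=> th0 hth; set E := expR _.
pose q (w : Om) g := qform (err w) (net d2 g).
apply: (@le_trans _ _ (\sum_w \sum_(g : I)
  (sample_prob w * expR (th * q w g) + sample_prob w * expR (- th * q w g)))).
  apply: ler_sum => w _.
  have hF g : 0 <= sample_prob w * expR (th * q w g) + sample_prob w * expR (- th * q w g).
    by rewrite addr_ge0 // mulr_ge0 ?sample_prob_ge0 ?expR_ge0.
  apply: le_trans (le_sum_term (worst_direction w) hF).
  rewrite -mulrDr; apply: ler_wpM2l; first exact: sample_prob_ge0.
  exact: expR_abs_le.
have -> : 2 * #|{: I}|%:R * E = \sum_(g : I) 2 * E.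
  by rewrite sumr_const -(mulr_natr (2 * E)) mulrAC.
rewrite exchange_big /=; apply: ler_sum => g _.
rewrite big_split /= (_ : 2 * E = E + E); last by ring.
apply: lerD; first by apply: mgf_direction; rewrite ger0_norm.
by rewrite /E -(sqrrN th); apply: mgf_direction; rewrite normrN ger0_norm.
Qed.

End Concentration.

(** * Tail and second moment *)

Section Bounds.
Local Open Scope sesquilinear_scope.
Local Open Scope complex_scope.
Local Notation conjC := Num.Def.conjC.
Context {R : realType}.
Local Notation C := R[i].
Context (d n : nat) (alpha eps : R) (e : 'I_d.+1 -> 'I_d -> 'cV[C]_d).
Context (halpha : 0 < alpha < 1) (hmub : complete_MUB e) (d2 : (2 <= d)%N) (n1 : (1 <= n)%N).
Context (heps : 0 < eps <= 1).
Context (rho : 'M[C]_d) (hrho : state rho).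
Local Notation Om := {ffun 'I_n -> {ffun 'I_d -> bool} * 'I_d.+1}.
Local Notation X := (@maxerr R d n alpha e d2 rho).
Local Notation sample_prob := (@sample_prob R d n alpha e rho).
Local Notation L := (ln (d%:R / eps) : R).

Lemma ln_two_ge : 1 / 2 <= ln 2 :> R.
Proof.
rewrite -[X in X <= _]expRK ler_ln ?posrE ?expR_gt0 //.
rewrite -[expR _]invrK -expRN invf_ple ?posrE ?expR_gt0 //.
by apply: le_trans (expR_ge1Dx _); lra.
Qed.

Lemma log_ratio_split : L = ln d%:R - ln eps.
Proof.
by case/andP: heps => h0 _; rewrite ln_div ?posrE ?ltr0n // ltnW.
Qed.

Lemma ln_eps_le0 : ln eps <= 0.
Proof. by case/andP: heps => h0 h1; apply: ln_le0. Qed.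

Lemma ln_d_ge : 1 / 2 <= ln d%:R :> R.
Proof.
apply: le_trans ln_two_ge _.
by rewrite ler_ln ?posrE ?ltr0n ?(ltnW d2) // ler_nat.
Qed.

Lemma log_ratio_ge : 1 / 2 <= L.
Proof. by rewrite log_ratio_split; have := ln_eps_le0; have := ln_d_ge; lra. Qed.

Lemma mgf_total th : 0 <= th -> th * (2 * d.+1%:R / alpha) <= n%:R / 4 ->
  \sum_(w : Om) sample_prob w * expR (th * X w) <=
  expR ((8 * d + 1)%:R * ln d%:R + 3 / 2 * d.+1%:R * th ^+ 2 / (n%:R * alpha ^+ 2)).
Proof.
move=> h0 h1; apply: le_trans (maxerr_mgf halpha hmub d2 n1 hrho h0 h1) _.
by rewrite expRD ler_wpM2r ?expR_ge0 // (net_card d2).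
Qed.

(** Markov's inequality for the exponential of the largest error. *)
Lemma tail_bound th s a : 0 <= th ->
  \sum_(w : Om) sample_prob w * expR (th * X w) <= expR a ->
  1 - expR (a - th * s) <= \sum_(w : Om | X w <= s) sample_prob w.
Proof.
move=> h0 h1.
have hs : \sum_(w : Om | X w <= s) sample_prob w + \sum_(w : Om | ~~ (X w <= s)) sample_prob w = 1.
  by rewrite -(sum_sample_prob n alpha hmub hrho) [RHS](bigID (fun w => X w <= s)).
have h2 : \sum_(w : Om | ~~ (X w <= s)) sample_prob w <= expR (a - th * s).
  apply: (@le_trans _ _ (expR (- (th * s)) * \sum_(w : Om) sample_prob w * expR (th * X w)));
    last first.
    by rewrite addrC expRD ler_wpM2l ?expR_ge0.
  rewrite mulr_sumr big_mkcond; apply: ler_sum => w _.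
  have p0 := sample_prob_ge0 e halpha hrho w.
  rewrite mulrCA -expRD; case: ifP => [|_]; last by rewrite mulr_ge0 ?expR_ge0.
  rewrite -ltNge => hw; rewrite ler_peMr // -expR0 ler_expR addrC subr_ge0.
  by rewrite ler_wpM2l // ltW.
by move: hs h2; move: (\sum_(w : Om | X w <= s) _) (\sum_(w : Om | ~~ _) _); move=> *; lra.
Qed.

Let nr : R := n%:R.
Let dr : R := d%:R.
Let t : R := Num.sqrt (92 * L * (dr ^+ 2 / (nr * alpha ^+ 2))).

Lemma natr_n_gt0 : 0 < nr. Proof. by rewrite ltr0n. Qed.
Lemma natr_d_ge2 : 2 <= dr. Proof. by rewrite ler_nat. Qed.
Lemma natr_dS : d.+1%:R = dr + 1 :> R. Proof. by rewrite -natr1. Qed.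
Lemma natr_net_exponent : (8 * d + 1)%:R = 8 * dr + 1 :> R. Proof. by rewrite natrD natrM. Qed.

Lemma threshold_sqr : t ^+ 2 * (nr * alpha ^+ 2) = 92 * L * dr ^+ 2.
Proof.
have /andP[a0 a1] := halpha; have np := natr_n_gt0; have := log_ratio_ge.
move=> hL; rewrite sqr_sqrtr; last first.
  apply: mulr_ge0; first by rewrite mulr_ge0 //; lra.
  by rewrite divr_ge0 ?sqr_ge0 // mulr_ge0 ?sqr_ge0 // ltW.
by move: (L) => l; field; rewrite !gt_eqF.
Qed.

Lemma threshold_gt0 : 0 < t.
Proof.
have /andP[a0 a1] := halpha; have np := natr_n_gt0; have hL := log_ratio_ge; have hd := natr_d_ge2.
rewrite sqrtr_gt0; apply: mulr_gt0; first by rewrite mulr_gt0 //; lra.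
have dp : 0 < dr by lra.
by rewrite divr_gt0 ?mulr_gt0 ?exprn_gt0.
Qed.

(** Here [th] minimizes the exponent, with value - n alpha^2 s^2 / (6 (d + 1)). By
    the definition of [t] this is a multiple of L d^2 / (d + 1), and the constant 92 makes
    it exceed the entropy (8 d + 1) log d of the grid by log (1 / eps). The margin is
    smallest at d = 2. *)
Lemma tail_exponent s th : s = 23 / 25 * t ->
  th = nr * alpha ^+ 2 * s / (3 * (dr + 1)) ->
  (8 * dr + 1) * ln dr + 3 / 2 * (dr + 1) * th ^+ 2 / (nr * alpha ^+ 2) - th * s <= ln eps.
Proof.
have /andP[a0 a1] := halpha; have np := natr_n_gt0; have hd := natr_d_ge2.
move=> es eth; have ht := threshold_sqr.
have ap : 0 < alpha ^+ 2 by rewrite exprn_gt0.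
have e1 : 3 / 2 * (dr + 1) * th ^+ 2 / (nr * alpha ^+ 2) - th * s =
   - (529 / 625 * (t ^+ 2 * (nr * alpha ^+ 2)) / (6 * (dr + 1))).
  by rewrite eth es; field; rewrite !gt_eqF //; lra.
rewrite -addrA e1 ht log_ratio_split -/dr.
have hl := ln_d_ge; rewrite -/dr in hl; have he := ln_eps_le0.
have dp : 0 < dr + 1 by lra.
rewrite -(ler_pM2r dp) mulrDl mulNr.
rewrite (_ : _ / (6 * (dr + 1)) * (dr + 1) = 529 * 92 / 3750 * dr ^+ 2 * (ln dr - ln eps));
  last first.
  by field; rewrite gt_eqF.
have h1 : (8 * dr + 1) * (dr + 1) <= 529 * 92 / 3750 * dr ^+ 2 by nra.
have h2 : dr + 1 <= 529 * 92 / 3750 * dr ^+ 2 by nra.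
have h3 : (8 * dr + 1) * (dr + 1) * ln dr <= 529 * 92 / 3750 * dr ^+ 2 * ln dr.
  by apply: ler_wpM2r => //; lra.
have h4 : (dr + 1) * (- ln eps) <= 529 * 92 / 3750 * dr ^+ 2 * (- ln eps).
  by apply: ler_wpM2r => //; rewrite oppr_ge0.
lra.
Qed.

Lemma maxerr_tail : t <= 1 / 6 ->
  1 - eps <= \sum_(w : Om | X w <= 23 / 25 * t) sample_prob w.
Proof.
have /andP[a0 a1] := halpha; have np := natr_n_gt0; have hd := natr_d_ge2.
have t0 := threshold_gt0; have /andP[e0 _] := heps.
move=> t6; have hexp := tail_exponent (erefl _) (erefl _).
set s := 23 / 25 * t in hexp *; set th := _ / (3 * (dr + 1)) in hexp.
have s0 : 0 <= s by rewrite /s mulr_ge0 // ltW.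
have th0 : 0 <= th.
  by rewrite /th divr_ge0 ?mulr_ge0 ?sqr_ge0 ?(ltW np) //; lra.
have hth : th * (2 * d.+1%:R / alpha) <= n%:R / 4.
  rewrite natr_dS -/nr (_ : th * _ = nr * (2 / 3 * alpha * s)); last first.
    by rewrite /th; field; rewrite !gt_eqF //; lra.
  apply: ler_wpM2l; first exact: ltW.
  have : alpha * s <= 1 * s by apply: ler_wpM2r => //; apply: ltW.
  by rewrite /s; lra.
have := tail_bound s th0 (mgf_total th0 hth).
rewrite natr_net_exponent natr_dS -/nr -/dr; apply: le_trans; rewrite lerD2l lerN2.
by rewrite -[X in _ <= X]lnK ?posrE // ler_expR.
Qed.

(** With th^2 = n alpha^2 L and a = 12 d L, the exponential moment says that the
    exponential of th X - a has mean at most 1. As y^2 <= 4 exp y for y >= 0, the second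
    moment of th X is at most 2 a^2 + 8, and division by th^2 replaces the squared
    logarithm by a single one. *)
Lemma second_moment : 64 * (dr + 1) ^+ 2 * L <= nr ->
  \sum_(w : Om) sample_prob w * X w ^+ 2 <= 296 * (dr ^+ 2 * L / (nr * alpha ^+ 2)).
Proof.
have /andP[a0 a1] := halpha; have np := natr_n_gt0; have hd := natr_d_ge2; have hL := log_ratio_ge.
have hl := ln_d_ge; have hle := ln_eps_le0; rewrite -/dr in hl.
move=> hn; pose th := Num.sqrt (nr * alpha ^+ 2 * L).
have Lp : 0 < L by lra.
have ap : 0 < alpha ^+ 2 by rewrite exprn_gt0.
have th2 : th ^+ 2 = nr * alpha ^+ 2 * L.
  by rewrite sqr_sqrtr // !mulr_ge0 ?ltW.
have th0 : 0 <= th by apply: sqrtr_ge0.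
have hth : th * (2 * d.+1%:R / alpha) <= n%:R / 4.
  rewrite natr_dS -/nr -ler_sqr ?nnegrE ?mulr_ge0 ?invr_ge0 ?(ltW a0) ?(ltW np) //; last by lra.
  have -> : (th * (2 * (dr + 1) / alpha)) ^+ 2 = 64 * (dr + 1) ^+ 2 * L * (nr / 16).
    by rewrite exprMn th2; move: (L) => l; field; rewrite gt_eqF.
  rewrite (_ : (nr / 4) ^+ 2 = nr * (nr / 16)); last by field.
  by apply: ler_wpM2r => //; rewrite divr_ge0 // ltW.
pose a : R := 12 * dr * L.
have hm : \sum_(w : Om) sample_prob w * expR (th * X w - a) <= 1.
  under eq_bigr do rewrite expRD mulrA.
  rewrite -mulr_suml expRN ler_pdivrMr ?expR_gt0 // mul1r.
  apply: le_trans (mgf_total th0 hth) _; rewrite ler_expR natr_net_exponent natr_dS th2 -/nr -/dr.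
  have -> : 3 / 2 * (dr + 1) * (nr * alpha ^+ 2 * L) / (nr * alpha ^+ 2) =
      3 / 2 * (dr + 1) * L.
    by move: (L) => l; field; rewrite !gt_eqF.
  have h1 : ln dr <= L by rewrite log_ratio_split -/dr; lra.
  have h2 : (8 * dr + 1) * ln dr <= (8 * dr + 1) * L by apply: ler_wpM2l => //; lra.
  have h3 : 5 * L <= 5 / 2 * dr * L by apply: ler_wpM2r; lra.
  by rewrite /a; move: h2 h3 Lp; move=> *; nra.
(* Either th X <= a, or its excess y over a satisfies y^2 <= 4 exp y. *)
have hpt w : (th * X w) ^+ 2 <= 2 * a ^+ 2 + 8 * expR (th * X w - a).
  have x0 : 0 <= th * X w by rewrite mulr_ge0 ?normr_ge0.
  have ha : 0 <= a by rewrite /a !mulr_ge0 //; lra.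
  have ex := expR_gt0 (th * X w - a).
  have [hxa|hxa] := leP (th * X w) a.
    have : (th * X w) ^+ 2 <= a ^+ 2 by rewrite ler_sqr ?nnegrE.
    by have := sqr_ge0 a; lra.
  set y := th * X w - a in ex *; have y0 : 0 < y by rewrite subr_gt0.
  have hy : y ^+ 2 <= 4 * expR y.
    have -> : expR y = expR (y / 2) ^+ 2 by rewrite -expRM_natl; congr expR; field.
    have h1 : y / 2 <= expR (y / 2) by apply: le_trans (expR_ge1Dx _); lra.
    have : (y / 2) ^+ 2 <= expR (y / 2) ^+ 2.
      by rewrite ler_sqr ?nnegrE ?expR_ge0 // divr_ge0 // ltW.
    by lra.
  rewrite (_ : th * X w = a + y); last by rewrite /y addrC subrK.
  by have := sqr_ge0 (a - y); lra.
have hsum : th ^+ 2 * \sum_(w : Om) sample_prob w * X w ^+ 2 <= 2 * a ^+ 2 + 8.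
  apply: (@le_trans _ _ (\sum_(w : Om) sample_prob w * (2 * a ^+ 2 + 8 * expR (th * X w - a)))).
    rewrite mulr_sumr; apply: ler_sum => w _.
    by rewrite mulrCA -exprMn ler_wpM2l ?(sample_prob_ge0 e halpha hrho).
  rewrite (eq_bigr (fun w => 2 * a ^+ 2 * sample_prob w +
    8 * (sample_prob w * expR (th * X w - a)))); last first.
    by move=> w _; ring.
  rewrite big_split /= -!mulr_sumr (sum_sample_prob n alpha hmub hrho) mulr1.
  by rewrite lerD2l -[X in _ <= X]mulr1 ler_wpM2l.
have hdL : 1 <= dr * L by nra.
have ha2 : 2 * a ^+ 2 + 8 <= 296 * (dr * L) ^+ 2.
  have : 1 <= (dr * L) ^+ 2 by rewrite expr_ge1 //; lra.
  by rewrite /a -mulrA exprMn; lra.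
have thp : 0 < th ^+ 2 by rewrite th2 !mulr_gt0.
rewrite -(ler_pM2l thp); apply: le_trans (le_trans hsum ha2) _.
rewrite th2 le_eqVlt; apply/orP; left; apply/eqP.
by move: (L) => l; field; rewrite !gt_eqF.
Qed.

End Bounds.

(** * Risk and rank recovery *)

Section Assembly.
Local Open Scope sesquilinear_scope.
Local Open Scope complex_scope.
Local Notation conjC := Num.Def.conjC.

(** The minimum with a constant covers the samples that are too small for
    [second_moment]: two states are at a bounded distance. *)
Lemma estimator_error (R : realType) (d n : nat) (alpha tau : R)
    (e : 'I_d.+1 -> 'I_d -> 'cV[R[i]]_d) (d2 : (2 <= d)%N)
    (rho : 'M[R[i]]_d) rho_hat (w : {ffun 'I_n -> {ffun 'I_d -> bool} * 'I_d.+1}) :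
  0 < alpha < 1 -> complete_MUB e ->
  (1 <= \rank rho)%N -> state rho -> 0 <= tau ->
  is_rho_hat e alpha (4 * arctanh alpha) tau rho_hat ->
  frob_norm (rho_hat w - rho) ^+ 2 <=
    Num.min 24 (24 * (\rank rho)%:R * (25 / 23 * maxerr alpha e d2 rho w) ^+ 2) +
    10 * (\rank rho)%:R * tau ^+ 2.
Proof.
move=> halpha hmub r1 hrho tau0 hhat.
have [P [hP hB]] := hhat w; have sP : state P by case: hP.
have h1 := thresholded_error r1 tau0 hrho sP hB.
have h2 := projection_error hP hrho (rho_bar_adj alpha e w _) (err_form_bound alpha e d2 hrho w).
have h3 : sqnorm (P - rho) <= 4.
  have := sqnorm_sum_le P (- rho); rewrite sqnormN.
  have := state_sqnorm_le1 sP; have := state_sqnorm_le1 hrho.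
  by move: (sqnorm _) (sqnorm _) (sqnorm _) => *; lra.
rewrite frob_sq; apply: le_trans h1 _; rewrite lerD2r le_min.
by move: h2 h3; move: (sqnorm _) => N *; apply/andP; split; lra.
Qed.

Lemma sum_weighted_le (R : realType) (T : finType) (p f g : T -> R) :
  (forall w, 0 <= p w) -> (forall w, f w <= g w) ->
  \sum_w p w * f w <= \sum_w p w * g w.
Proof. by move=> hp h; apply: ler_sum => w _; apply: ler_wpM2l. Qed.

(** If n < 64 (d + 1)^2 L, then Q >= 1 / 144 and the constant 24 of
    [estimator_error] is absorbed; otherwise [second_moment] applies. *)
Lemma mean_square_error (R : realType) (d n : nat) (alpha eps : R)
    (e : 'I_d.+1 -> 'I_d -> 'cV[R[i]]_d) (rho : 'M[R[i]]_d) rho_hat :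
  (2 <= d)%N -> (1 <= n)%N -> 0 < alpha < 1 -> 0 < eps <= 1 ->
  complete_MUB e -> (1 <= \rank rho)%N -> state rho ->
  let t := Num.sqrt (92 * ln (d%:R / eps) * (d%:R ^+ 2 / (n%:R * alpha ^+ 2))) in
  is_rho_hat e alpha (4 * arctanh alpha) (2 * t) rho_hat ->
  \sum_(w : {ffun 'I_n -> {ffun 'I_d -> bool} * 'I_d.+1})
     sample_prob alpha e rho w * frob_norm (rho_hat w - rho) ^+ 2 <=
  13000 * (\rank rho)%:R * (d%:R ^+ 2 * ln (d%:R / eps) / (n%:R * alpha ^+ 2)).
Proof.
move=> d2 n1 halpha heps hmub r1 hrho t hhat.
have t0 : 0 <= t by apply: sqrtr_ge0.
have hL := log_ratio_ge d2 heps; have ht := threshold_sqr halpha d2 n1 heps.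
have hbound w : frob_norm (rho_hat w - rho) ^+ 2 <= _ :=
  estimator_error d2 w halpha hmub r1 hrho (mulr_ge0 (ler0n R 2) t0) hhat.
have /andP[a0 a1] := halpha.
have np : 0 < n%:R :> R by rewrite ltr0n.
have hd : 2 <= d%:R :> R by rewrite ler_nat.
have hr : 1 <= (\rank rho)%:R :> R by rewrite ler1n.
have a2 : 0 < alpha ^+ 2 by rewrite exprn_gt0.
have a21 : alpha ^+ 2 <= 1 by rewrite expr_le1 // ltW.
have p0 := sample_prob_ge0 e halpha hrho (n := n).
have p1 := sum_sample_prob n alpha hmub hrho.
have hmom := second_moment halpha hmub d2 n1 heps hrho.
set L : R := ln (d%:R / eps) in hL ht hmom *.
set Q := _ / (n%:R * alpha ^+ 2) in hmom *.
have na : 0 < n%:R * alpha ^+ 2 by rewrite mulr_gt0.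
have etQ : t ^+ 2 = 92 * Q.
  apply: (mulIf (lt0r_neq0 na)); rewrite ht /Q.
  by clearbody L; field; rewrite !gt_eqF.
set r : R := (\rank rho)%:R in hr hbound *.
have Q0 : 0 <= Q by rewrite /Q divr_ge0 ?(ltW na) // mulr_ge0 ?sqr_ge0 //; lra.
have rQ0 : 0 <= r * Q by rewrite mulr_ge0 //; lra.
have [hn|hn] := leP (64 * (d%:R + 1) ^+ 2 * L) n%:R.
  apply: (@le_trans _ _ (\sum_w sample_prob alpha e rho w *
    (24 * r * (25 / 23) ^+ 2 * maxerr alpha e d2 rho w ^+ 2 + 3680 * r * Q))).
    apply: sum_weighted_le => // w; apply: le_trans (hbound w) _.
    rewrite [(2 * t) ^+ 2]exprMn etQ.
    apply: lerD; last by lra.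
    rewrite ge_min; apply/orP; right; rewrite le_eqVlt; apply/orP; left.
    by apply/eqP; field.
  under eq_bigr do rewrite mulrDr mulrCA.
  rewrite big_split /= -mulr_sumr -mulr_suml p1 mul1r.
  have := hmom hn; move: (\sum_w _) => S hS.
  have : r * S <= r * (296 * Q) by apply: ler_wpM2l => //; lra.
  by lra.
have hQ : 1 <= 144 * Q.
  have hdd : (d%:R + 1) ^+ 2 <= 9 / 4 * d%:R ^+ 2 :> R by nra.
  have h1 : n%:R * alpha ^+ 2 <= 144 * (d%:R ^+ 2 * L).
    apply: (@le_trans _ _ n%:R); first by rewrite ler_piMr // ltW.
    apply: le_trans (ltW hn) _.
    have : (d%:R + 1) ^+ 2 * L <= 9 / 4 * d%:R ^+ 2 * L by apply: ler_wpM2r => //; lra.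
    by lra.
  by rewrite /Q mulrA ler_pdivlMr // mul1r.
have hrQ : 1 <= 144 * (r * Q).
  have : 1 * (144 * Q) <= r * (144 * Q) by apply: ler_wpM2r => //; lra.
  by lra.
apply: (@le_trans _ _ (\sum_w sample_prob alpha e rho w * (24 + 3680 * r * Q))).
  apply: sum_weighted_le => // w; apply: le_trans (hbound w) _.
  rewrite [(2 * t) ^+ 2]exprMn etQ.
  apply: lerD; last by lra.
  by rewrite ge_min lexx.
by rewrite -mulr_suml p1 mul1r; lra.
Qed.

Lemma lambda_min_le1 (R : realType) d (rho : 'M[R[i]]_d) :
  state rho -> (1 <= \rank rho)%N -> lambda_min rho <= 1.
Proof.
move=> hrho r1; have [Y [mu [hY erho]]] := hermitian_spectral (state_herm hrho).
have hS : #|[set i | mu i != 0]| = \rank rho by rewrite erho rank_spectral.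
have : (0 < #|[set i | (mu i != 0)%R]|)%N by rewrite hS.
case/card_gt0P => i; rewrite inE => hi.
apply: le_trans (lambda_min_le hrho hY erho hi) _.
have sY : state (Y *m rdiag mu *m Y ^t*) by rewrite -erho.
rewrite -(state_eig_sum hY sY) (bigD1 i) //= lerDl sumr_ge0 // => j _.
exact: state_eig_ge0 hY sY.
Qed.

End Assembly.

Theorem theorem8 (R : realType) :
  exists2 C : R, 0 < C &
  forall (d r n : nat) (alpha eps : R)
    (e : 'I_d.+1 -> 'I_d -> 'cV[R[i]]_d),
  (2 <= d)%N -> (1 <= r <= d)%N -> (1 <= n)%N ->
  0 < alpha < 1 -> 0 < eps <= 1 ->
  complete_MUB e ->
  let delta := 4 * arctanh alpha in
  let t := Num.sqrt (92 * ln (d%:R / eps) * (d%:R ^+ 2 / (n%:R * alpha ^+ 2))) in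
  forall rho_hat : {ffun 'I_n -> {ffun 'I_d -> bool} * 'I_d.+1} -> 'M[R[i]]_d,
  is_rho_hat e alpha delta (2 * t) rho_hat ->
  let M := @M_delta_n R n d e delta in
  let copies (rho : 'M[R[i]]_d) := tensor (fun _ : 'I_n => rho) in
  [/\ locally_gentle alpha M,
      (ereal_sup
        [set (expectation M (copies rho)
                (fun w => frob_norm (rho_hat w - rho) ^+ 2))%:E
        | rho in @state_of_rank R d r]%classic
       <= (C * (r%:R * d%:R ^+ 2 / (n%:R * alpha ^+ 2)) * ln (d%:R / eps))%:E)%E
    & forall rho : 'M[R[i]]_d, state_of_rank r rho ->
        6 * t <= lambda_min rho ->
        1 - eps <= probability_of M (copies rho)
                     (fun w => \rank (rho_hat w) == r)].
Proof.
(* 13000 covers both regimes of mean_square_error: 8400 + 3680 and 3456 + 3680. *)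
exists 13000; first by rewrite ltr0n.
move=> d r n alpha eps e d2 /andP[r1 rd] n1 halpha heps hmub.
move=> delta t rho_hat hhat M copies; split.
- split; first exact: measurement_M_delta_n.
  exists (fun _ => M_delta e delta); split => // i; split.
    exact: measurement_M_delta.
  exact: gentle_M_delta.
- apply: ge_ereal_sup => _ [rho [hrho hr] <-]; rewrite lee_fin.
  rewrite /expectation (eq_bigr (fun w =>
    sample_prob alpha e rho w * frob_norm (rho_hat w - rho) ^+ 2)).
    rewrite -hr in r1; apply: le_trans (mean_square_error d2 n1 halpha heps hmub r1 hrho hhat) _.
    rewrite hr le_eqVlt; apply/orP; left; apply/eqP; ring.
  by move=> w _; rewrite (outcome_probE halpha hmub) // state_herm.
- move=> rho [hrho hr] hl; rewrite -hr in r1.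
  have t0 : 0 < t := threshold_gt0 halpha d2 n1 heps.
  have t6 : t <= 1 / 6 by have := lambda_min_le1 hrho r1; lra.
  apply: le_trans (maxerr_tail halpha hmub d2 n1 heps hrho t6) _.
  rewrite /probability_of big_mkcond [X in _ <= X]big_mkcond; apply: ler_sum => w _.
  rewrite (outcome_probE halpha hmub) ?state_herm //.
  case: ifP => [hw|_]; last by case: ifP => // _; apply: sample_prob_ge0.
  suff -> : \rank (rho_hat w) == r by [].
  have [P [hP hB]] := hhat w; rewrite -hr; apply/eqP.
  apply: (rank_recovery r1 t0 hl hrho (rho_bar_adj alpha e w _) hP _ hB).
  move=> v; apply: le_trans (err_form_bound alpha e d2 hrho w v) _.
  rewrite ler_wpM2r ?sqnorm_ge0 //; move: hw; rewrite -/t => hw.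
  have : 25 / 23 * maxerr alpha e d2 rho w <= 25 / 23 * (23 / 25 * t) by apply: ler_wpM2l.
  by lra.
Qed.
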